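(* Assume that $\infty$ is regular or an exit. A linear operator $\mathscr L$ with domain $\mathcal D(\mathscr L)$ on $C(\mathbb N\cup\{\infty\})$ is the infinitesimal generator of a Feller $Q$-process $X$ on $\mathbb N\cup\{\infty\}\cup\{\partial\}$ if and only if there exists a triple $(\nu,\gamma,\beta)$, unique up to a positive multiplicative constant, consisting of a positive measure $\nu$ on $\mathbb N$ and constants $\gamma,\beta\ge0$, satisfying (a) $\sum_{k\ge0}\nu_k\Big(\sum_{j=k}^\infty(c_{j+1}-c_j)\sum_{i=0}^j\mu_i\Big)<\infty$ and $|\nu|+\beta\ne0$; (b) $\beta=0$ if $\infty$ is an exit; (c) $|\nu|=\infty$ or $\beta>0$; such that $$\mathcal D(\mathscr L)=\Big\{F\in\mathcal D(Q):\ \frac{\beta}{2}F^+(\infty)+\sum_{k\ge0}(F(\infty)-F(k))\nu_k+\gamma F(\infty)=0\Big\}$$ and $\mathscr LF=QF$ for $F\in\mathcal D(\mathscr L)$. Here, when $\infty$ is an exit, $\beta F^+(\infty):=0$ even if $F^+(\infty)$ does not exist; otherwise $F^+(\infty)$ and the sum $\sum_{k\ge0}(F(\infty)-F(k))\nu_k$ are assumed to be well defined for every $F$ in this family. In this case, the resolvent matrix of $X$ is given by this triple through $$R_\alpha(i,\{j\})=\Phi_{ij}(\alpha)+u_\alpha(i)\,\frac{\sum_{k\ge0}\nu_k\Phi_{kj}(\alpha)+\beta\mu_ju_\alpha(j)}{\gamma+\sum_{k\ge0}\nu_k(1-u_\alpha(k))+\beta\alpha\sum_{k\ge0}\mu_ku_\alpha(k)},\qquad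 \alpha>0,\ i,j\in\mathbb N.$$
   Context: Setting. $\mathbb N=\{0,1,2,\dots\}$. Let $a_0=0$, $a_k>0$ ($k\ge1$), $b_k>0$ ($k\ge 0$), $q_k=a_k+b_k$, and let $Q=(q_{ij})_{i,j\in\mathbb N}$ be the tridiagonal matrix with $q_{kk}=-q_k$, $q_{k,k+1}=b_k$, $q_{k,k-1}=a_k$, all other entries $0$. A transition matrix $(p_{ij}(t))_{i,j\in\mathbb N,t\ge0}$ is a nonnegative semigroup of matrices with row sums $\le 1$; it is extended to an honest one (row sums $1$) on $\mathbb N\cup\{\partial\}$ by adding a trap $\partial$. It is standard if $\lim_{t\to0}p_{ij}(t)=\delta_{ij}$. A $Q$-process is a continuous-time Markov chain whose transition matrix is standard with $p_{ij}'(0)=q_{ij}$ for all $i,j\in\mathbb N$; two $Q$-processes with the same transition matrix are identified. The minimal $Q$-process has the smallest transition matrix: $p^{\min}_{ij}(t)\le p_{ij}(t)$ for every $Q$-process. Put $\mu_0=1$, $\mu_k=\frac{b_0\cdots b_{k-1}}{a_1\cdots a_k}$, $c_0=0$, $c_1=\frac1{2b_0}$, $c_k=\frac1{2b_0}+\sum_{i=2}^k\frac{a_1\cdots a_{i-1}}{2b_0b_1\cdots b_{i-1}}$ ($k\ge2$), $\sigma=\sum_{k\ge0}(c_{k+1}-c_k)\sum_{i=0}^k\mu_i$, $\lambda=\sum_{k\ge0}c_k\mu_k$. The boundary $\infty$ is regular if $\sigma<\infty,\lambda<\infty$; an exit if $\sigma<\infty,\lambda=\infty$. $\Phi_{ij}(\alpha)=\int_0^\infty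 e^{-\alpha t}p^{\min}_{ij}(t)dt$; $u_\alpha(i)=\mathbf E_ie^{-\alpha\eta}=1-\alpha\sum_j\Phi_{ij}(\alpha)$, where $\eta$ is the lifetime of the minimal $Q$-process. For a positive measure $\nu$ on $\mathbb N$: $\nu_k=\nu(\{k\})$, $|\nu|=\sum_{k\ge0}\nu_k$. The resolvent matrix of a $Q$-process is $R_\alpha(i,\{j\})=\int_0^\infty e^{-\alpha t}p_{ij}(t)dt$. Operator $Q$. $\mathbb N\cup\{\infty\}$ is the Alexandroff compactification of discrete $\mathbb N$; a function $F$ on $\mathbb N$ is identified with an element of $C(\mathbb N\cup\{\infty\})$ if $F(\infty):=\lim_kF(k)$ exists (and is finite). For $F:\mathbb N\to\mathbb R$, $QF(k)=a_kF(k-1)-q_kF(k)+b_kF(k+1)$ with $F(-1):=0$; $\mathcal D(Q)=\{F\in C(\mathbb N\cup\{\infty\}):QF\in C(\mathbb N\cup\{\infty\})\}$. $F^+(k)=\frac{F(k+1)-F(k)}{c_{k+1}-c_k}$ and $F^+(\infty)=\lim_{k\to\infty}F^+(k)$ if it exists. Feller $Q$-process. Let $\mathbf F=\mathbb N\cup\{\infty\}\cup\{\partial\}$ with $\partial$ isolated. The Ray-Knight compactification of a $Q$-process is the càdlàg Ray process on $\mathbf F$ with Ray resolvent $\bar R_\alpha:C(\mathbf F)\to C(\mathbf F)$ determined by $\bar R_\alpha f(i)=\sum_{j\in\mathbb N\cup\{\partial\}}R_\alpha(i,\{j\})f(j)$ ($i\in\mathbb N\cup\{\partial\}$), $\bar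 R_\alpha f(\infty)=\lim_{i\to\infty}\bar R_\alpha f(i)$. A $Q$-process is identified with its Ray-Knight compactification and is called a Feller $Q$-process if $\infty$ is non-branching, i.e. $\alpha\bar R_\alpha f(\infty)\to f(\infty)$ as $\alpha\to\infty$ for all $f\in C(\mathbf F)$; it is then a Feller process on $\mathbf F$ whose semigroup $(P_t)$ acts on $C(\mathbb N\cup\{\infty\})$ (functions extended by $0$ at $\partial$) as a strongly continuous contraction semigroup. Its infinitesimal generator is $\mathscr LF=\lim_{t\downarrow0}(P_tF-F)/t$, limit in the uniform norm of $C(\mathbb N\cup\{\infty\})$, with domain the set of $F\in C(\mathbb N\cup\{\infty\})$ for which the limit exists. *)

(* Defs.v *)
From HB Require Import structures.
From mathcomp Require Import all_boot all_order all_algebra.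
From mathcomp Require Import all_classical all_reals all_analysis.

Set Implicit Arguments.
Unset Strict Implicit.
Unset Printing Implicit Defensive.

Import Order.TTheory GRing.Theory Num.Theory.
Import numFieldNormedType.Exports.

Local Open Scope classical_set_scope.
Local Open Scope ring_scope.

(* The Alexandroff compactification of discrete nat: [Some k] is the state k and
   [None] is the point at infinity. *)
Notation nbar := (one_point_compactification nat).

(* nat together with the trap [None], as a discrete space. *)
Notation ntrap := (discrete_topology (option nat)).

(* The state space nat, infinity, trap.  Compactifying the discrete space
   [ntrap] leaves the trap isolated: [Some (Some k)] is k, [Some None] is the
   trap and [None] is infinity. *)
Notation fspace := (one_point_compactification ntrap).

Definition nbar_incl (x : nbar) : fspace :=
  if x is Some k then Some (Some k) else None.

Section definitions.
Context {R : realType}.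
Implicit Types (a b : nat -> R) (p : R -> nat -> nat -> R).

Definition rsum (h : nat -> R) : R := limn (series h).

Section rates.
Variables a b : nat -> R.

Definition rates : Prop :=
  [/\ a 0%N = 0, forall k, 0 < a k.+1 & forall k, 0 < b k].

Definition Qmatrix (i j : nat) : R :=
  if j == i then - (a i + b i)
  else if j == i.+1 then b i
  else if i == j.+1 then a i
  else 0.

Definition mu (k : nat) : R :=
  (\prod_(0 <= i < k) b i) / (\prod_(1 <= i < k.+1) a i).

Definition scale (k : nat) : R :=
  if k is 0 then 0 else
  (2 * b 0%N)^-1 +
  \sum_(2 <= i < k.+1) (\prod_(1 <= l < i) a l) / (2 * \prod_(0 <= l < i) b l).

Definition sigma_term (k : nat) : \bar R :=
  ((scale k.+1 - scale k) * \sum_(0 <= i < k.+1) mu i)%:E.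

Definition sigma : \bar R := (\sum_(0 <= k <oo) sigma_term k)%E.

Definition lambda : \bar R := (\sum_(0 <= k <oo) (scale k * mu k)%:E)%E.

Definition regular_bd : bool := (sigma < +oo)%E && (lambda < +oo)%E.
Definition exit_bd : bool := (sigma < +oo)%E && (lambda == +oo)%E.

(* Transition matrices [p t i j]; only times t >= 0 are relevant. *)
Definition transition_matrix p : Prop :=
  [/\ forall t i j, 0 <= t -> 0 <= p t i j,
      forall t i, 0 <= t -> (\sum_(0 <= j <oo) (p t i j)%:E <= 1)%E,
      forall i j, p 0 i j = (i == j)%:R &
      forall s t i j, 0 <= s -> 0 <= t ->
        ((p (s + t) i j)%:E = \sum_(0 <= k <oo) (p s i k * p t k j)%:E)%E].

Definition standard p : Prop :=
  forall i j, p t i j @[t --> 0^'+] --> ((i == j)%:R : R).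

Definition Q_process p : Prop :=
  [/\ transition_matrix p, standard p &
      forall i j, (p t i j - p 0 i j) / t @[t --> 0^'+] --> Qmatrix i j].

Definition minimal_Q_process pm : Prop :=
  Q_process pm /\
  forall p, Q_process p -> forall t i j, 0 <= t -> pm t i j <= p t i j.

End rates.

Definition laplace (alpha : R) (h : R -> R) : R :=
  \int[lebesgue_measure]_(t in `[0, +oo[) (expR (- (alpha * t)) * h t).

Definition resolvent p (alpha : R) (i j : nat) : R :=
  laplace alpha (fun t => p t i j).

(* Honest extension of p by the trap [None]. *)
Definition honest_ext p (t : R) (x y : ntrap) : R :=
  match x, y with
  | Some i, Some j => p t i j
  | Some i, None => 1 - rsum (p t i)
  | None, Some _ => 0
  | None, None => 1
  end.

Definition kernel_sum (K : ntrap -> ntrap -> R) (f : fspace -> R) (x : ntrap)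
    : R :=
  rsum (fun j => K x (Some j) * f (Some (Some j))) + K x None * f (Some None).

Definition kernel_op (K : ntrap -> ntrap -> R) (f : fspace -> R) (x : fspace)
    : R :=
  if x is Some y then kernel_sum K f y
  else limn (fun i => kernel_sum K f (Some i)).

Definition ray_resolvent p (alpha : R) : (fspace -> R) -> fspace -> R :=
  kernel_op (fun x y => laplace alpha (fun t => honest_ext p t x y)).

(* A Q-process is identified with its transition matrix.  The second clause
   says that the limit defining the Ray resolvent at infinity exists, so that it
   acts on C(fspace); the third that infinity is non-branching. *)
Definition Feller_Q_process a b p : Prop :=
  [/\ Q_process a b p,
      forall alpha (f : fspace -> R), 0 < alpha -> continuous f ->
        continuous (ray_resolvent p alpha f) &
      forall f : fspace -> R, continuous f ->
        alpha * ray_resolvent p alpha f None @[alpha --> +oo] --> f None].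

Definition zero_ext (F : nbar -> R) (x : fspace) : R :=
  match x with
  | Some (Some k) => F (Some k)
  | Some None => 0
  | None => F None
  end.

(* The semigroup acting on C(nbar), functions being extended by 0 at the trap. *)
Definition Feller_semigroup p (t : R) (F : nbar -> R^o) : nbar -> R^o :=
  fun x => kernel_op (honest_ext p t) (zero_ext F) (nbar_incl x).

Definition generator_lim p (F G : nbar -> R^o) : Prop :=
  {uniform, (t^-1 *: (Feller_semigroup p t F - F)) @[t --> 0^'+] --> G}.

Definition linear_operator (D : set (nbar -> R^o))
    (L : (nbar -> R^o) -> nbar -> R^o) : Prop :=
  [/\ forall F, D F -> continuous F /\ continuous (L F),
      D 0 &
      forall (r : R) F G, D F -> D G ->
        D (r *: F + G) /\ L (r *: F + G) = r *: L F + L G].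

Definition is_generator p (D : set (nbar -> R^o))
    (L : (nbar -> R^o) -> nbar -> R^o) : Prop :=
  D = [set F | continuous F /\ exists2 G, continuous G & generator_lim p F G] /\
  forall F, D F -> generator_lim p F (L F).

(* A sequence h is identified with an element of C(nbar) exactly when
   [cont_ext h] is continuous, i.e. when h converges. *)
Definition cont_ext (h : nat -> R) : nbar -> R^o :=
  fun x => if x is Some k then h k else limn h.

Section boundary.
Variables a b : nat -> R.

Definition Qop (F : nbar -> R^o) : nbar -> R^o :=
  cont_ext (fun k => a k * (if k is j.+1 then F (Some j) else 0)
                     - (a k + b k) * F (Some k) + b k * F (Some k.+1)).

Definition Qdomain : set (nbar -> R^o) :=
  [set F | continuous F /\ continuous (Qop F)].

Definition right_deriv (F : nbar -> R) (k : nat) : R :=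
  (F (Some k.+1) - F (Some k)) / (scale a b k.+1 - scale a b k).

Notation positive_measure := {measure set nat -> \bar R}.

Definition total_mass (nu : positive_measure) : \bar R :=
  (\sum_(0 <= k <oo) nu [set k])%E.

Definition admissible (nu : positive_measure) (gamma beta : R) : Prop :=
  [/\ 0 <= gamma /\ 0 <= beta,
      (\sum_(0 <= k <oo) nu [set k] * \sum_(k <= j <oo) sigma_term a b j
         < +oo)%E,
      (total_mass nu + beta%:E != 0)%E,
      exit_bd a b -> beta = 0 &
      total_mass nu = +oo%E \/ 0 < beta].

(* The summability clause of [admissible] makes every nu [set k] finite, so
   [fine] loses nothing there. *)
Definition jump_term (nu : positive_measure) (F : nbar -> R) (k : nat) : R :=
  (F None - F (Some k)) * fine (nu [set k]).

Definition boundary_condition (nu : positive_measure) (gamma beta : R)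
    (F : nbar -> R) : Prop :=
  [/\ ~~ exit_bd a b -> cvgn (right_deriv F),
      cvgn (series (jump_term nu F)) &
      (if exit_bd a b then 0 else beta / 2 * limn (right_deriv F))
      + rsum (jump_term nu F) + gamma * F None = 0].

Definition boundary_triple (D : set (nbar -> R^o))
    (L : (nbar -> R^o) -> nbar -> R^o)
    (nu : positive_measure) (gamma beta : R) : Prop :=
  [/\ admissible nu gamma beta,
      D = [set F | Qdomain F /\ boundary_condition nu gamma beta F] &
      forall F, D F -> L F = Qop F].

Definition proportional (nu : positive_measure) (gamma beta : R)
    (nu' : positive_measure) (gamma' beta' : R) : Prop :=
  exists2 r : R, 0 < r &
    [/\ forall A, (nu' A = r%:E * nu A)%E, gamma' = r * gamma &
        beta' = r * beta].

(* For the minimal [pm], this is the Laplace transform at alpha of the lifetime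
   of the minimal Q-process started at i. *)
Definition u_fun pm (alpha : R) (i : nat) : R :=
  1 - alpha * rsum (resolvent pm alpha i).

(* Extended-real arithmetic, where 0 * +oo = 0: this is used when infinity is an
   exit, in which case beta = 0 and the last series of the denominator
   diverges. *)
Definition resolvent_formula pm (nu : positive_measure) (gamma beta alpha : R)
    (i j : nat) : \bar R :=
  let Phi := resolvent pm alpha in
  let u := u_fun pm alpha in
  ((Phi i j)%:E +
   (u i)%:E *
   ((\sum_(0 <= k <oo) nu [set k] * (Phi k j)%:E + (beta * mu a b j * u j)%:E) /
    (gamma%:E + \sum_(0 <= k <oo) nu [set k] * (1 - u k)%:E
     + (beta * alpha)%:E * \sum_(0 <= k <oo) (mu a b k * u k)%:E)))%E.

End boundary.
End definitions.

(* Main.v *)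
Require Import Defs.
From HB Require Import structures.
From mathcomp Require Import all_boot all_order all_algebra.
From mathcomp Require Import all_classical all_reals all_analysis.
From mathcomp Require Import measurable_realfun.
From mathcomp Require Import ring lra zify.

Set Implicit Arguments.
Unset Strict Implicit.
Unset Printing Implicit Defensive.

Import Order.TTheory GRing.Theory Num.Theory.
Import numFieldNormedType.Exports.

Local Open Scope classical_set_scope.
Local Open Scope ring_scope.

(* For a Q-process, alpha - Q maps R_alpha G to G; since sigma < oo, the kernel of
   alpha - Q consists of the multiples of u_alpha, whence
   R_alpha(i,j) = Phi_ij + u_i r_j for some weights r_j >= 0.  A maximum principle
   at infinity shows that the generator of a Feller Q-process is Q restricted to
   the kernel of Lam F = F(oo) - sum_j r_j (alpha F - QF)_j, and that
   Lam F <= 0 if F >= 0 and F, QF vanish at infinity.  Hence nu_k = - Lam(1_k)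
   is nonnegative; as Q is mu-symmetric, (alpha - Q)(r / mu) = nu / mu, and the
   Riesz decomposition of the supersolution r / mu reads
   r_j = sum_k nu_k Phi_kj + beta mu_j u_j, which is the triple.  If |nu| < oo and
   beta = 0, Lam is continuous for the uniform norm and vanishes on a dense
   domain, although Lam u = 1: this is excluded by (c).

   Conversely, the kernel of the resolvent formula satisfies the boundary
   condition, and its range is dense because the denominator is unbounded in
   alpha.  The semigroup is the limit of backward Euler iterates along dyadic
   steps.  It charges nat only: mass at infinity would survive for a positive
   time and be seen by the resolvent, which is carried by nat.

   The minimal process is dominated by the process of (nu, gamma + c, beta) for
   all c >= 0, and letting c tend to oo identifies its resolvent with Phi. *)

(** * Absolutely summable sequences *)

(** Both directions meet in [BC_eq]: if al F - QF = G, then BC F = F(oo) denom - sum_j numer_j G_j.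
    The left side does not contain al, so one boundary functional serves every resolvent. The triple
    is therefore extracted at al = 1 only and normalised by [denom 1 = 1], which makes gamma the
    missing mass 1 - sum_j r_j. The term beta F^+(oo) / 2 enters as beta sum_i mu_i QF(i), by
    summation by parts.

    Two obstacles shape the estimates. Differentiability of p at time 0 is pointwise in the state,
    whereas the generator is a uniform limit; hence expansions in t come with explicit errors
    depending on sup norms and moduli of continuity alone. And BC dlt_k = - nu_k, so the functions
    dlt_k are in general outside the domain: the derivative of the constructed transition matrix
    cannot be read off its generator, and is reached through a pointwise Lipschitz bound.

    When infinity is an exit, sum_i mu_i diverges; beta = 0 removes the terms where it would
    occur. *)

Section absolute_series.
Context {R : realType}.
Implicit Types (f g h : nat -> R) (M e l : R).

Lemma cvgn_epsP f l : f @ \oo --> l <->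
  forall e, 0 < e -> exists N, forall n, (N <= n)%N -> `|f n - l| <= e.
Proof.
split=> [fl e e0|H].
  have /cvgrPdist_le/(_ e e0)[N _ HN] := fl.
  by exists N => n Nn; rewrite distrC; apply: HN.
apply/cvgrPdist_le => e e0; have [N HN] := H e e0.
by exists N => // n Nn; rewrite distrC; apply: HN.
Qed.

Lemma cvg_right0_epsP (f : R -> R) l : f t @[t --> 0^'+] --> l <->
  forall e, 0 < e -> exists2 d, 0 < d & forall t, 0 < t -> t < d -> `|f t - l| <= e.
Proof.
split=> [fl e e0|H].
  have /cvgrPdist_le/(_ e e0) := fl.
  rewrite near_withinE => -[d /= d0 Hd]; exists d => // t t0 td.
  by rewrite distrC; apply: Hd => //=; rewrite distrC subr0 gtr0_norm.
apply/cvgrPdist_le => e e0; have [d d0 Hd] := H e e0.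
rewrite near_withinE; exists d => //= t /=; rewrite distrC subr0 => td t0.
by rewrite distrC; apply: Hd => //; rewrite -(gtr0_norm t0).
Qed.

Lemma cvg_pinfty_epsP (f : R -> R) l : f t @[t --> +oo] --> l <->
  forall e, 0 < e -> exists A, forall t, A < t -> `|f t - l| <= e.
Proof.
split=> [fl e e0|H].
  have /cvgrPdist_le/(_ e e0)[A [_ HA]] := fl.
  by exists A => t At; rewrite distrC; apply: HA.
apply/cvgrPdist_le => e e0; have [A HA] := H e e0.
by exists A; split; [exact: num_real|move=> t At; rewrite distrC; apply: HA].
Qed.

Lemma cvg_fsum (T : Type) (Fl : set_system T) {FF : Filter Fl} (f : nat -> T -> R)
    (l : nat -> R) n : (forall i, f i @ Fl --> l i) ->
  (fun x => \sum_(0 <= i < n) f i x) @ Fl --> \sum_(0 <= i < n) l i.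
Proof.
move=> fl; elim: n => [|n IH].
  by rewrite big_geq //; under eq_fun do rewrite big_geq //; exact: cvg_cst.
by rewrite big_nat_recr //=; under eq_fun do rewrite big_nat_recr //=; exact: cvgD.
Qed.

Lemma le_eps (x y : R) : (forall e, 0 < e -> x <= y + e) -> x <= y.
Proof. by move=> H; apply/ler_addgt0Pr => e e0; apply: H. Qed.

Lemma eq_eps (x y C : R) : (forall e, 0 < e -> `|x - y| <= C * e) -> x = y.
Proof.
move=> H; apply/eqP; rewrite -subr_eq0 -normr_le0; apply/ler_addgt0Pr => e e0.
have C1 : 0 < `|C| + 1 by rewrite ltr_wpDl.
(* C may vanish, so the error is rescaled by |C| + 1 instead of C. *)
have := H (e / (`|C| + 1)) (divr_gt0 e0 C1).
move/le_trans; apply; rewrite add0r mulrCA ler_piMr ?(ltW e0)//.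
by rewrite ler_pdivrMr // mul1r (le_trans (ler_norm _)) // lerDl.
Qed.

Lemma limn_le f M : cvgn f -> (forall k, f k <= M) -> limn f <= M.
Proof. by move=> cf fM; apply: limr_le => //; apply: nearW. Qed.

Lemma limn_ge f M : cvgn f -> (forall k, M <= f k) -> M <= limn f.
Proof. by move=> cf fM; apply: limr_ge => //; apply: nearW. Qed.

Lemma limn_norm_le f M : cvgn f -> (forall k, `|f k| <= M) -> `|limn f| <= M.
Proof.
move=> cf fM; rewrite ler_norml; apply/andP; split.
  by apply: limn_ge => // k; have := fM k; rewrite ler_norml => /andP[].
by apply: limn_le => // k; have := fM k; rewrite ler_norml => /andP[].
Qed.

Lemma cvgn_le_lim f g (l m : R) : f @ \oo --> l -> g @ \oo --> m ->
  (forall k, f k <= g k) -> l <= m.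
Proof.
by move=> fl gm fg; apply: (ler_cvg_to fl gm); apply: nearW.
Qed.

Lemma cvgn_unif f :
  (forall e, 0 < e -> exists2 h, cvgn h & forall k, `|f k - h k| <= e) -> cvgn f.
Proof.
move=> H; apply/cauchy_cvgP/cauchy_exP => e e0.
have [h ch fh] := H (e / 4) ltac:(lra).
have /cvgn_epsP/(_ (e / 8) ltac:(lra)) [N HN] := ch.
have Nn := leqnn N; exists (f N), N => // m /= Nm; set n := N; rewrite /ball /=.
have := fh m; have := fh n; have := HN m Nm; have := HN n Nn.
rewrite !ler_distl => /andP[A1 A2] /andP[B1 B2] /andP[C1 C2] /andP[D1 D2].
rewrite ltr_distl; apply/andP; split; lra.
Qed.

Lemma cvgn_bounded f : cvgn f -> exists2 M, 0 <= M & forall k, `|f k| <= M.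
Proof.
move=> /cvg_seq_bounded [M [_ HM]].
exists (`|M| + 1) => [|k]; first by rewrite addr_ge0.
by apply: HM => //; rewrite (le_lt_trans (ler_norm _)) // ltrDl.
Qed.

(** Absolute convergence, because it passes to dominated sequences. Every identity on [rsum] needs
    such a hypothesis: [rsum] is a limit, with a default value when the series diverges. *)
Definition asum h : Prop := cvgn (series (fun k => `|h k|)).

Lemma asum_cvg h : asum h -> cvgn (series h).
Proof. exact: normed_cvg. Qed.

Lemma asum_norm h : asum h -> asum (fun k => `|h k|).
Proof. by rewrite /asum; under [X in _ -> cvgn (series X)]eq_fun do rewrite normr_id. Qed.

Lemma asum_dom h g : asum g -> (forall k, `|h k| <= `|g k|) -> asum h.
Proof. by move=> cg hg; apply: (@series_le_cvg _ _ (fun k => `|g k|)). Qed.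

Lemma asumZ c h : asum h -> asum (fun k => c * h k).
Proof.
move=> ch; rewrite /asum.
have -> : (fun k => `|c * h k|) = `|c| *: (fun k => `|h k|).
  by apply/funext => k; rewrite normrM.
exact: is_cvg_seriesZ.
Qed.

Lemma asumD h g : asum h -> asum g -> asum (fun k => h k + g k).
Proof.
move=> ch cg; apply: (@series_le_cvg _ _ (fun k => `|h k| + `|g k|)) => //.
- by move=> k; exact: ler_normD.
- exact: (is_cvg_seriesD ch cg).
Qed.

Lemma asumN h : asum h -> asum (fun k => - h k).
Proof. by move=> ch; apply: asum_dom ch _ => k; rewrite normrN. Qed.

Lemma asumB h g : asum h -> asum g -> asum (fun k => h k - g k).
Proof. by move=> ch cg; apply: asumD => //; apply: asumN. Qed.

Lemma asum_mulr h g M : asum h -> (forall k, `|g k| <= M) ->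
  asum (fun k => h k * g k).
Proof.
move=> ch gM; have H := asumZ (c := M) ch; apply: (asum_dom H) => k.
by rewrite !normrM mulrC ler_wpM2r // (le_trans (gM k)) // ler_norm.
Qed.

Lemma rsum_cvg h : asum h -> series h @ \oo --> rsum h.
Proof. exact: asum_cvg. Qed.

Lemma rsum_eq h l : series h @ \oo --> l -> rsum h = l.
Proof. by move=> hl; apply/cvg_lim. Qed.

Lemma rsumD h g : asum h -> asum g -> rsum (fun k => h k + g k) = rsum h + rsum g.
Proof.
move=> ch cg; apply: rsum_eq.
have -> : (fun k => h k + g k) = h + g by [].
by rewrite seriesD; apply: cvgD; apply: rsum_cvg.
Qed.

Lemma rsumZ c h : asum h -> rsum (fun k => c * h k) = c * rsum h.
Proof.
move=> ch; apply: rsum_eq; have -> : (fun k => c * h k) = c *: h by [].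
by rewrite seriesZ; apply: cvgZr; apply: rsum_cvg.
Qed.

Lemma rsumN h : asum h -> rsum (fun k => - h k) = - rsum h.
Proof.
move=> ch; rewrite -[RHS]mulN1r -rsumZ //; congr rsum.
by apply/funext => k; rewrite mulN1r.
Qed.

Lemma rsumB h g : asum h -> asum g -> rsum (fun k => h k - g k) = rsum h - rsum g.
Proof. by move=> ch cg; rewrite rsumD ?rsumN //; exact: asumN. Qed.

Lemma ler_rsum h g : asum h -> asum g -> (forall k, h k <= g k) -> rsum h <= rsum g.
Proof.
move=> ch cg hg; apply: (cvgn_le_lim (rsum_cvg ch) (rsum_cvg cg)) => n.
by rewrite /series /= ler_sum.
Qed.

Lemma rsum_ge0 h : asum h -> (forall k, 0 <= h k) -> 0 <= rsum h.
Proof. by move=> ch h0; apply: limn_ge; [exact: asum_cvg|move=> n; exact: sumr_ge0]. Qed.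

Lemma rsum_norm h g : asum g -> (forall k, `|h k| <= g k) -> `|rsum h| <= rsum g.
Proof.
move=> cg hg; have ch : asum h by apply: asum_dom cg _ => k; rewrite (le_trans (hg k)) // ler_norm.
rewrite ler_norml -rsumN //; apply/andP; split; (apply: ler_rsum => // [|k]; first exact: asumN) || apply: ler_rsum => // k.
- by have := hg k; rewrite ler_norml => /andP[].
- by have := hg k; rewrite ler_norml => /andP[].
Qed.

Lemma rsum_part h n : asum h -> (forall k, 0 <= h k) -> \sum_(0 <= k < n) h k <= rsum h.
Proof.
move=> ch h0; apply: (@limr_ge _ _ _ _ _ (series h)); first exact: asum_cvg.
exists n => // m /= nm; apply: nondecreasing_series => // k _ _; exact: h0.
Qed.

Lemma rsum_term h k : asum h -> (forall k, 0 <= h k) -> h k <= rsum h.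
Proof.
move=> ch h0; apply: le_trans (rsum_part k.+1 ch h0).
by rewrite big_nat_recr //= lerDr sumr_ge0.
Qed.

Lemma asum_bound h M : (forall k, 0 <= h k) ->
  (forall n, \sum_(0 <= k < n) h k <= M) -> asum h /\ rsum h <= M.
Proof.
move=> h0 hM; have ch : asum h.
  rewrite /asum; have -> : (fun k => `|h k|) = h by apply/funext => k; rewrite ger0_norm.
  apply: nondecreasing_is_cvgn; first by apply: nondecreasing_series => k _ _; exact: h0.
  by exists M => _ [n _ <-]; exact: hM.
by split => //; apply: limn_le => //; exact: asum_cvg.
Qed.

Lemma rsum_fin h n : (forall k, (n <= k)%N -> h k = 0) ->
  asum h /\ rsum h = \sum_(0 <= k < n) h k.
Proof.
move=> h0; have E g m : (forall k, (n <= k)%N -> g k = 0) -> (n <= m)%N ->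
    \sum_(0 <= k < m) g k = \sum_(0 <= k < n) g k :> R.
  move=> g0 nm; rewrite (big_cat_nat (leq0n n) nm) /= [X in _ + X]big_nat_cond [X in _ + X]big1 ?addr0 //.
  by move=> k /andP[/andP[+ _] _]; exact: g0.
split; [apply/cvg_ex; exists (\sum_(0 <= k < n) `|h k|)|apply: rsum_eq];
  apply/cvgn_epsP => e e0; exists n => m nm; rewrite /series /= E ?subrr ?normr0 ?(ltW e0) //.
by move=> k nk; rewrite h0 // normr0.
Qed.

Lemma rsum_single h i : (forall k, k != i -> h k = 0) -> asum h /\ rsum h = h i.
Proof.
move=> h0; have [|ch ->] := @rsum_fin h i.+1.
  by move=> k ik; apply: h0; rewrite gtn_eqF.
split => //; rewrite big_nat_recr //= big_nat_cond big1 ?add0r //.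
by move=> k /andP[/andP[_ ki] _]; apply: h0; rewrite ltn_eqF.
Qed.

Lemma rsum_tail h e : asum h -> 0 < e ->
  exists n, \sum_(0 <= k < n) `|h k| >= rsum (fun k => `|h k|) - e.
Proof.
move=> ch e0; have /cvgn_epsP/(_ e e0)[N HN] := rsum_cvg (asum_norm ch).
by exists N; have := HN N (leqnn _); rewrite ler_distl => /andP[].
Qed.

(** Beyond some m all terms are controlled by the tail of g; below m there are finitely many of
    them, which converge one by one. *)
Lemma tannery (F : nat -> nat -> R) f g : asum g ->
  (forall n k, `|F n k| <= g k) -> (forall k, (F ^~ k) @ \oo --> f k) ->
  rsum (F n) @[n --> \oo] --> rsum f.
Proof.
move=> cg Fg Ff.
have g0 k : 0 <= g k by apply: le_trans (Fg 0%N k).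
have fg k : `|f k| <= g k.
  rewrite -(cvg_lim _ (Ff k)) //; apply: limn_norm_le => //.
  by apply/cvg_ex; exists (f k); exact: Ff.
have cf : asum f by apply: asum_dom cg _ => k; rewrite (le_trans (fg k)) // ler_norm.
have cF n : asum (F n) by apply: asum_dom cg _ => k; rewrite (le_trans (Fg n k)) // ler_norm.
apply/cvgn_epsP => e e0.
have [m Hm] := rsum_tail cg (e := e / 4) ltac:(lra).
have Hm' : rsum g - \sum_(0 <= k < m) g k <= e / 4.
  have gE : (fun k => `|g k|) = g by apply/funext => k; rewrite ger0_norm.
  move: Hm; under eq_bigr do rewrite ger0_norm //; rewrite gE; lra.
pose D n k := F n k - f k.
have cD n : asum (D n) by exact: asumB.
have Dg n k : `|D n k| <= 2 * g k.
  by rewrite (le_trans (ler_normB _ _)) // mulr2n mulrDl !mul1r lerD.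
have sD : \sum_(0 <= k < m) `|D n k| @[n --> \oo] --> (0 : R).
  have := @cvg_fsum nat \oo _ (fun k n => `|D n k|) (fun=> 0) m.
  rewrite big1 //; apply => k; apply/norm_cvg0P.
  rewrite -(subrr (f k)); apply: cvgB; [exact: Ff|exact: cvg_cst].
have /cvgn_epsP/(_ (e / 4) ltac:(lra))[N HN] := sD.
exists N => n Nn; rewrite -rsumB // -/(D n).
(* B dominates the difference: the actual error on the head, 2 g on the tail. It is summed as 2 g
   plus the finitely supported correction C. *)
pose B k := if (k < m)%N then `|D n k| else 2 * g k.
pose C k := if (k < m)%N then `|D n k| - 2 * g k else 0.
have [cC sC] : asum C /\ rsum C = \sum_(0 <= k < m) C k.
  by apply: rsum_fin => k; rewrite leqNgt /C => /negbTE ->.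
have BE : B = fun k => C k + 2 * g k.
  by apply/funext => k; rewrite /B /C; case: ifP => _; ring.
have cB : asum B by rewrite BE; apply: asumD => //; exact: asumZ.
apply: (le_trans (@rsum_norm _ B cB _)) => [k|].
  by rewrite /B; case: ifP.
rewrite BE rsumD ?rsumZ //; last exact: asumZ.
have -> : rsum C = \sum_(0 <= k < m) `|D n k| - 2 * \sum_(0 <= k < m) g k.
  rewrite sC mulr_sumr -sumrB big_nat_cond [RHS]big_nat_cond; apply: eq_bigr.
  by move=> k /andP[/andP[_ km] _]; rewrite /C km.
have := HN n Nn; rewrite subr0 ger0_norm ?sumr_ge0 // => H1; lra.
Qed.

Lemma asum_sum (F : nat -> nat -> R) n : (forall i, asum (F i)) ->
  asum (fun k => \sum_(0 <= i < n) F i k) /\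
  rsum (fun k => \sum_(0 <= i < n) F i k) = \sum_(0 <= i < n) rsum (F i).
Proof.
move=> cF; elim: n => [|n [IH1 IH2]].
  under eq_fun do rewrite big_geq //.
  by have [c ->] := @rsum_fin (fun=> 0) 0 (fun _ _ => erefl); rewrite !big_geq.
under eq_fun do rewrite big_nat_recr //=.
split; first exact: asumD.
by rewrite big_nat_recr //= rsumD // IH2.
Qed.

(** [tannery] applied to the partial sums over j, with the row bounds g as dominating sequence. The
    convergence of the series of column sums is a separate conclusion because an equality of [rsum]
    does not contain it. *)
Lemma rsum_fubini (F : nat -> nat -> R) g : asum g ->
  (forall i, asum (F i)) -> (forall i, rsum (fun j => `|F i j|) <= g i) ->
  [/\ forall j, asum (F ^~ j),
   series (fun j => rsum (F ^~ j)) @ \oo --> rsum (fun i => rsum (F i)) &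
   rsum (fun j => rsum (F ^~ j)) = rsum (fun i => rsum (F i))].
Proof.
move=> cg cF Fg.
have Fij i j : `|F i j| <= g i.
  apply: le_trans (Fg i).
  by apply: (@rsum_term (fun j => `|F i j|)) => //; exact: asum_norm.
have g0 i : 0 <= g i by exact: le_trans (Fij i 0%N).
have cFj j : asum (F ^~ j) by apply: asum_dom cg _ => i; rewrite (le_trans (Fij i j)) // ler_norm.
have H : series (fun j => rsum (F ^~ j)) @ \oo --> rsum (fun i => rsum (F i)).
  have -> : series (fun j => rsum (F ^~ j)) =
      (fun n => rsum (fun i => \sum_(0 <= j < n) F i j)).
    by apply/funext => n; have [_ ->] := @asum_sum (fun j i => F i j) n cFj.
  apply: (tannery cg) => [n i|i]; last exact: rsum_cvg.
  apply: le_trans (Fg i); apply: (le_trans (ler_norm_sum _ _ _)).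
  by apply: (@rsum_part (fun j => `|F i j|)) => //; exact: asum_norm.
by split => //; exact: rsum_eq.
Qed.

Lemma esum_asum h : (forall k, 0 <= h k) -> asum h ->
  (\sum_(0 <= k <oo) (h k)%:E)%E = (rsum h)%:E.
Proof.
move=> h0 ch; apply/cvg_lim => //.
under eq_fun do rewrite sumEFin.
by apply: cvg_EFin; [exact: nearW|exact: rsum_cvg].
Qed.

Lemma asum_esum h : (forall k, 0 <= h k) ->
  (\sum_(0 <= k <oo) (h k)%:E < +oo)%E -> asum h.
Proof.
move=> h0 hoo; have := @nnseries_is_cvg R h h0 hoo.
by rewrite /asum; under [X in _ -> cvgn (series X)]eq_fun do rewrite ger0_norm //.
Qed.

End absolute_series.

(** * The difference operator Q *)

Section birth_death.
Context {R : realType} (a b : nat -> R).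
Implicit Types (F G : nat -> R) (al c l M N : R).

Definition Qseq F (k : nat) : R :=
  a k * (if k is j.+1 then F j else 0) - (a k + b k) * F k + b k * F k.+1.

Definition dlt (k : nat) : nat -> R := fun i => (i == k)%:R.

Lemma Qseq_dlt k j : Qseq (dlt k) j =
  a j * (j == k.+1)%:R - (a j + b j) * (j == k)%:R + b j * (j.+1 == k)%:R.
Proof. by case: j => //=; rewrite /Qseq /dlt. Qed.

Lemma QseqD F G k : Qseq (fun i => F i + G i) k = Qseq F k + Qseq G k.
Proof. by rewrite /Qseq; case: k => [|k]; ring. Qed.

Lemma QseqZ c F k : Qseq (fun i => c * F i) k = c * Qseq F k.
Proof. by rewrite /Qseq; case: k => [|k]; ring. Qed.

Lemma QseqB F G k : Qseq (fun i => F i - G i) k = Qseq F k - Qseq G k.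
Proof. by rewrite /Qseq; case: k => [|k]; ring. Qed.

Lemma Qseq_sum (h : nat -> nat -> R) n i :
  Qseq (fun i => \sum_(0 <= j < n) h i j) i = \sum_(0 <= j < n) Qseq (h ^~ j) i.
Proof.
elim: n => [|n IH]; first by rewrite /Qseq !big_geq //; case: i => [|i]; rewrite ?big_geq //; ring.
rewrite big_nat_recr //= -IH -QseqD; congr Qseq.
by apply/funext => k; rewrite big_nat_recr.
Qed.

(** A row of Q has at most three nonzero entries, so only finite linear combinations of series
    occur. *)
Lemma Qseq_rsum (h : nat -> nat -> R) i : (forall i, asum (h i)) ->
  asum (fun j => Qseq (h ^~ j) i) /\
  Qseq (fun i => rsum (h i)) i = rsum (fun j => Qseq (h ^~ j) i).
Proof.
move=> ch; rewrite /Qseq; case: i => [|i].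
  have E j : a 0%N * 0 - (a 0%N + b 0%N) * h 0%N j + b 0%N * h 1%N j =
     (- (a 0%N + b 0%N)) * h 0%N j + b 0%N * h 1%N j by ring.
  rewrite (funext E).
  split; first by apply: asumD; apply: asumZ.
  by rewrite rsumD ?rsumZ //; [ring|exact: asumZ..].
have E j : a i.+1 * h i j - (a i.+1 + b i.+1) * h i.+1 j + b i.+1 * h i.+2 j =
  (a i.+1 * h i j + (- (a i.+1 + b i.+1)) * h i.+1 j) + b i.+1 * h i.+2 j by ring.
rewrite (funext E).
have c1 : asum (fun j => a i.+1 * h i j + (- (a i.+1 + b i.+1)) * h i.+1 j).
  by apply: asumD; apply: asumZ.
split; first by apply: asumD => //; apply: asumZ.
by rewrite !rsumD ?rsumZ //; [ring|exact: asumZ..].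
Qed.

Section with_rates.
Hypothesis hab : rates a b.

Lemma a0 : a 0%N = 0. Proof. by case: hab. Qed.
Lemma a_gt0 k : 0 < a k.+1. Proof. by case: hab. Qed.
Lemma a_ge0 k : 0 <= a k. Proof. by case: k => [|k]; rewrite ?a0 // ltW ?a_gt0. Qed.
Lemma b_gt0 k : 0 < b k. Proof. by case: hab. Qed.
Lemma q_gt0 k : 0 < a k + b k. Proof. by rewrite ltr_wpDl ?a_ge0 ?b_gt0. Qed.

Lemma Qseq_cst c k : Qseq (fun=> c) k = 0.
Proof. by rewrite /Qseq; case: k => [|k]; rewrite ?a0; ring. Qed.

Lemma Qseq_bound F M k : (forall i, `|F i| <= M) -> `|Qseq F k| <= 2 * (a k + b k) * M.
Proof.
move=> FM; have M0 : 0 <= M by apply: le_trans (FM 0%N).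
have H : `|if k is j.+1 then F j else 0| <= M by case: k => [|k]; rewrite ?normr0.
rewrite /Qseq (le_trans (ler_normD _ _)) // (le_trans (lerD (ler_normB _ _) (lexx _))) //.
rewrite !normrM (ger0_norm (a_ge0 k)) (gtr0_norm (b_gt0 k)) (gtr0_norm (q_gt0 k)).
have A1 := ler_wpM2l (a_ge0 k) H.
have A2 := ler_wpM2l (ltW (b_gt0 k)) (FM k.+1).
have A3 := ler_wpM2l (ltW (q_gt0 k)) (FM k).
lra.
Qed.

Lemma mu0 : mu a b 0 = 1.
Proof. by rewrite /mu !big_geq // divr1. Qed.

Lemma prodb_gt0 n : 0 < \prod_(0 <= i < n) b i.
Proof. by apply: prodr_gt0 => i _; exact: b_gt0. Qed.

Lemma proda_gt0 n : 0 < \prod_(1 <= i < n) a i.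
Proof.
rewrite big_nat_cond; apply: prodr_gt0 => -[|i]; first by rewrite ltn0.
by rewrite a_gt0.
Qed.

Lemma mu_gt0 k : 0 < mu a b k.
Proof. by rewrite /mu divr_gt0 ?prodb_gt0 ?proda_gt0. Qed.

Lemma muS k : mu a b k.+1 * a k.+1 = mu a b k * b k.
Proof.
rewrite /mu big_nat_recr //= [\prod_(1 <= i < k.+2) _]big_nat_recr //=.
have ? := gt_eqF (proda_gt0 k.+1); have ? := gt_eqF (a_gt0 k).
by field; apply/andP; split; apply/negbT.
Qed.

(** The conductance of the edge between k and k + 1: by [muS] (detailed balance) it is also a_(k+1)
    mu_(k+1), and by [scaleS] its double is the inverse of the increment of the scale. *)
Definition bmu k : R := b k * mu a b k.

Lemma bmu_gt0 k : 0 < bmu k.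
Proof. by rewrite mulr_gt0 ?b_gt0 ?mu_gt0. Qed.

Lemma scaleS k : scale a b k.+1 - scale a b k = (2 * bmu k)^-1.
Proof.
rewrite /bmu; case: k => [|k].
  by rewrite /scale mu0 big_geq // addr0 subr0 mulr1.
rewrite /scale [\sum_(2 <= i < k.+3) _]big_nat_recr //= addrA [X in X - _]addrC addrK.
rewrite /mu [\prod_(0 <= l < k.+2) _]big_nat_recr //=.
have ? := lt0r_neq0 (prodb_gt0 k.+1); have ? := lt0r_neq0 (proda_gt0 k.+2).
by have ? := lt0r_neq0 (b_gt0 k.+1); field; apply/and3P.
Qed.

Lemma scale_lt k : scale a b k < scale a b k.+1.
Proof. by rewrite -subr_gt0 scaleS invr_gt0 mulr_gt0 ?bmu_gt0. Qed.

Lemma scale_ge1 k : scale a b 1 <= scale a b k.+1.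
Proof. by elim: k => // k IH; apply: le_trans IH (ltW (scale_lt _)). Qed.

(* Summation by parts: [2 * sum mu_i QF(i)] is the right derivative of F. *)
Lemma Qseq_sum_mu F k :
  bmu k * (F k.+1 - F k) = \sum_(0 <= i < k.+1) mu a b i * Qseq F i.
Proof.
elim: k => [|k IH].
  by rewrite big_nat1 mu0 /bmu /Qseq mu0 a0; ring.
rewrite big_nat_recr //= -IH /Qseq /bmu.
have := muS k; set m := mu a b k.+1; set m' := mu a b k => E.
have -> : b k * m' = m * a k.+1 by rewrite E mulrC.
ring.
Qed.

Lemma Qseq_incr F k : F k.+1 - F k =
  (bmu k)^-1 * \sum_(0 <= i < k.+1) mu a b i * Qseq F i.
Proof. by rewrite -Qseq_sum_mu mulKf // gt_eqF ?bmu_gt0. Qed.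

(** A negative value would make F attain a negative minimum, where QF >= 0 and al F < 0. Only a
    lower limit is assumed, since in [PhiO_le_x] the function is not known to converge. *)
Lemma maxp_liminf al F : 0 < al ->
  (forall e, 0 < e -> exists m, forall k, (m <= k)%N -> - e <= F k) ->
  (forall k, 0 <= al * F k - Qseq F k) -> forall k, 0 <= F k.
Proof.
move=> al0 Fl H k; rewrite leNgt; apply/negP => Fk.
(* Beyond N, F is at least F k / 2 > F k, so the minimum over the indices up to [maxn N k] is a
   global one. *)
have [N HN] := Fl (- F k / 2) ltac:(lra).
have [i0 Hi0] : exists i0, forall i, (i <= maxn N k)%N -> F i0 <= F i.
  elim: (maxn N k) => [|n [i Hi]]; first by exists 0%N => i; rewrite leqn0 => /eqP ->.
  have [Fi|Fi] := leP (F i) (F n.+1).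
    by exists i => j; rewrite leq_eqVlt => /predU1P[->//|]; exact: Hi.
  exists n.+1 => j; rewrite leq_eqVlt => /predU1P[->//|jn].
  by apply: le_trans (ltW Fi) _; exact: Hi.
have Fi0k : F i0 <= F k by apply: Hi0; rewrite leq_maxr.
have Hmin i : F i0 <= F i.
  have [iN|Ni] := leqP i N; first by apply: Hi0; rewrite leq_max iN.
  have := HN i (ltnW Ni); lra.
have Q0 : 0 <= Qseq F i0.
  rewrite /Qseq; case: i0 {Hi0 Fi0k} Hmin => [|i] Hmin.
    by have := mulr_ge0 (ltW (b_gt0 0%N)) (_ : 0 <= F 1%N - F 0%N); rewrite a0 subr_ge0 Hmin => /(_ isT); lra.
  have A1 : 0 <= a i.+1 * (F i - F i.+1) by rewrite mulr_ge0 ?a_ge0 // subr_ge0.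
  have A2 : 0 <= b i.+1 * (F i.+2 - F i.+1) by rewrite mulr_ge0 ?subr_ge0 // ltW ?b_gt0.
  lra.
have := H i0; have : al * F i0 < 0 by rewrite pmulr_rlt0 //; lra.
lra.
Qed.

Lemma maxp al F l : 0 < al -> F @ \oo --> l -> 0 <= l ->
  (forall k, 0 <= al * F k - Qseq F k) -> forall k, 0 <= F k.
Proof.
move=> al0 Fl l0; apply: maxp_liminf al0 _ => e e0.
have /cvgn_epsP/(_ e e0)[N HN] := Fl; exists N => k /HN.
by rewrite ler_distl => /andP[H1 _]; lra.
Qed.

Fixpoint vd al k : R * R :=
  if k is j.+1 then
    let d := (a j * (vd al j).2 + al * (vd al j).1) / b j in ((vd al j).1 + d, d)
  else (1, 0).
(* The increasing solution of QF = al F with value 1 at 0; [(vd al k).2] is its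
   increment from k - 1 to k. *)
Definition vv al k := (vd al k).1.

Lemma vv0 al : vv al 0 = 1. Proof. by []. Qed.

Lemma vv_eq al k : Qseq (vv al) k = al * vv al k.
Proof.
have b0 := gt_eqF (b_gt0 k).
case: k b0 => [|k] b0; rewrite /Qseq /vv /= ?a0; first by field; apply/negbT.
set v := (vd al k).1; set d := (_ + _) / b k.
by field; apply/negbT.
Qed.

(** As a_0 = 0, the equation at state 0 already gives F 1 from F 0, and the recursion then
    determines F: the solutions form a line. *)
Lemma ker_vv al F : (forall k, Qseq F k = al * F k) -> forall k, F k = F 0%N * vv al k.
Proof.
move=> H k; suff: F k = F 0%N * vv al k /\ F k.+1 = F 0%N * vv al k.+1 by case.
elim: k => [|k [IH1 IH2]].
  split; first by rewrite vv0 mulr1.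
  have := H 0%N; have := vv_eq al 0; rewrite /Qseq a0 vv0 => E1 E2.
  apply: (mulfI (lt0r_neq0 (b_gt0 0%N))); rewrite mulrCA.
  have -> : b 0%N * vv al 1 = al + b 0%N by lra.
  lra.
split=> //; have := H k.+1; have := vv_eq al k.+1; rewrite /Qseq => E1 E2.
apply: (mulfI (lt0r_neq0 (b_gt0 k.+1))); rewrite mulrCA.
have -> : b k.+1 * vv al k.+2 = al * vv al k.+1 - a k.+1 * vv al k + (a k.+1 + b k.+1) * vv al k.+1.
  by lra.
have -> : b k.+1 * F k.+2 = al * F k.+1 - a k.+1 * F k + (a k.+1 + b k.+1) * F k.+1 by lra.
by rewrite IH1 IH2; ring.
Qed.

Lemma vv_mono al k : 0 <= al -> 1 <= vv al k /\ vv al k <= vv al k.+1.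
Proof.
move=> al0.
have H j : 1 <= (vd al j).1 /\ 0 <= (vd al j).2.
  elim: j => [|j [IH1 IH2]] //=.
  have d0 : 0 <= (a j * (vd al j).2 + al * (vd al j).1) / b j.
    by rewrite divr_ge0 ?(ltW (b_gt0 _)) // addr_ge0 ?mulr_ge0 ?a_ge0 // (le_trans ler01).
  by split => //; lra.
by have [H1 _] := H k; have [_ H2] := H k.+1; split => //; move: H2; rewrite /vv /=; lra.
Qed.

Lemma vv_gt0 al k : 0 <= al -> 0 < vv al k.
Proof. by move=> /(vv_mono k)[H _]; exact: lt_le_trans H. Qed.

Section with_sigma.
Hypothesis hs : (sigma a b < +oo)%E.

(* [st] is [sigma_term] with values in [R]; [tl] are the tail sums of sigma. *)
Definition st k : R := (scale a b k.+1 - scale a b k) * \sum_(0 <= i < k.+1) mu a b i.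

Lemma st_gt0 k : 0 < st k.
Proof.
rewrite /st mulr_gt0 ?subr_gt0 ?scale_lt // big_nat_recr //= ltr_wpDl ?mu_gt0 //.
by apply: sumr_ge0 => i _; rewrite ltW ?mu_gt0.
Qed.

Lemma st_bmu k : 2 * st k = (bmu k)^-1 * \sum_(0 <= i < k.+1) mu a b i.
Proof. by rewrite /st scaleS mulrA invfM mulrA mulfV ?mul1r. Qed.

Lemma bmu_st k : (bmu k)^-1 <= 2 * st k.
Proof.
rewrite st_bmu ler_peMr ?invr_ge0 ?(ltW (bmu_gt0 _)) //.
rewrite big_nat_recl //= mu0 lerDl sumr_ge0 // => i _; exact: ltW (mu_gt0 _).
Qed.

Lemma asum_st : asum st.
Proof.
apply: asum_esum; first by move=> k; exact: ltW (st_gt0 k).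
exact: hs.
Qed.

Definition tl k : R := rsum st - \sum_(0 <= j < k) st j.

Lemma tlS k : tl k = st k + tl k.+1.
Proof. by rewrite /tl big_nat_recr //=; ring. Qed.

Lemma tl_ge0 k : 0 <= tl k.
Proof. by rewrite subr_ge0 rsum_part //; [exact: asum_st|move=> i; exact: ltW (st_gt0 i)]. Qed.

Lemma tl_gt0 k : 0 < tl k.
Proof. by rewrite tlS ltr_wpDr ?tl_ge0 ?st_gt0. Qed.

Lemma tl_cvg0 : tl @ \oo --> (0 : R).
Proof.
rewrite -[X in _ --> X](subrr (rsum st)); apply: cvgB; first exact: cvg_cst.
exact: rsum_cvg asum_st.
Qed.

Lemma incr_le F c C k : F @ \oo --> c -> (forall j, F j.+1 - F j <= C * st j) ->
  c - F k <= C * tl k.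
Proof.
move=> Fc H.
have K n : F (n + k)%N - F k <= C * (tl k - tl (n + k)%N).
  elim: n => [|n IH]; first by rewrite !subrr mulr0.
  rewrite addSn; have H1 := H (n + k)%N; rewrite (tlS (n + k)) in IH; lra.
have L1 : (fun n => F (n + k)%N - F k) @ \oo --> c - F k.
  by apply: cvgB; [rewrite cvg_shiftn|exact: cvg_cst].
have L2 : (fun n => C * (tl k - tl (n + k)%N)) @ \oo --> C * (tl k - 0).
  by apply: cvgZr; apply: cvgB; [exact: cvg_cst|rewrite cvg_shiftn]; exact: tl_cvg0.
by rewrite -[tl k]subr0; apply: (cvgn_le_lim L1 L2 K).
Qed.

Lemma incr_ge F c C k : F @ \oo --> c -> (forall j, C * st j <= F j.+1 - F j) ->
  C * tl k <= c - F k.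
Proof.
move=> Fc H; have Fc' : (fun k => - F k) @ \oo --> - c by exact: cvgN.
have := @incr_le _ _ (- C) k Fc' _; rewrite mulNr opprK => /(_ _)/wrap[j|].
  by have := H j; lra.
lra.
Qed.

Lemma Qseq_incr_bound F M k : (forall k, `|Qseq F k| <= M) -> `|F k.+1 - F k| <= 2 * M * st k.
Proof.
move=> FM; rewrite Qseq_incr mulrAC st_bmu normrM ger0_norm ?invr_ge0 ?(ltW (bmu_gt0 _)) //.
rewrite -mulrA ler_wpM2l ?invr_ge0 ?(ltW (bmu_gt0 _)) // mulr_suml.
apply: (le_trans (ler_norm_sum _ _ _)); apply: ler_sum => i _.
by rewrite normrM (gtr0_norm (mu_gt0 i)) ler_wpM2l ?(ltW (mu_gt0 i)).
Qed.

(** This is the use of sigma < oo that removes regularity questions at infinity: a bounded QF makes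
    the increments of F summable, being at most 2 M [st]. *)
Lemma Qseq_bounded_cvg F M : (forall k, `|Qseq F k| <= M) -> cvgn F.
Proof.
move=> FM; have E : F = fun n => F 0%N + series (fun k => F k.+1 - F k) n.
  apply/funext => n; rewrite /series /= telescope_sumr //; ring.
have : asum (fun k => F k.+1 - F k).
  apply: (asum_dom (asumZ (c := 2 * M) asum_st)) => k.
  by rewrite (le_trans (Qseq_incr_bound k FM)) // ler_norm.
move=> /rsum_cvg H; rewrite E; apply/cvg_ex; eexists; apply: cvgD; [exact: cvg_cst|exact: H].
Qed.

Section resolvent_param.
Variable al : R.
Hypothesis al0 : 0 < al.
Let v := vv al.

Lemma v_gt0 k : 0 < v k. Proof. exact: vv_gt0 (ltW al0). Qed.
Lemma v_ge1 k : 1 <= v k. Proof. by have [] := vv_mono k (ltW al0). Qed.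
Lemma v_nd : {homo v : m n / (m <= n)%N >-> m <= n}.
Proof. by apply: homo_leq (@le_refl _ _) (@le_trans _ _) _ => k; have [] := vv_mono k (ltW al0). Qed.

Lemma v_incr k : v k.+1 - v k <= 2 * al * st k * v k.
Proof.
rewrite Qseq_incr.
have -> : 2 * al * st k * v k = al * v k * (2 * st k) by ring.
rewrite st_bmu [X in _ <= X]mulrCA.
rewrite ler_wpM2l ?invr_ge0 ?(ltW (bmu_gt0 _)) // mulr_sumr.
rewrite big_nat_cond [X in _ <= X]big_nat_cond; apply: ler_sum => i /andP[/andP[_ ik] _].
rewrite vv_eq mulrC ler_wpM2r ?(ltW (mu_gt0 i)) // ler_wpM2l ?(ltW al0) //.
exact: v_nd.
Qed.

(** Discrete Gronwall: v_(k+1) <= v_k (1 + 2 al st_k) <= v_k exp(2 al st_k), and [st] is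
    summable. *)
Lemma v_cvg : cvgn v.
Proof.
apply: nondecreasing_is_cvgn; first exact: v_nd.
exists (expR (2 * al * rsum st)) => _ [n _ <-].
apply: (@le_trans _ _ (expR (2 * al * \sum_(0 <= j < n) st j))).
  elim: n => [|n IH]; first by rewrite big_geq // mulr0 expR0 /v vv0.
  rewrite big_nat_recr //= mulrDr expRD.
  have H1 := expR_ge1Dx (2 * al * st n); have H2 := v_incr n; have H3 := v_gt0 n.
  apply: (@le_trans _ _ (v n * (1 + 2 * al * st n))); first by lra.
  apply: ler_pM => //; first exact: ltW.
  by have := mulr_gt0 al0 (st_gt0 n); lra.
rewrite ler_expR ler_wpM2l ?mulr_ge0 ?(ltW al0) // rsum_part //; first exact: asum_st.
by move=> k; exact: ltW (st_gt0 k).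
Qed.

Definition vinf := limn v.
Lemma v_le_inf k : v k <= vinf.
Proof. exact: nondecreasing_cvgn_le v_nd v_cvg k. Qed.
Lemma vinf_gt0 : 0 < vinf. Proof. exact: lt_le_trans (v_gt0 0) (v_le_inf 0). Qed.

(* The function u_alpha of the paper, characterised by [uu_eq] and [uu_cvg]. *)
Definition uu k : R := v k / vinf.

Lemma uu_gt0 k : 0 < uu k. Proof. by rewrite divr_gt0 ?v_gt0 ?vinf_gt0. Qed.
Lemma uu_le1 k : uu k <= 1. Proof. by rewrite ler_pdivrMr ?vinf_gt0 // mul1r v_le_inf. Qed.
Lemma uu_norm k : `|uu k| <= 1. Proof. by rewrite gtr0_norm ?uu_gt0 // uu_le1. Qed.
Lemma uu_nd : {homo uu : m n / (m <= n)%N >-> m <= n}.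
Proof. by move=> m n mn; rewrite ler_pM2r ?invr_gt0 ?vinf_gt0 // v_nd. Qed.
Lemma uu_cvg : uu @ \oo --> (1 : R).
Proof.
rewrite -[X in _ --> X](mulfV (lt0r_neq0 vinf_gt0)); apply: cvgMl; exact: v_cvg.
Qed.
Lemma uu_eq k : Qseq uu k = al * uu k.
Proof.
have -> : uu = fun k => vinf^-1 * v k by apply/funext => i; rewrite /uu mulrC.
by rewrite QseqZ vv_eq mulrCA.
Qed.

Lemma uu_incr k : 2 * al * uu 0 * st k <= uu k.+1 - uu k <= 2 * al * st k.
Proof.
rewrite Qseq_incr.
have -> : 2 * al * uu 0 * st k = (bmu k)^-1 * \sum_(0 <= i < k.+1) mu a b i * (al * uu 0).
  by rewrite -mulr_suml [RHS]mulrA -st_bmu; ring.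
have -> : 2 * al * st k = (bmu k)^-1 * \sum_(0 <= i < k.+1) mu a b i * al.
  by rewrite -mulr_suml [RHS]mulrA -st_bmu; ring.
apply/andP; split; rewrite ler_wpM2l ?invr_ge0 ?(ltW (bmu_gt0 _)) //; apply: ler_sum => i _;
  rewrite ler_wpM2l ?(ltW (mu_gt0 _)) // uu_eq.
  by rewrite ler_wpM2l ?(ltW al0) // uu_nd.
by rewrite ler_piMr ?(ltW al0) // uu_le1.
Qed.

(** With [uu_tl_le], it makes 1 - u_k comparable to the tail of sigma for each al. This is why
    condition (a) amounts to the summability of nu_k (1 - u_k). *)
Lemma uu_tl_ge k : 2 * al * uu 0 * tl k <= 1 - uu k.
Proof. by apply: incr_ge uu_cvg _ => j; have /andP[] := uu_incr j. Qed.
Lemma uu_tl_le k : 1 - uu k <= 2 * al * tl k.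
Proof. by apply: incr_le uu_cvg _ => j; have /andP[] := uu_incr j. Qed.

(** Since u increases, al u_k = Qu(k) is at most b_k (u_(k+1) - u_k). At a fixed state u_k thus
    tends to 0 as al grows, which drives [denom_unbounded]. *)
Lemma uu_b k : uu k <= b k / al.
Proof.
rewrite ler_pdivlMr // mulrC -uu_eq.
have H := uu_nd (leqnSn k); have H1 : Qseq uu k <= b k * (uu k.+1 - uu k).
  rewrite /Qseq; case: k H => [|k] H; first by rewrite a0; lra.
  have : 0 <= a k.+1 * (uu k.+1 - uu k) by rewrite mulr_ge0 ?a_ge0 // subr_ge0 uu_nd.
  lra.
apply: (le_trans H1); rewrite ler_piMr ?(ltW (b_gt0 _)) //.
by have := uu_le1 k.+1; have := uu_gt0 k; lra.
Qed.

Lemma ker_uu F c : F @ \oo --> c -> (forall k, Qseq F k = al * F k) ->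
  forall k, F k = c * uu k.
Proof.
move=> Fc H k; have E := ker_vv H.
have : F @ \oo --> F 0%N * vinf.
  by rewrite [X in X @ _](funext E); apply: cvgZr; exact: v_cvg.
move=> /(cvg_unique _ Fc) -> //; rewrite E /uu -/v; field; exact: lt0r_neq0 vinf_gt0.
Qed.

(** Reduction of order: with these decrements of s, the discrete Wronskian of v and v s, multiplied
    by [bmu], is constantly 1, so that v s solves the same equation away from state 0. *)
Definition green_weight (k : nat) : R := (bmu k * v k * v k.+1)^-1.
Definition ss k : R := rsum green_weight - \sum_(0 <= l < k) green_weight l.

Lemma green_weight_gt0 k : 0 < green_weight k.
Proof. rewrite invr_gt0; apply: mulr_gt0 (v_gt0 _); exact: mulr_gt0 (bmu_gt0 _) (v_gt0 _). Qed.

Lemma asum_green_weight : asum green_weight.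
Proof.
apply: (asum_dom (asumZ (c := 2) asum_st)) => k.
rewrite ger0_norm ?(ltW (green_weight_gt0 _)) // (le_trans _ (ler_norm _)) //.
apply: le_trans (bmu_st k); rewrite /green_weight -mulrA invfM ler_piMr ?invr_ge0 ?(ltW (bmu_gt0 _)) //.
by rewrite invf_le1 ?mulr_gt0 ?v_gt0 // mulr_ege1 ?v_ge1.
Qed.

Lemma ssS k : ss k = green_weight k + ss k.+1.
Proof. by rewrite /ss big_nat_recr //=; ring. Qed.
Lemma ss_ge0 k : 0 <= ss k.
Proof. by rewrite subr_ge0 rsum_part //; [exact: asum_green_weight|move=> i; exact: ltW (green_weight_gt0 i)]. Qed.
Lemma ss_cvg0 : ss @ \oo --> (0 : R).
Proof.
rewrite -[X in _ --> X](subrr (rsum green_weight)); apply: cvgB; first exact: cvg_cst.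
exact: rsum_cvg asum_green_weight.
Qed.

(* Green function of [al - Q]: [v * ss] is the solution vanishing at infinity. *)
Definition Phi i j : R := mu a b j * v j * (v i * ss (maxn i j)).

Lemma Phi_ge0 i j : 0 <= Phi i j.
Proof. by apply: mulr_ge0; apply: mulr_ge0; rewrite ?ss_ge0 ?(ltW (mu_gt0 _)) ?(ltW (v_gt0 _)). Qed.

Lemma Phi_sym i j : mu a b i * Phi i j = mu a b j * Phi j i.
Proof. by rewrite /Phi maxnC; ring. Qed.

Lemma Phi_cvg0 j : Phi ^~ j @ \oo --> (0 : R).
Proof.
rewrite -[X in _ --> X](mulr0 (mu a b j * v j)); apply: cvgZr.
rewrite -[X in _ --> X](mulr0 vinf); apply: cvgM; first exact: v_cvg.
apply/cvgn_epsP => e e0; have /cvgn_epsP/(_ e e0)[N HN] := ss_cvg0.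
by exists N => n Nn; apply: HN; rewrite leq_max Nn.
Qed.

Lemma Phi_eq i j : Qseq (Phi ^~ j) i = al * Phi i j - dlt j i.
Proof.
(* The factor [ss (maxn k j)] is constant up to j and loses [green_weight k] at every later step
   k. *)
have D k : ss (maxn k.+1 j) = ss (maxn k j) - (if (j <= k)%N then green_weight k else 0).
  have [jk|] := boolP (j <= k)%N; last first.
    by rewrite -ltnNge => kj; rewrite (maxn_idPr kj) (maxn_idPr (ltnW kj)) subr0.
  by rewrite (maxn_idPl jk) (maxn_idPl (leqW jk)) (ssS k); ring.
have m0 k := lt0r_neq0 (mu_gt0 k); have v0 k := lt0r_neq0 (v_gt0 k).
have b0 k := lt0r_neq0 (b_gt0 k).
have G1 k : b k * v k.+1 * green_weight k = (mu a b k * v k)^-1.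
  rewrite /green_weight /bmu; move: (m0 k) (v0 k) (v0 k.+1) (b0 k).
  move: (mu a b k) (v k) (v k.+1) (b k) => x y z w x0 y0 z0 w0.
  by field; rewrite x0 y0 z0 w0.
have -> : Phi ^~ j = fun i => (mu a b j * v j) * (v i * ss (maxn i j)) by [].
rewrite QseqZ /Phi; case: i => [|i].
  have := vv_eq al 0; rewrite -/v /Qseq a0 D => E.
  have -> : b 0%N * (v 1%N * (ss (maxn 0 j) - (if (j <= 0)%N then green_weight 0 else 0))) =
    (al * v 0 + b 0%N * v 0) * ss (maxn 0 j) - (if (j <= 0)%N then b 0%N * v 1%N * green_weight 0 else 0).
    by rewrite (_ : al * v 0 + b 0%N * v 0 = b 0%N * v 1%N); [case: ifP => _; ring|lra].
  rewrite G1 leqn0 /dlt (eq_sym 0%N j); case: eqP => [->|_]; rewrite /= ?mulr0n ?mulr1n; last by ring.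
  by move: (m0 0%N) (v0 0%N); move: (mu a b 0) (v 0) => x y x0 y0; field; rewrite x0 y0.
have := vv_eq al i.+1; rewrite -/v /Qseq (D i.+1) => E.
have Di : ss (maxn i j) = ss (maxn i.+1 j) + (if (j <= i)%N then green_weight i else 0) by rewrite D; ring.
rewrite Di.
have mS : a i.+1 * mu a b i.+1 = bmu i by rewrite mulrC muS mulrC.
have G2 : a i.+1 * v i * green_weight i = (mu a b i.+1 * v i.+1)^-1.
  rewrite /green_weight -mS; move: (m0 i.+1) (v0 i) (v0 i.+1) (lt0r_neq0 (a_gt0 i)).
  move: (mu a b i.+1) (v i) (v i.+1) (a i.+1) => x y z w x0 y0 z0 w0.
  by field; rewrite x0 y0 z0 w0.
set S := ss (maxn i.+1 j).
(* The common factor S meets the equation of v. By [G1] and [G2] the two correction terms are both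
   the inverse of mu v at the state i.+1: they cancel when j <= i, and only the second is present
   when j = i.+1, which produces the - 1. *)
transitivity (mu a b j * v j * (S * (a i.+1 * v i - (a i.+1 + b i.+1) * v i.+1 + b i.+1 * v i.+2)
   + (if (j <= i)%N then a i.+1 * v i * green_weight i else 0)
   - (if (j <= i.+1)%N then b i.+1 * v i.+2 * green_weight i.+1 else 0))).
  by do 2 case: ifP => _; ring.
rewrite E G1 G2 /dlt; have [ji|] := leqP j i.
  by rewrite (leqW ji) gtn_eqF //= mulr0n; ring.
rewrite leq_eqVlt => /predU1P[<-|ij]; last by rewrite leqNgt ij /= ltn_eqF //= mulr0n; ring.
rewrite leqnn eqxx /= mulr1n; move: (m0 i.+1) (v0 i.+1).
by move: (mu a b i.+1) (v i.+1) => x y x0 y0; field; rewrite x0 y0.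
Qed.

(** The difference of the two sides vanishes at infinity, and al - Q maps it to al times the
    indicator of the states from n on; the maximum principle concludes. *)
Lemma Phi_part n i : al * \sum_(0 <= j < n) Phi i j <= 1 - uu i.
Proof.
rewrite -subr_ge0; move: i; apply: (@maxp al _ 0) => // [|k].
  rewrite -[X in _ --> X](subrr (1 - 1 : R)); apply: cvgB.
    by apply: cvgB; [exact: cvg_cst|exact: uu_cvg].
  rewrite subrr -[X in _ --> X](mulr0 al); apply: cvgZr.
  have := @cvg_fsum _ nat \oo _ (fun j i => Phi i j) (fun=> 0) n.
  by rewrite big1 //; apply => j; exact: Phi_cvg0.
rewrite !QseqB Qseq_cst uu_eq QseqZ Qseq_sum.
rewrite [X in _ * _ - (_ - al * X)](eq_bigr (fun j => al * Phi k j - dlt j k)) => [|j _]; last first.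
  exact: (Phi_eq k j).
rewrite sumrB -mulr_sumr.
have : \sum_(0 <= j < n) dlt j k <= 1.
  rewrite /dlt; elim: n => [|n IH]; first by rewrite big_geq.
  rewrite big_nat_recr //=; case: eqP => [->|_]; last by rewrite addr0.
  rewrite big_nat_cond big1 ?add0r // => i /andP[/andP[_ ik] _].
  by rewrite gtn_eqF.
set X := \sum_(0 <= j < n) dlt j k; set Y := \sum_(0 <= j < n) _ => X1.
have : 0 <= al * (1 - X) by rewrite mulr_ge0 ?(ltW al0) // subr_ge0.
lra.
Qed.

Lemma Phi_asum i : asum (Phi i) /\ al * rsum (Phi i) <= 1 - uu i.
Proof.
have [|H1 H2] := @asum_bound _ (Phi i) ((1 - uu i) / al) (Phi_ge0 i) _.
  by move=> n; rewrite ler_pdivlMr // mulrC Phi_part.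
by split=> //; rewrite mulrC -ler_pdivlMr.
Qed.

Definition PhiO G i : R := rsum (fun j => Phi i j * G j).

Lemma PhiO_asum G M i : (forall k, `|G k| <= M) -> asum (fun j => Phi i j * G j).
Proof. by move=> GM; apply: asum_mulr GM; have [] := Phi_asum i. Qed.

Lemma PhiO_bound G M i : (forall k, `|G k| <= M) -> `|PhiO G i| <= M * (1 - uu i) / al.
Proof.
move=> GM; have [c1 c2] := Phi_asum i.
apply: (@le_trans _ _ (rsum (fun j => M * Phi i j))).
  apply: rsum_norm => [|k]; first exact: asumZ.
  by rewrite normrM (ger0_norm (Phi_ge0 _ _)) mulrC ler_wpM2r ?Phi_ge0.
rewrite rsumZ // -mulrA ler_wpM2l ?(le_trans _ (GM 0%N)) // ler_pdivlMr // mulrC //.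
Qed.

Lemma PhiO_cvg0 G M : (forall k, `|G k| <= M) -> PhiO G @ \oo --> (0 : R).
Proof.
move=> GM; apply/norm_cvg0P.
apply: (@squeeze_cvgr _ _ _ _ (fun=> 0) (fun i => M * (1 - uu i) / al)).
- by apply: nearW => i; rewrite normr_ge0 /= PhiO_bound.
- exact: cvg_cst.
- rewrite -[X in _ --> X](mul0r al^-1); apply: cvgMl; rewrite -(mulr0 M); apply: cvgZr.
  by rewrite -[X in _ --> X](subrr 1); apply: cvgB; [exact: cvg_cst|exact: uu_cvg].
Qed.

Lemma PhiO_eq G M i : (forall k, `|G k| <= M) -> Qseq (PhiO G) i = al * PhiO G i - G i.
Proof.
move=> GM; have [c1 ->] := @Qseq_rsum (fun i j => Phi i j * G j) i (fun i => PhiO_asum GM).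
have E j : Qseq (fun i => Phi i j * G j) i = al * (Phi i j * G j) - dlt j i * G j.
  have -> : (fun i => Phi i j * G j) = fun i => G j * Phi i j.
    by apply/funext => k; rewrite mulrC.
  by rewrite QseqZ Phi_eq; ring.
rewrite (funext E); have [|c2 E2] := @rsum_single _ (fun j => dlt j i * G j) i.
  by move=> k ki; rewrite /dlt eq_sym (negbTE ki) mul0r.
rewrite rsumB ?rsumZ //; [|exact: PhiO_asum GM|by apply: asumZ; exact: PhiO_asum GM].
by rewrite E2 /dlt eqxx mul1r.
Qed.

(** F - PhiO G lies in the kernel of al - Q, and PhiO G vanishes at infinity, so the coefficient of
    u can only be the limit of F. *)
Lemma PhiO_unique F G M c : F @ \oo --> c -> (forall k, `|G k| <= M) ->
  (forall k, al * F k - Qseq F k = G k) -> forall k, F k = PhiO G k + c * uu k.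
Proof.
move=> Fc GM H k; have := @ker_uu (fun k => F k - PhiO G k) c _ _ k.
rewrite -[X in _ --> X]subr0 => /(_ _)/wrap[|].
  by apply: cvgB => //; exact: PhiO_cvg0 GM.
move=> /(_ _)/wrap[i|E]; last by lra.
by rewrite QseqB (PhiO_eq i GM); have := H i; lra.
Qed.

Lemma PhiOZ G M c i : (forall k, `|G k| <= M) -> PhiO (fun k => c * G k) i = c * PhiO G i.
Proof.
move=> GM; rewrite /PhiO -rsumZ; last exact: PhiO_asum GM.
by congr rsum; apply/funext => k; rewrite mulrCA.
Qed.

Lemma PhiOB G H M N i : (forall k, `|G k| <= M) -> (forall k, `|H k| <= N) ->
  PhiO (fun k => G k - H k) i = PhiO G i - PhiO H i.
Proof.
move=> GM HN; rewrite /PhiO -rsumB; [|exact: PhiO_asum GM|exact: PhiO_asum HN].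
by congr rsum; apply/funext => k; rewrite mulrBr.
Qed.

(** Uniqueness for the constant c, which al - Q maps to al c. It turns the inequality of [Phi_asum]
    into the equality [Phi_rsum]. *)
Lemma PhiO_cst c i : al * PhiO (fun=> c) i = c * (1 - uu i).
Proof.
have Fc : (fun=> c : R) @ \oo --> (c : R) by exact: cvg_cst.
have E := @PhiO_unique (fun=> c) (fun=> al * c) `|al * c| c Fc (fun=> lexx _).
have {}E := E (fun k => etrans (congr1 (fun x => al * c - x) (Qseq_cst c k)) (subr0 _)) i.
move: E; rewrite (@PhiOZ (fun=> c) `|c|) //; lra.
Qed.

Lemma Phi_rsum i : al * rsum (Phi i) = 1 - uu i.
Proof.
by rewrite -[RHS]mul1r -PhiO_cst /PhiO; under [X in _ = _ * rsum X]eq_fun do rewrite mulr1.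
Qed.

Lemma PhiO_dlt i j : PhiO (dlt j) i = Phi i j.
Proof.
have [|_] := @rsum_single _ (fun k => Phi i k * dlt j k) j.
  by move=> k kj; rewrite /dlt (negbTE kj) mulr0.
by rewrite /dlt eqxx mulr1.
Qed.

(** As F vanishes at infinity, F = PhiO (al F - QF), so the difference is PhiO (QF). *)
Lemma PhiO_approx F M N : F @ \oo --> (0 : R) -> (forall k, `|F k| <= N) ->
  (forall k, `|Qseq F k| <= M) -> forall k, `|al * PhiO F k - F k| <= M / al.
Proof.
move=> F0 FN QM k.
have H1 i : `|al * F i| <= al * N by rewrite normrM gtr0_norm // ler_wpM2l // ltW.
have H2 i : `|al * F i - Qseq F i| <= al * N + M by rewrite (le_trans (ler_normB _ _)) // lerD.
have := PhiO_unique F0 H2 (fun=> erefl) k; rewrite mul0r addr0 => E.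
rewrite [X in _ - X]E.
rewrite (PhiOB k H1 QM) (PhiOZ al k FN) opprB addrCA subrr addr0.
apply: (le_trans (PhiO_bound k QM)); rewrite ler_pM2r ?invr_gt0 //.
rewrite ler_piMr ?(le_trans _ (QM 0%N)) //.
by have := uu_gt0 k; lra.
Qed.

End resolvent_param.
End with_sigma.
End with_rates.
End birth_death.

(** * Laplace transforms *)

Section laplace_transform.
Context {R : realType}.
Implicit Types (h g : R -> R) (M al t e : R).
Local Notation leb := (@lebesgue_measure R).
Local Notation ray := (`[0, +oo[%classic : set R).

(* Laplace transforms only see nonnegative times, so [ucont] and [bcont] say
   nothing about negative ones. *)
Definition ucont h : Prop := forall e, 0 < e -> exists2 d, 0 < d &
  forall s t, 0 <= s -> 0 <= t -> `|s - t| < d -> `|h s - h t| <= e.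

Definition bcont M h : Prop := ucont h /\ forall t, 0 <= t -> `|h t| <= M.

Lemma bcont_cst c : bcont `|c| (fun=> c).
Proof. by split=> [e e0|//]; exists 1 => // s t _ _ _; rewrite subrr normr0 ltW. Qed.

Lemma bcontD M N h g : bcont M h -> bcont N g -> bcont (M + N) (fun t => h t + g t).
Proof.
move=> [uh hM] [ug gN]; split=> [e e0|t t0]; last first.
  by rewrite (le_trans (ler_normD _ _)) // lerD ?hM ?gN.
have [d1 d10 H1] := uh (e / 2) ltac:(lra); have [d2 d20 H2] := ug (e / 2) ltac:(lra).
exists (Num.min d1 d2); first by rewrite lt_min d10.
move=> s t s0 t0; rewrite lt_min => /andP[sd1 sd2].
have := H1 _ _ s0 t0 sd1; have := H2 _ _ s0 t0 sd2.
have -> : h s + g s - (h t + g t) = (h s - h t) + (g s - g t) by ring.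
move=> A B; apply: (le_trans (ler_normD _ _)); lra.
Qed.

Lemma bcontZ M c h : bcont M h -> bcont (`|c| * M) (fun t => c * h t).
Proof.
move=> [uh hM]; split=> [e e0|t t0]; last by rewrite normrM ler_wpM2l // hM.
have c1 : 0 < `|c| + 1 by rewrite ltr_wpDl.
have [d d0 H] := uh (e / (`|c| + 1)) (divr_gt0 e0 c1); exists d => // s t s0 t0 sd.
rewrite -mulrBr normrM; apply: (le_trans (ler_wpM2l (normr_ge0 _) (H _ _ s0 t0 sd))).
by rewrite mulrCA ler_piMr ?(ltW e0) // ler_pdivrMr // mul1r lerDl.
Qed.

Lemma bcontB M N h g : bcont M h -> bcont N g -> bcont (M + N) (fun t => h t - g t).
Proof.
move=> bh bg; have := bcontD bh (bcontZ (-1) bg); rewrite normrN1 mul1r.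
by congr bcont; apply/funext => t; rewrite mulN1r.
Qed.

Lemma bcont_shift M h t : 0 <= t -> bcont M h -> bcont M (fun s => h (t + s)).
Proof.
move=> t0 [uh hM]; split=> [e e0|s s0]; last by rewrite hM // addr_ge0.
have [d d0 H] := uh e e0; exists d => // r s r0 s0 rs.
by apply: H; rewrite ?addr_ge0 // opprD addrACA subrr add0r.
Qed.

Lemma bcont_continuous M h : bcont M h -> continuous (fun t => h `|t|).
Proof.
move=> [uh _] x; apply/cvgrPdist_le => e e0; have [d d0 H] := uh e e0.
exists d => //= y xy; apply: H => //; apply: le_lt_trans xy.
exact: ler_dist_dist.
Qed.

Lemma expN_continuous al : continuous (fun t => expR (- (al * t))).
Proof.
move=> x; apply: continuous_comp; last exact: continuous_expR.
by apply: cvgN; apply: cvgZr; exact: cvg_id.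
Qed.

(** The absolute value extends h evenly, so that the integrand is continuous on the whole line
    although [bcont] restricts h at nonnegative times only. *)
Let wh al h t := expR (- (al * t)) * h `|t|.

Lemma wh_continuous al M h : bcont M h -> continuous (wh al h).
Proof.
move=> bh x; apply: cvgM; first exact: expN_continuous.
exact: (bcont_continuous bh).
Qed.

Lemma wh_eq al h t : ray t -> wh al h t = expR (- (al * t)) * h t.
Proof. by rewrite /= in_itv /= andbT => t0; rewrite /wh ger0_norm. Qed.

Let measurable_exp al : measurable_fun ray (EFin \o (fun t => expR (- (al * t)))).
Proof.
apply/measurable_EFinP; apply: measurable_funTS; apply: continuous_measurable_fun.
exact: expN_continuous.
Qed.

Let measurable_wh al M h : bcont M h -> measurable_fun ray (EFin \o wh al h).
Proof.
move=> bh; apply/measurable_EFinP; apply: measurable_funTS; apply: continuous_measurable_fun.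
exact: wh_continuous bh.
Qed.

Lemma laplaceE al h : laplace al h = \int[leb]_(t in ray) wh al h t.
Proof. by apply: eq_Rintegral => t; rewrite inE => /wh_eq ->. Qed.

Lemma int_exp al : 0 < al ->
  (\int[leb]_(t in ray) (expR (- (al * t)))%:E = (al^-1)%:E)%E.
Proof.
move=> al0; have := @integral_exponential_pdf R al al0.
have -> : (\int[leb]_x (exponential_pdf al x)%:E =
    \int[leb]_(x in ray) (al * expR (- al * x))%:E)%E.
  rewrite [RHS]integral_mkcond; apply: eq_integral => x _.
  by rewrite -[RHS]/(((EFin \o (fun x => al * expR (- al * x))) \_ ray) x) restrict_EFin.
under eq_integral => x _ do rewrite EFinM mulNr.
rewrite ge0_integralZl //=; [|exact: measurable_exp|by rewrite lee_fin ltW].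
move=> H; rewrite -[LHS]mul1e -(mulVf (lt0r_neq0 al0)) EFinM -muleA H.
by rewrite mule1.
Qed.

Lemma exp_integrable al : 0 < al ->
  leb.-integrable ray (EFin \o (fun t => expR (- (al * t)))).
Proof.
move=> al0; apply/integrableP; split.
  exact: measurable_exp.
under eq_integral => x _ do rewrite /= ger0_norm ?expR_ge0 //.
by rewrite int_exp // ltry.
Qed.

Lemma wh_integrable al M h : 0 < al -> bcont M h -> leb.-integrable ray (EFin \o wh al h).
Proof.
move=> al0 bh; apply: (@le_integrable _ _ _ leb ray _ _ (fun t => (M * expR (- (al * t)))%:E)) => //.
- exact: measurable_wh bh.
- move=> x x0 /=; rewrite lee_fin /wh normrM ger0_norm ?expR_ge0 // normrM mulrC.
  rewrite [X in _ <= _ * X]ger0_norm ?expR_ge0 // ler_wpM2r ?expR_ge0 //.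
  by case: bh => _ /(_ `|x| (normr_ge0 _)) H; rewrite (le_trans H) // ler_norm.
- have -> : (fun t => (M * expR (- (al * t)))%:E) = (fun t => (M%:E * (EFin \o (fun t => expR (- (al * t)))) t)%E).
    by apply/funext => t /=; rewrite EFinM.
  by apply: integrableZl => //; exact: exp_integrable.
Qed.

Lemma laplaceD al M N h g : 0 < al -> bcont M h -> bcont N g ->
  laplace al (fun t => h t + g t) = laplace al h + laplace al g.
Proof.
move=> al0 bh bg; rewrite !laplaceE -RintegralD //; last 2 first.
- exact: wh_integrable al0 bh.
- exact: wh_integrable al0 bg.
by apply: eq_Rintegral => t _; rewrite /wh mulrDr.
Qed.

Lemma laplaceZ al M c h : 0 < al -> bcont M h ->
  laplace al (fun t => c * h t) = c * laplace al h.
Proof.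
move=> al0 bh; rewrite !laplaceE -RintegralZl //; last exact: wh_integrable al0 bh.
by apply: eq_Rintegral => t _; rewrite /wh mulrCA.
Qed.

Lemma laplaceB al M N h g : 0 < al -> bcont M h -> bcont N g ->
  laplace al (fun t => h t - g t) = laplace al h - laplace al g.
Proof.
move=> al0 bh bg; have := laplaceD al0 bh (bcontZ (-1) bg).
rewrite (laplaceZ _ al0 bg) mulN1r => <-; congr laplace.
by apply/funext => t; rewrite mulN1r.
Qed.

Lemma eq_laplace al h g : (forall t, 0 <= t -> h t = g t) -> laplace al h = laplace al g.
Proof.
move=> hg; apply: eq_Rintegral => t; rewrite inE /= in_itv /= andbT => t0.
by rewrite hg.
Qed.

Lemma le_laplace al M N h g : 0 < al -> bcont M h -> bcont N g ->
  (forall t, 0 <= t -> h t <= g t) -> laplace al h <= laplace al g.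
Proof.
move=> al0 bh bg hg; rewrite !laplaceE; apply: le_Rintegral => //.
- exact: wh_integrable al0 bh.
- exact: wh_integrable al0 bg.
by move=> t _; rewrite /wh ler_wpM2l ?expR_ge0 // hg.
Qed.

Lemma laplace_cst al c : 0 < al -> laplace al (fun=> c) = c / al.
Proof.
move=> al0; rewrite /laplace RintegralZr //; last exact: exp_integrable.
by rewrite /Rintegral int_exp // mulrC.
Qed.

Lemma laplace_bound al M h : 0 < al -> bcont M h -> `|laplace al h| <= M / al.
Proof.
move=> al0 bh; have M0 : 0 <= M by case: bh => _ /(_ 0 (lexx _)); exact: le_trans.
have hM t : 0 <= t -> - M <= h t <= M by case: bh => _ H /H; rewrite ler_norml.
rewrite ler_norml -mulNr -!laplace_cst //; apply/andP; split.
  by apply: (le_laplace al0 (bcont_cst _) bh) => t /hM/andP[].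
by apply: (le_laplace al0 bh (bcont_cst _)) => t /hM/andP[].
Qed.

Lemma laplace_ge0 al M h : 0 < al -> bcont M h -> (forall t, 0 <= t -> 0 <= h t) ->
  0 <= laplace al h.
Proof.
move=> al0 bh h0; rewrite -(mul0r al^-1) -laplace_cst //.
exact: (le_laplace al0 (bcont_cst _) bh).
Qed.

Lemma laplace_dominated al M (f : nat -> R -> R) h : 0 < al ->
  (forall n, bcont M (f n)) -> bcont M h ->
  (forall t, 0 <= t -> f n t @[n --> \oo] --> h t) ->
  laplace al (f n) @[n --> \oo] --> laplace al h.
Proof.
move=> al0 bf bh fh.
have [|||||| _ _ H] := @dominated_convergence _ _ _ leb ray _
   (fun n t => (wh al (f n) t)%:E) (fun t => (wh al h t)%:E) (fun t => (M * expR (- (al * t)))%:E).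
- exact: measurable_itv.
- by move=> n; exact: measurable_wh (bf n).
- exact: measurable_wh bh.
- apply: aeW => t /= t0; apply: cvg_EFin; first exact: nearW.
  by apply: cvgZr; apply: fh.
- have -> : (fun t => (M * expR (- (al * t)))%:E) = (fun t => (M%:E * (EFin \o (fun t => expR (- (al * t)))) t)%E).
    by apply/funext => t /=; rewrite EFinM.
  by apply: integrableZl => //; exact: exp_integrable.
- apply: aeW => t n /= t0; rewrite lee_fin /wh normrM ger0_norm ?expR_ge0 // mulrC.
  by rewrite ler_wpM2r ?expR_ge0 //; case: (bf n) => _; apply.
under eq_fun do rewrite laplaceE; rewrite laplaceE /Rintegral.
apply: fine_cvg; rewrite fineK; first exact: H.
exact: integrable_fin_num (wh_integrable al0 bh).
Qed.

Let shift_ge0 al M h t : 0 < al -> 0 <= t -> bcont M h -> (forall s, 0 <= s -> 0 <= h s) ->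
  \int[leb]_(s in `[t, +oo[) wh al h s = expR (- (al * t)) * laplace al (fun s => h (t + s)).
Proof.
move=> al0 t0 bh h0.
have bs := bcont_shift t0 bh.
have := @increasing_ge0_integration_by_substitutiony R (fun x => x + t) (wh al h) 0.
have dE : derive1 (fun x : R => x + t) = (fun=> 1 : R).
  by apply/funext => x; rewrite derive1E deriveD // derive_id derive_cst addr0.
rewrite dE add0r => H.
rewrite /Rintegral H; last 8 first.
- by move=> x y _ _ xy; rewrite ltrD2r.
- by move=> x _; exact: cvg_cst.
- by apply: is_cvg_cst.
- by apply: is_cvg_cst.
- split; first by move=> x _; apply: derivableD.
  by apply: cvgD; [exact: cvg_at_right_filter|exact: cvg_cst].
- apply/cvgryPge => A; exists (A - t); split; first exact: num_real.
  by move=> x Ax; rewrite -lerBlDr ltW.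
- apply: continuous_subspaceT; exact: (wh_continuous bh).
- by move=> x _; rewrite /wh mulr_ge0 ?expR_ge0 // h0.
rewrite laplaceE -RintegralZl //; last exact: wh_integrable al0 bs.
apply: eq_Rintegral => x; rewrite inE /= in_itv /= andbT => x0.
rewrite -[LHS]/(wh al h (x + t) * 1) mulr1 /wh !ger0_norm ?addr_ge0 // mulrA -expRD addrC.
by congr (expR _ * h _); ring.
Qed.

Lemma laplace_shift al M h t : 0 < al -> 0 < t -> bcont M h ->
  \int[leb]_(s in `[0, t]) wh al h s =
  laplace al h - expR (- (al * t)) * laplace al (fun s => h (t + s)).
Proof.
move=> al0 t0 bh; have bs := bcont_shift (ltW t0) bh.
have iS g N b : bcont N g -> leb.-integrable [set` Interval (BSide b t) +oo%O] (EFin \o wh al g).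
  move=> bg; apply: integrableS (wh_integrable al0 bg) => //.
  by apply: subset_itvr; case: b; rewrite bnd_simp // ltW.
have M0 : 0 <= M by case: bh => _ /(_ 0 (lexx _)); exact: le_trans.
(* [shift_ge0] requires a nonnegative function: it is applied to h + M and to the constant M, and
   the two identities are subtracted. *)
have b1 : bcont (M + `|M|) (fun s => h s + M) by apply: bcontD bh (bcont_cst M).
have b1s := bcont_shift (ltW t0) b1.
have h1 s : 0 <= s -> 0 <= h s + M.
  by case: bh => _ H /H; rewrite ler_norml => /andP[]; lra.
have E1 := shift_ge0 al0 (ltW t0) b1 h1.
have E2 := shift_ge0 al0 (ltW t0) (bcont_cst M) (fun _ _ => M0).
rewrite (laplaceD al0 bs (bcont_cst M)) mulrDr -E2 in E1.
have E3 : \int[leb]_(s in `[t, +oo[) wh al (fun s => h s + M) s =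
  \int[leb]_(s in `[t, +oo[) wh al h s + \int[leb]_(s in `[t, +oo[) wh al (fun=> M) s.
  rewrite -RintegralD //; [|exact: iS bh|exact: iS (bcont_cst M)].
  by apply: eq_Rintegral => s _; rewrite /wh mulrDr.
rewrite E3 in E1; move/addIr : E1 => <-.
rewrite laplaceE; have := @Rintegral_itvB R (wh al h) (BLeft 0) +oo%O t (wh_integrable al0 bh).
rewrite !bnd_simp (ltW t0) => /(_ isT isT).
rewrite Rintegral_itv_obnd_cbnd; last exact: iS bh.
by move=> <-; rewrite opprB addrC subrK.
Qed.

Lemma laplace_shift_le al M h t : 0 < al -> 0 < t -> bcont M h ->
  (forall s, 0 <= s -> 0 <= h s) ->
  laplace al (fun s => h (t + s)) <= expR (al * t) * laplace al h.
Proof.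
move=> al0 t0 bh h0; have := laplace_shift al0 t0 bh.
have : 0 <= \int[leb]_(s in `[0, t]) wh al h s.
  apply: Rintegral_ge0 => s /=; rewrite in_itv /= => /andP[s0 _].
  by rewrite /wh mulr_ge0 ?expR_ge0 // h0.
move=> /[swap] -> H; rewrite -(ler_pM2l (expR_gt0 (- (al * t)))) mulrA -expRD addNr expR0 mul1r.
by rewrite -subr_ge0.
Qed.

(** From exp(-x) >= 1 - x one gets (1 - x) exp x <= 1, and (1 - x)(1 + x + 2 x^2) >= 1 as long as x
    <= 1/2. *)
Lemma expR_quad (x : R) : 0 <= x -> x <= 2^-1 -> 1 + x <= expR x <= 1 + x + 2 * x ^+ 2.
Proof.
move=> x0 x1; rewrite expR_ge1Dx /=.
have H := expR_ge1Dx (- x); rewrite expRN in H.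
have e0 := expR_gt0 x.
have : expR x * (1 - x) <= 1.
  by rewrite -[leRHS](mulfV (lt0r_neq0 e0)) ler_pM2l.
nra.
Qed.

(** The arithmetic of [laplace_shift_expand]: E = exp(al t), L and A are the transforms of h and of
    its shift by t, B = A / E and k0 = h 0. The error splits into three terms, each at most 2 x M t,
    the last one with 2 e t added; hence the constants 2 and 6. *)
Let shift_algebra (x E L B A k0 M t e al : R) : 0 < al -> 0 < t -> 0 <= e -> 0 <= M -> x = al * t ->
  x <= 2^-1 -> 1 + x <= E -> E <= 1 + x + 2 * x ^+ 2 -> A = E * B -> al * `|L| <= M ->
  `|k0| <= M -> `|L - B - t * k0| <= t * (e + x * M) ->
  `|A - L - t * (al * L - k0)| <= t * (2 * e + 6 * (x * M)).
Proof.
move=> al0 t0 e0 M0 xE x1 E1 E2 AE LM hM.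
have x0 : 0 <= x by rewrite xE mulr_ge0 ?ltW.
set d := L - B - t * k0 => dM.
have -> : A - L - t * (al * L - k0) = (E - 1 - x) * L - (E - 1) * (t * k0) - E * d.
  by rewrite AE xE /d; ring.
have K1 : `|(E - 1 - x) * L| <= t * (2 * x * M).
  rewrite normrM ger0_norm; last by lra.
  apply: (@le_trans _ _ (2 * x ^+ 2 * `|L|)); first by rewrite ler_wpM2r //; lra.
  have -> : 2 * x ^+ 2 * `|L| = t * (2 * x * (al * `|L|)) by rewrite [in LHS]xE [in RHS]xE; ring.
  by rewrite ler_pM2l // ler_wpM2l // mulr_ge0.
have K2 : `|(E - 1) * (t * k0)| <= t * (2 * x * M).
  rewrite mulrCA normrM (gtr0_norm t0) ler_pM2l // normrM ger0_norm; last by lra.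
  by apply: ler_pM => //; [lra|nra].
have K3 : `|E * d| <= t * (2 * (e + x * M)).
  rewrite mulrCA normrM ger0_norm; last by lra.
  have xM : 0 <= e + x * M by rewrite addr_ge0 ?mulr_ge0.
  by apply: ler_pM => //; nra.
apply: (le_trans (ler_normB _ _)); apply: (le_trans (lerD (ler_normB _ _) (lexx _))).
lra.
Qed.

(** The derivative at t = 0 of the transform of the shift, with an error that depends on h only
    through M and its oscillation on [0, t]. In [gen_RR] this makes the difference quotients
    converge uniformly in the starting state. *)
Lemma laplace_shift_expand al M h t e : 0 < al -> 0 < t -> al * t <= 2^-1 -> bcont M h ->
  (forall s, 0 <= s -> s <= t -> `|h s - h 0| <= e) ->
  `|laplace al (fun s => h (t + s)) - laplace al h - t * (al * laplace al h - h 0)| <=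
    t * (2 * e + 6 * (al * M * t)).
Proof.
move=> al0 t0 alt bh he.
have M0 : 0 <= M by case: bh => _ /(_ 0 (lexx _)); exact: le_trans.
have e0 : 0 <= e by apply: le_trans (he 0 (lexx _) (ltW t0)).
have it : leb.-integrable `[0, t] (EFin \o wh al h).
  by apply: integrableS (wh_integrable al0 bh) => //; apply: subset_itvl.
have mt : fine (leb `[0, t]) = t.
  by rewrite lebesgue_measure_itv /= lte_fin t0 /= subr0.
have ic c : leb.-integrable `[0, t] (EFin \o (fun=> c)).
  apply: continuous_compact_integrable; first exact: segment_compact.
  by apply: continuous_subspaceT => x; exact: cvg_cst.
have H0 : \int[leb]_(s in `[0, t]) wh al h s - t * h 0 =
    \int[leb]_(s in `[0, t]) (wh al h s - h 0).
  by rewrite RintegralB // Rintegral_cst // mt mulrC.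
have : `|\int[leb]_(s in `[0, t]) (wh al h s - h 0)| <= t * (e + al * t * M).
  apply: (le_trans (le_normr_Rintegral _ _)) => //.
    by apply: (integrableB _ it (ic _)) => //.
  apply: (@le_trans _ _ (\int[leb]_(s in `[0, t]) (e + al * t * M))); last first.
    by rewrite Rintegral_cst // mt mulrC.
  apply: le_Rintegral => //; first by apply: integrable_norm; apply: (integrableB _ it (ic _)).
  move=> s; rewrite /= in_itv /= => /andP[s0 st].
  rewrite /wh (ger0_norm s0).
  have -> : expR (- (al * s)) * h s - h 0 = (h s - h 0) - (1 - expR (- (al * s))) * h s by ring.
  apply: (le_trans (ler_normB _ _)); apply: lerD; first exact: he.
  have als : 0 <= al * s by rewrite mulr_ge0 // ltW.
  have E1 := expR_ge1Dx (- (al * s)).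
  have E2 : expR (- (al * s)) <= 1 by rewrite -expR0 ler_expR oppr_le0.
  rewrite normrM ger0_norm; last by lra.
  apply: ler_pM => //; first by lra.
    by apply: (@le_trans _ _ (al * s)); [lra|rewrite ler_pM2l].
  by case: bh => _; apply.
rewrite -H0 (laplace_shift al0 t0 bh) => H1.
have /andP[E1 E2] := expR_quad (mulr_ge0 (ltW al0) (ltW t0)) alt.
have L1 := laplace_bound al0 bh; rewrite ler_pdivlMr // mulrC in L1.
have hM : `|h 0| <= M by case: bh => _; apply.
have -> : al * M * t = al * t * M by ring.
apply: (shift_algebra al0 t0 e0 M0 erefl alt E1 E2 _ L1 hM H1).
by rewrite mulrA -expRD subrr expR0 mul1r.
Qed.

End laplace_transform.

(** * Resolvents of Q-processes *)

Section Q_process_resolvent.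
Context {R : realType} (a b : nat -> R) (p : R -> nat -> nat -> R).
Hypotheses (hab : rates a b) (hs : (sigma a b < +oo)%E) (hp : Q_process a b p).
Implicit Types (F G H : nat -> R) (al c l M N : R) (s t : R).
Local Notation Qseq := (Qseq a b).

Lemma p_ge0 t i j : 0 <= t -> 0 <= p t i j.
Proof. by move=> t0; case: hp => -[H _ _ _] _ _; exact: H. Qed.

Lemma p_asum t i : 0 <= t -> asum (p t i).
Proof.
move=> t0; apply: asum_esum => [j|]; first exact: p_ge0.
by case: hp => -[_ /(_ t i t0) H _ _] _ _; exact: le_lt_trans H (ltry _).
Qed.

Lemma p_rsum_le1 t i : 0 <= t -> rsum (p t i) <= 1.
Proof.
move=> t0; rewrite -lee_fin -esum_asum; [|by move=> j; exact: p_ge0|exact: p_asum].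
by case: hp => -[_ /(_ t i t0)].
Qed.

Lemma p_le1 t i j : 0 <= t -> p t i j <= 1.
Proof.
move=> t0; apply: le_trans (p_rsum_le1 i t0).
by apply: rsum_term; [exact: p_asum|move=> k; exact: p_ge0].
Qed.

Lemma p_0 i j : p 0 i j = dlt j i.
Proof. by case: hp => -[_ _ -> _]. Qed.

Lemma p_CK s t i j : 0 <= s -> 0 <= t ->
  p (s + t) i j = rsum (fun k => p s i k * p t k j).
Proof.
move=> s0 t0; apply: EFin_inj; case: hp => -[_ _ _ ->] // _ _.
rewrite esum_asum //; first by move=> k; rewrite mulr_ge0 ?p_ge0.
apply: (@asum_mulr _ _ _ 1); first exact: p_asum.
by move=> k; rewrite ger0_norm ?p_ge0 ?p_le1.
Qed.

Definition PP t G i : R := rsum (fun j => p t i j * G j).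
Definition RR al G i : R := laplace al (fun t => PP t G i).

Lemma PP_asum t G M i : 0 <= t -> (forall k, `|G k| <= M) ->
  asum (fun j => p t i j * G j).
Proof. by move=> t0 GM; apply: asum_mulr GM; exact: p_asum. Qed.

Lemma PP_bound t G M i : 0 <= t -> (forall k, `|G k| <= M) -> `|PP t G i| <= M.
Proof.
move=> t0 GM; have M0 : 0 <= M by exact: le_trans (GM 0%N).
apply: (@le_trans _ _ (rsum (fun j => M * p t i j))).
  apply: rsum_norm => [|k]; first by apply: asumZ; exact: p_asum.
  by rewrite normrM mulrC (ger0_norm (p_ge0 _ _ t0)) ler_wpM2r ?p_ge0.
rewrite rsumZ; last exact: p_asum.
by rewrite ler_piMr ?p_rsum_le1.
Qed.

Lemma PPB t G H M N i : 0 <= t -> (forall k, `|G k| <= M) -> (forall k, `|H k| <= N) ->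
  PP t (fun k => G k - H k) i = PP t G i - PP t H i.
Proof.
move=> t0 GM HN; rewrite /PP -rsumB; [|exact: PP_asum GM|exact: PP_asum HN].
by congr rsum; apply/funext => k; rewrite mulrBr.
Qed.

Lemma PPD t G H M N i : 0 <= t -> (forall k, `|G k| <= M) -> (forall k, `|H k| <= N) ->
  PP t (fun k => G k + H k) i = PP t G i + PP t H i.
Proof.
move=> t0 GM HN; rewrite /PP -rsumD; [|exact: PP_asum GM|exact: PP_asum HN].
by congr rsum; apply/funext => k; rewrite mulrDr.
Qed.

Lemma PPZ t G M c i : 0 <= t -> (forall k, `|G k| <= M) ->
  PP t (fun k => c * G k) i = c * PP t G i.
Proof.
move=> t0 GM; rewrite /PP -rsumZ; last exact: PP_asum GM.
by congr rsum; apply/funext => k; rewrite mulrCA.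
Qed.

Lemma PP_le t G H M N i : 0 <= t -> (forall k, `|G k| <= M) -> (forall k, `|H k| <= N) ->
  (forall k, G k <= H k) -> PP t G i <= PP t H i.
Proof.
move=> t0 GM HN GH; apply: ler_rsum => [||k]; [exact: PP_asum GM|exact: PP_asum HN|].
by rewrite ler_wpM2l ?p_ge0.
Qed.

Lemma PP_dlt t j i : PP t (dlt j) i = p t i j.
Proof.
have [|_] := @rsum_single _ (fun k => p t i k * dlt j k) j.
  by move=> k kj; rewrite /dlt (negbTE kj) mulr0.
by rewrite /dlt eqxx mulr1.
Qed.

Lemma PP_0 G i : PP 0 G i = G i.
Proof.
have [|_] := @rsum_single _ (fun k => p 0 i k * G k) i.
  by move=> k ki; rewrite p_0 /dlt eq_sym (negbTE ki) mul0r.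
by rewrite p_0 /dlt eqxx mul1r.
Qed.

Lemma PP_semigroup s t G M i : 0 <= s -> 0 <= t -> (forall k, `|G k| <= M) ->
  PP (s + t) G i = PP s (PP t G) i.
Proof.
move=> s0 t0 GM; have M0 : 0 <= M by exact: le_trans (GM 0%N).
have cF k : asum (fun j => p s i k * (p t k j * G j)) by apply: asumZ; exact: PP_asum GM.
have cg : asum (fun k => M * p s i k) by apply: asumZ; exact: p_asum.
have [|_ _] := rsum_fubini cg cF.
  move=> k; under [X in rsum X]eq_fun do rewrite normrM.
  rewrite rsumZ; last by apply: asum_norm; exact: PP_asum GM.
  rewrite ger0_norm ?p_ge0 // mulrC ler_wpM2r ?p_ge0 //.
  apply: (@le_trans _ _ (rsum (fun j => M * p t k j))).
    apply: ler_rsum; [by apply: asum_norm; exact: PP_asum GM|by apply: asumZ; exact: p_asum|].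
    by move=> j; rewrite normrM mulrC (ger0_norm (p_ge0 _ _ t0)) ler_wpM2r ?p_ge0.
  rewrite rsumZ; last exact: p_asum.
by rewrite ler_piMr ?p_rsum_le1.
move=> E; rewrite /PP.
have -> : (fun j => p (s + t) i j * G j) = (fun j => rsum (fun k => p s i k * (p t k j * G j))).
  apply/funext => j; rewrite p_CK // mulrC -rsumZ; last first.
    apply: (@asum_mulr _ _ _ 1); first exact: p_asum.
    by move=> k; rewrite ger0_norm ?p_ge0 ?p_le1.
  by congr rsum; apply/funext => k; ring.
rewrite E; congr rsum; apply/funext => k; rewrite rsumZ //; exact: PP_asum GM.
Qed.

(** The mass that reaches other states and the mass that is no longer at i are both at most 1 -
    p_ii(r); each contributes M times that amount. *)
Lemma PP_near r G M i : 0 <= r -> (forall k, `|G k| <= M) ->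
  `|PP r G i - G i| <= 2 * M * (1 - p r i i).
Proof.
move=> r0 GM; have M0 : 0 <= M by exact: le_trans (GM 0%N).
have [|c1 E1] := @rsum_single _ (fun j => dlt i j * p r i i * G i) i.
  by move=> k ki; rewrite /dlt (negbTE ki) !mul0r.
have [|c2 E2] := @rsum_single _ (fun j => dlt i j * p r i i) i.
  by move=> k ki; rewrite /dlt (negbTE ki) !mul0r.
rewrite /= /dlt eqxx !mul1r in E1 E2.
have cG := @PP_asum _ _ _ i r0 GM; have cp := @p_asum _ i r0.
have c3 : asum (fun j => M * (p r i j - dlt i j * p r i i)) by apply: asumZ; exact: asumB.
have H : `|rsum (fun j => p r i j * G j - dlt i j * p r i i * G i)| <= M * (1 - p r i i).
  apply: (le_trans (rsum_norm c3 _)) => [k|].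
    rewrite /dlt; case: eqP => [->|_].
      by rewrite !mul1r !subrr normr0 mulr0.
    by rewrite !mul0r !subr0 normrM mulrC (ger0_norm (p_ge0 _ _ r0)) ler_wpM2r ?p_ge0.
  rewrite rsumZ; last exact: asumB.
  by rewrite rsumB // E2 ler_wpM2l // lerB // p_rsum_le1.
rewrite rsumB // E1 -/(PP r G i) in H.
have -> : PP r G i - G i = (PP r G i - p r i i * G i) - (1 - p r i i) * G i by ring.
apply: (le_trans (ler_normB _ _)).
have -> : 2 * M * (1 - p r i i) = M * (1 - p r i i) + (1 - p r i i) * M by ring.
apply: lerD => //; rewrite normrM ger0_norm ?subr_ge0 ?p_le1 // ler_wpM2l //.
by rewrite subr_ge0 p_le1.
Qed.

Lemma p_diag i e : 0 < e -> exists2 d, 0 < d & forall s, 0 <= s -> s < d -> 1 - p s i i <= e.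
Proof.
move=> e0; have [_ /(_ i i)/cvg_right0_epsP/(_ e e0)[d d0 H] _] := hp.
exists d => // s; rewrite le_eqVlt => /predU1P[<- _|s0 sd].
  by rewrite p_0 /dlt eqxx subrr ltW.
have := H s s0 sd; rewrite eqxx ler_distl => /andP[]; rewrite /=; lra.
Qed.

Lemma PP_bcont G M i : (forall k, `|G k| <= M) -> bcont M (fun t => PP t G i).
Proof.
move=> GM; have M0 : 0 <= M by exact: le_trans (GM 0%N).
split=> [e e0|t t0]; last exact: PP_bound.
have M1 : 0 < 2 * M + 1 by lra.
have [d d0 Hd] := p_diag i (divr_gt0 e0 M1); exists d => // s t.
wlog st : s t / s <= t.
  move=> W s0 t0 std; have [st|/ltW ts] := leP s t; first exact: W.
  by rewrite distrC; apply: W => //; rewrite distrC.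
move=> s0 t0; rewrite distrC ger0_norm ?subr_ge0 // => std.
(* Writing P_t G = P_(t-s) (P_s G), where P_s G has the same bound M as G, yields a modulus of
   continuity independent of s. *)
rewrite distrC -[in PP t](subrK s t) (PP_semigroup (M := M)) ?subr_ge0 //.
have ts0 : 0 <= t - s by rewrite subr_ge0.
have PM k : `|PP s G k| <= M by exact: PP_bound.
apply: (le_trans (PP_near i ts0 PM)).
have H1 := Hd _ ts0 std; have M2 : 0 <= 2 * M by lra.
apply: (le_trans (ler_wpM2l M2 H1)).
by rewrite mulrCA ler_piMr ?(ltW e0) // ler_pdivrMr // mul1r lerDl.
Qed.

Lemma sum_Qmatrix G i : \sum_(0 <= j < i.+2) Qmatrix a b i j * G j = Qseq G i.
Proof.
rewrite big_nat_recr // big_nat_recr //= /Qmatrix eqxx (gtn_eqF (ltnSn i)) eqxx.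
rewrite /Qseq; congr (_ + _); case: i => [|i].
  by rewrite big_geq // (a0 hab); ring.
rewrite big_nat_recr //= big_nat_cond big1 ?add0r => [|k /andP[/andP[_ ki] _]].
  by rewrite (ltn_eqF (ltnSn i)) (ltn_eqF (ltnW (ltnSn i.+1))) eqxx; ring.
have -> : (i.+1 == k.+1) = false by rewrite eqSS gtn_eqF.
by rewrite !ltn_eqF ?mul0r // ltnW // ltnW // ltnS.
Qed.

(** Row i of Q lives on the columns below i + 2, where the derivatives of p are summed. For G = 1,
    conservativity Q1 = 0 shows that the mass of row i of p(t) missing from these columns is o(t),
    so the remaining columns contribute at most M o(t). *)
Lemma PP_gen G M i : (forall k, `|G k| <= M) ->
  (PP t G i - G i) / t @[t --> 0^'+] --> Qseq G i.
Proof.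
move=> GM; have M0 : 0 <= M by exact: le_trans (GM 0%N).
pose S H t := \sum_(0 <= j < i.+2) (p t i j - p 0 i j) / t * H j.
have SH H : S H t @[t --> 0^'+] --> Qseq H i.
  rewrite -sum_Qmatrix.
  apply: (@cvg_fsum _ _ _ _ (fun j t => (p t i j - p 0 i j) / t * H j)) => j.
  by apply: cvgMl; case: hp.
have SE H t : t != 0 -> t * S H t = \sum_(0 <= j < i.+2) p t i j * H j - H i.
  move=> t0; rewrite /S mulr_sumr.
  transitivity (\sum_(0 <= j < i.+2) (p t i j * H j - dlt j i * H j)).
    by apply: eq_bigr => j _; rewrite p_0; field.
  rewrite sumrB; congr (_ - _); rewrite big_nat_recr //= big_nat_recr //=.
  rewrite big_nat_cond big1 => [|k /andP[/andP[_ ki] _]]; last by rewrite /dlt gtn_eqF // mul0r.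
  by rewrite /dlt eqxx ltn_eqF // mul0r mul1r add0r addr0.
apply/cvg_right0_epsP => e e0.
have M1 : 0 < 2 * (M + 1) by lra.
have /cvg_right0_epsP/(_ (e / 2) ltac:(lra))[d1 d10 H1] := SH G.
have := SH (fun=> 1); rewrite (Qseq_cst hab) => /cvg_right0_epsP/(_ _ (divr_gt0 e0 M1))[d2 d20 H2].
exists (Num.min d1 d2); first by rewrite lt_min d10.
move=> t t0; rewrite lt_min => /andP[td1 td2].
have := H2 t t0 td2; have := H1 t t0 td1; rewrite subr0 => A1 A2.
have tn := lt0r_neq0 t0.
have A3 : `|PP t G i - \sum_(0 <= j < i.+2) p t i j * G j| <= M * (1 - \sum_(0 <= j < i.+2) p t i j).
  pose T H j := if (j < i.+2)%N then H j else 0 : R.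
  have RT H : asum (T H) /\ rsum (T H) = \sum_(0 <= j < i.+2) H j.
    have [|c ->] := @rsum_fin _ (T H) i.+2; first by move=> k; rewrite leqNgt /T => /negbTE ->.
    split => //; rewrite big_nat_cond [RHS]big_nat_cond; apply: eq_bigr => k /andP[/andP[_ ki] _].
    by rewrite /T ki.
  have [c1 E1] := RT (fun j => p t i j * G j); have [c2 E2] := RT (p t i).
  have cp := @p_asum _ i (ltW t0); have cpG := @PP_asum _ _ _ i (ltW t0) GM.
  rewrite -E1 /PP -rsumB //.
  have cb : asum (fun j => M * (p t i j - T (p t i) j)) by apply: asumZ; exact: asumB.
  apply: (le_trans (rsum_norm cb _)) => [k|].
    rewrite /T; case: ifP => _; first by rewrite !subrr normr0 mulr0.
    by rewrite !subr0 normrM mulrC (ger0_norm (p_ge0 _ _ (ltW t0))) ler_wpM2r ?p_ge0 // ltW.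
  rewrite rsumZ; last exact: asumB.
  by rewrite rsumB // E2 ler_wpM2l // lerB // p_rsum_le1 // ltW.
have E3 := SE G t tn; have := SE (fun=> 1) t tn.
under eq_bigr do rewrite mulr1.
move=> E4; set X := S (fun=> 1) t in A2 E4.
have A5 : `|PP t G i - G i - t * S G t| <= t * (M * `|X|).
  rewrite E3; have -> : PP t G i - G i - (\sum_(0 <= j < i.+2) p t i j * G j - G i) =
    PP t G i - \sum_(0 <= j < i.+2) p t i j * G j by ring.
  apply: (le_trans A3); rewrite mulrCA ler_wpM2l // -[X in _ <= X * _](gtr0_norm t0) -normrM E4.
  by rewrite -normrN opprB ler_norm.
have -> : (PP t G i - G i) / t - Qseq G i =
   (PP t G i - G i - t * S G t) / t + (S G t - Qseq G i) by field.
apply: (le_trans (ler_normD _ _)).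
have A6 : `|(PP t G i - G i - t * S G t) / t| <= e / 2.
  rewrite normrM normfV (gtr0_norm t0) ler_pdivrMr // [leRHS]mulrC; apply: (le_trans A5).
  rewrite ler_pM2l //; apply: (le_trans (ler_wpM2l M0 A2)).
  by rewrite mulrA ler_pdivrMr //; nra.
lra.
Qed.

Lemma RR_bound al G M i : 0 < al -> (forall k, `|G k| <= M) -> `|RR al G i| <= M / al.
Proof. by move=> al0 GM; apply: laplace_bound => //; exact: PP_bcont. Qed.

Lemma RRD al G H M N i : 0 < al -> (forall k, `|G k| <= M) -> (forall k, `|H k| <= N) ->
  RR al (fun k => G k + H k) i = RR al G i + RR al H i.
Proof.
move=> al0 GM HN; rewrite /RR -(laplaceD al0 (PP_bcont i GM) (PP_bcont i HN)).
by apply: eq_laplace => t t0; exact: PPD GM HN.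
Qed.

Lemma RRZ al G M c i : 0 < al -> (forall k, `|G k| <= M) ->
  RR al (fun k => c * G k) i = c * RR al G i.
Proof.
move=> al0 GM; rewrite /RR -(laplaceZ _ al0 (PP_bcont i GM)).
by apply: eq_laplace => t t0; exact: PPZ GM.
Qed.

Lemma dlt_norm j k : `|dlt j k : R| <= 1.
Proof. by rewrite /dlt ger0_norm ?ler0n //; case: eqP => _; rewrite ?ler01. Qed.

Lemma RR_dlt al i j : RR al (dlt j) i = resolvent p al i j.
Proof. by apply: eq_laplace => t _; rewrite PP_dlt. Qed.

Definition trunc n G j : R := if (j < n)%N then G j else 0.

Lemma trunc_norm n G M j : (forall k, `|G k| <= M) -> `|trunc n G j| <= M.
Proof.
move=> GM; rewrite /trunc; case: ifP => // _.
by rewrite normr0; exact: le_trans (GM 0%N).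
Qed.

Lemma RR_trunc al n G M i : 0 < al -> (forall k, `|G k| <= M) ->
  RR al (trunc n G) i = \sum_(0 <= j < n) resolvent p al i j * G j.
Proof.
move=> al0 GM; elim: n => [|n IH].
  rewrite big_geq //; have -> : trunc 0 G = fun=> 0 * 0 by apply/funext => k; rewrite mul0r.
  by rewrite (@RRZ _ (fun=> 0) 0) ?mul0r // => k; rewrite normr0.
have -> : trunc n.+1 G = fun j => trunc n G j + G n * dlt n j.
  apply/funext => j; rewrite /trunc /dlt ltnS; case: ltngtP => [jn|nj|->] /=;
  by rewrite ?mulr0 ?mulr1 ?addr0 ?add0r.
rewrite (@RRD _ _ _ M `|G n|) //; last 2 first.
- by move=> k; exact: trunc_norm.
- by move=> k; rewrite normrM ler_piMr // dlt_norm.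
rewrite (@RRZ _ _ 1) //; last exact: dlt_norm.
by rewrite IH RR_dlt big_nat_recr //= [G n * _]mulrC.
Qed.

Lemma PP_trunc_cvg t G M i : 0 <= t -> (forall k, `|G k| <= M) ->
  PP t (trunc n G) i @[n --> \oo] --> PP t G i.
Proof.
move=> t0 GM; have -> : (fun n => PP t (trunc n G) i) = series (fun j => p t i j * G j).
  apply/funext => n; have [|_] := @rsum_fin _ (fun j => p t i j * trunc n G j) n.
    by move=> k; rewrite leqNgt /trunc => /negbTE ->; rewrite mulr0.
  rewrite /PP /series /= => ->; rewrite big_nat_cond [RHS]big_nat_cond.
  by apply: eq_bigr => k /andP[/andP[_ nsteps] _]; rewrite /trunc nsteps.
by apply: rsum_cvg; exact: PP_asum GM.
Qed.

Lemma RR_sum al G M i : 0 < al -> (forall k, `|G k| <= M) ->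
  series (fun j => resolvent p al i j * G j) @ \oo --> RR al G i.
Proof.
move=> al0 GM.
have -> : series (fun j => resolvent p al i j * G j) = (fun n => RR al (trunc n G) i).
  by apply/funext => n; rewrite (RR_trunc _ _ al0 GM).
apply: (laplace_dominated (M := M)) => //.
- by move=> n; apply: PP_bcont => k; exact: trunc_norm.
- exact: PP_bcont.
- by move=> t t0; exact: PP_trunc_cvg GM.
Qed.

Lemma resolvent_ge0 al i j : 0 < al -> 0 <= resolvent p al i j.
Proof.
move=> al0; rewrite -RR_dlt; apply: laplace_ge0 al0 (PP_bcont i (dlt_norm j)) _ => t t0.
by rewrite PP_dlt p_ge0.
Qed.

Lemma resolvent_asum al i : 0 < al ->
  asum (resolvent p al i) /\ al * rsum (resolvent p al i) <= 1.
Proof.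
move=> al0; have [n|H1 H2] := @asum_bound _ (resolvent p al i) al^-1 (fun j => resolvent_ge0 i j al0) _.
  have one (k : nat) : `|1 : R| <= 1 by rewrite normr1.
  have := RR_trunc n i al0 (G := fun=> 1) (M := 1) one.
  under eq_bigr do rewrite mulr1.
  move=> <-; rewrite -[leRHS]mul1r; apply: le_trans (ler_norm _) _.
  by apply: RR_bound => // k; apply: trunc_norm.
by split=> //; rewrite mulrC -ler_pdivlMr // div1r.
Qed.

Lemma RR_rsum al G M i : 0 < al -> (forall k, `|G k| <= M) ->
  RR al G i = rsum (fun j => resolvent p al i j * G j).
Proof. by move=> al0 GM; apply/esym/rsum_eq; exact: RR_sum GM. Qed.

Lemma laplace_deriv al M h : 0 < al -> bcont M h ->
  (laplace al (fun s => h (t + s)) - laplace al h) / t @[t --> 0^'+] -->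
    al * laplace al h - h 0.
Proof.
move=> al0 bh; have M0 : 0 <= M by case: bh => _ /(_ 0 (lexx _)); exact: le_trans.
apply/cvg_right0_epsP => e e0; have [/(_ (e / 4) ltac:(lra))[d d0 Hd] _] := bh.
have K0 : 0 < 12 * (al * M) + 1 by have := mulr_ge0 (ltW al0) M0; lra.
exists (Num.min d (Num.min ((2 * al)^-1) (e / (12 * (al * M) + 1)))).
  by rewrite !lt_min d0 invr_gt0 mulr_gt0 //= divr_gt0.
move=> t t0; rewrite !lt_min => /and3P[td ta te].
have alt : al * t <= 2^-1.
  by rewrite mulrC -ler_pdivlMr // -invfM ltW // mulrC.
have := laplace_shift_expand al0 t0 alt bh (e := e / 4) _.
move=> /(_ _)/wrap[s s0 st|].
  by apply: Hd => //; rewrite subr0 ger0_norm // (le_lt_trans st).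
set A := laplace al _; set L := laplace al h => H.
have -> : (A - L) / t - (al * L - h 0) = (A - L - t * (al * L - h 0)) / t.
  by field; exact: lt0r_neq0.
rewrite normrM normfV (gtr0_norm t0) ler_pdivrMr //.
rewrite [leRHS]mulrC; apply: (le_trans H).
rewrite ler_pM2l //; rewrite ltr_pdivlMr // in te.
have : 0 <= t by exact: ltW.
nra.
Qed.

(** The sum over states is exchanged with the integral over time: finite sums commute with the
    transform by linearity, and they are bounded by M for every number of terms, which allows
    dominated convergence. *)
Lemma PP_RR al t G M i : 0 < al -> 0 <= t -> (forall k, `|G k| <= M) ->
  PP t (RR al G) i = laplace al (fun s => PP (t + s) G i).
Proof.
move=> al0 t0 GM; have M0 : 0 <= M by exact: le_trans (GM 0%N).
have RM k := RR_bound k al0 GM.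
pose f n s := \sum_(0 <= j < n) p t i j * PP s G j.
have fb n s : 0 <= s -> `|f n s| <= M.
  move=> s0; apply: (le_trans (ler_norm_sum _ _ _)).
  apply: (@le_trans _ _ (\sum_(0 <= j < n) p t i j * M)).
    by apply: ler_sum => j _; rewrite normrM (ger0_norm (p_ge0 _ _ t0)) ler_wpM2l ?p_ge0 ?PP_bound.
  rewrite -mulr_suml ler_piMl //; apply: le_trans (p_rsum_le1 i t0).
  by apply: rsum_part; [exact: p_asum|move=> j; exact: p_ge0].
have fu n : exists N, bcont N (f n) /\ laplace al (f n) = \sum_(0 <= j < n) p t i j * RR al G j.
  elim: n => [|n [N [bN EN]]].
    rewrite big_geq //; exists `|0 : R|; have -> : f 0%N = fun=> 0 by apply/funext => s; rewrite /f big_geq.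
    by split; [exact: bcont_cst|rewrite laplace_cst // mul0r].
  have -> : f n.+1 = fun s => f n s + p t i n * PP s G n.
    by apply/funext => s; rewrite /f big_nat_recr.
  have b1 := bcontZ (p t i n) (PP_bcont n GM).
  eexists; split; first exact: bcontD bN b1.
  by rewrite (laplaceD al0 bN b1) EN (laplaceZ _ al0 (PP_bcont n GM)) big_nat_recr.
have L1 : laplace al (f n) @[n --> \oo] --> laplace al (fun s => PP (t + s) G i).
  apply: (laplace_dominated (M := M)) => //.
  - by move=> n; split; [have [N [[]]] := fu n|exact: fb].
  - exact: (bcont_shift t0 (@PP_bcont G M i GM)).
  - move=> s s0; rewrite (PP_semigroup _ t0 s0 GM).
    apply: (rsum_cvg (h := fun j => p t i j * PP s G j)).
    by apply: (PP_asum (M := M)) => // k; exact: PP_bound.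
apply/rsum_eq; have -> : series (fun j => p t i j * RR al G j) = fun n => laplace al (f n).
  by apply/funext => n; have [N [_ ->]] := fu n.
exact: L1.
Qed.

(** The difference quotient at t = 0 of P_t R_al G has limit Q R_al G by [PP_gen], and limit al R_al
    G - G by shifting the Laplace transform. *)
Lemma RR_gen al G M i : 0 < al -> (forall k, `|G k| <= M) ->
  Qseq (RR al G) i = al * RR al G i - G i.
Proof.
move=> al0 GM.
have L1 := PP_gen (i := i) (fun k => RR_bound k al0 GM).
have L2 := laplace_deriv al0 (PP_bcont i GM); rewrite PP_0 in L2.
apply: cvg_unique L1 _ => //; apply: cvg_trans L2; apply: near_eq_cvg.
near=> t; rewrite (PP_RR (M := M)) // ltW //; near: t; exact: nbhs_right_gt.
Unshelve. all: by end_near. Qed.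

Lemma RR_decomp al G M : 0 < al -> (forall k, `|G k| <= M) ->
  RR al G @ \oo --> limn (RR al G) /\
  forall i, RR al G i = PhiO a b al G i + limn (RR al G) * uu a b al i.
Proof.
move=> al0 GM; have c : cvgn (RR al G).
  apply: (Qseq_bounded_cvg hab hs (M := M + M)) => k; rewrite (RR_gen _ al0 GM).
  rewrite (le_trans (ler_normB _ _)) // lerD // normrM gtr0_norm // mulrC -ler_pdivlMr //.
  exact: RR_bound.
split=> // i; apply: (PhiO_unique hab hs al0 c GM) => k.
by rewrite (RR_gen _ al0 GM); ring.
Qed.

(* The boundary part of the resolvent, see [resolvent_decomp]. *)
Definition rr al j : R := limn (RR al (dlt j)).

Lemma resolvent_decomp al i j : 0 < al ->
  resolvent p al i j = Phi a b al i j + uu a b al i * rr al j.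
Proof.
move=> al0; have [_ H] := RR_decomp al0 (dlt_norm j).
by rewrite -RR_dlt H (PhiO_dlt a b al) mulrC.
Qed.

Lemma rr_ge0 al j : 0 < al -> 0 <= rr al j.
Proof.
move=> al0; have [c _] := RR_decomp al0 (dlt_norm j).
by apply: limn_ge => // k; rewrite RR_dlt resolvent_ge0.
Qed.

Lemma Phi_le_resolvent al i j : 0 < al -> Phi a b al i j <= resolvent p al i j.
Proof.
move=> al0; rewrite resolvent_decomp // lerDl mulr_ge0 ?rr_ge0 // ltW //.
exact: uu_gt0.
Qed.

Lemma rr_asum al : 0 < al -> asum (rr al) /\ al * rsum (rr al) <= 1.
Proof.
move=> al0; have u0 := uu_gt0 hab hs al0.
have [n|H1 H2] := @asum_bound _ (rr al) al^-1 (fun j => rr_ge0 j al0) _.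
  (* The total mass of row k of the resolvent bounds u_k times any partial sum of the weights; as k
     tends to infinity u_k tends to 1. *)
  have H k : uu a b al k * \sum_(0 <= j < n) rr al j <= al^-1.
    have [c1 c2] := resolvent_asum k al0.
    apply: (@le_trans _ _ (\sum_(0 <= j < n) resolvent p al k j)).
      rewrite mulr_sumr; apply: ler_sum => j _; rewrite resolvent_decomp // lerDr.
      exact: Phi_ge0.
    apply: le_trans (rsum_part n c1 (fun j => resolvent_ge0 k j al0)) _.
    by rewrite -[leRHS]div1r ler_pdivlMr // mulrC.
  rewrite -[leLHS]mul1r; apply: (cvgn_le_lim _ (cvg_cst _) H).
  by apply: cvgMl; exact: uu_cvg.
by split=> //; rewrite mulrC -ler_pdivlMr // div1r.
Qed.

Lemma rr_mul_asum al G M : 0 < al -> (forall k, `|G k| <= M) -> asum (fun j => rr al j * G j).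
Proof. by move=> al0 GM; apply: asum_mulr GM; have [] := rr_asum al0. Qed.

Lemma RR_limn al G M : 0 < al -> (forall k, `|G k| <= M) ->
  limn (RR al G) = rsum (fun j => rr al j * G j).
Proof.
move=> al0 GM; have [_ /(_ 0%N)] := RR_decomp al0 GM.
have u0 := uu_gt0 hab hs al0 0.
rewrite (RR_rsum _ al0 GM).
have -> : (fun j => resolvent p al 0 j * G j) =
   fun j => Phi a b al 0 j * G j + uu a b al 0 * (rr al j * G j).
  by apply/funext => j; rewrite resolvent_decomp //; ring.
rewrite rsumD; [|exact: (PhiO_asum hab hs al0 GM)|by apply: asumZ; exact: rr_mul_asum GM].
rewrite rsumZ; last exact: rr_mul_asum GM.
move=> /addrI; rewrite [RHS]mulrC => /(mulfI (lt0r_neq0 u0)) //.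
Qed.

End Q_process_resolvent.

(** * Truncations and the behaviour of al Phi for large al *)

Section truncation.
Context {R : realType} (a b : nat -> R).
Hypotheses (hab : rates a b) (hs : (sigma a b < +oo)%E).
Implicit Types (F G H : nat -> R) (al c l M N e : R).

Lemma trunc_cvg0 n G : trunc n G @ \oo --> (0 : R).
Proof.
apply/cvgn_epsP => e e0; exists n => m nm.
by rewrite /trunc ltnNge nm subr0 normr0 ltW.
Qed.

Lemma dlt_cvg0 j : dlt j @ \oo --> (0 : R).
Proof.
apply/cvgn_epsP => e e0; exists j.+1 => m jm.
by rewrite /dlt gtn_eqF // subr0 normr0 ltW.
Qed.

Lemma Qseq_trunc_0 n G k : (n < k)%N -> Qseq a b (trunc n G) k = 0.
Proof.
case: k => // k nk; rewrite /Qseq /trunc !ltnNge.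
rewrite (leqW (ltnW nk)) (ltnW nk) -ltnS nk /=; ring.
Qed.

Lemma Qseq_trunc_bound n G M : (forall k, `|G k| <= M) ->
  exists C, forall k, `|Qseq a b (trunc n G) k| <= C.
Proof.
move=> GM; have M0 : 0 <= M by exact: le_trans (GM 0%N).
exists (\sum_(0 <= k < n.+1) 2 * (a k + b k) * M) => k.
have P i : 0 <= 2 * (a i + b i) * M by rewrite !mulr_ge0 // ltW // q_gt0.
have [nk|] := ltnP n k; first by rewrite Qseq_trunc_0 // normr0 sumr_ge0.
move=> nsteps; apply: (le_trans (Qseq_bound hab k (fun i => trunc_norm n i GM))).
rewrite (big_cat_nat (leq0n k.+1)) //= big_nat_recr //= -addrA addrCA lerDl.
by rewrite addr_ge0 // sumr_ge0.
Qed.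

(** A truncation of G has a bounded image under Q, so [PhiO_approx] applies to it with error C / al;
    the rest is at most e / 4 and al Phi is a contraction. *)
Lemma PhiO_strong G e : G @ \oo --> (0 : R) -> 0 < e ->
  exists2 A, 0 < A & forall al, A <= al -> forall k, `|al * PhiO a b al G k - G k| <= e.
Proof.
move=> G0 e0; have [M M0 GM] : exists2 M, 0 <= M & forall k, `|G k| <= M.
  by apply: cvgn_bounded; apply/cvg_ex; exists 0.
have /cvgn_epsP/(_ (e / 4) ltac:(lra))[n Hn] := G0.
have [C HC] := Qseq_trunc_bound n GM.
have C0 : 0 <= C by exact: le_trans (HC 0%N).
exists ((C + 1) / (e / 4)) => [|al Aal k]; first by rewrite divr_gt0 //; lra.
have al0 : 0 < al by apply: lt_le_trans Aal; rewrite divr_gt0 //; lra.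
pose T := trunc n G; pose S k := G k - T k.
have SM i : `|S i| <= e / 4.
  rewrite /S /T /trunc; case: ltnP => ni; last by rewrite subr0; have := Hn i ni; rewrite subr0.
  by rewrite subrr normr0; lra.
have TM i : `|T i| <= M by exact: trunc_norm.
have E : PhiO a b al G k = PhiO a b al T k + PhiO a b al S k.
  have := PhiOB hab hs al0 k GM TM; rewrite -/S => ->; ring.
have H1 := PhiO_approx hab hs al0 (trunc_cvg0 n G) TM HC k.
have H2 := PhiO_bound hab hs al0 k SM.
have H3 : `|al * PhiO a b al S k| <= e / 4.
  rewrite normrM gtr0_norm // mulrC -ler_pdivlMr //; apply: (le_trans H2).
  rewrite ler_pM2r ?invr_gt0 // ler_piMr //; first by lra.
  by have := uu_gt0 hab hs al0 k; lra.
have H4 : C / al <= e / 4.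
  by rewrite ler_pdivrMr // mulrC -ler_pdivrMr; [apply: le_trans Aal; rewrite ler_pM2r ?invr_gt0; lra|lra].
have -> : al * PhiO a b al G k - G k =
   (al * PhiO a b al T k - T k) + (al * PhiO a b al S k - S k) by rewrite E /S; ring.
apply: (le_trans (ler_normD _ _)); have := SM k.
have : `|al * PhiO a b al S k - S k| <= `|al * PhiO a b al S k| + `|S k| by exact: ler_normB.
lra.
Qed.

End truncation.

(** * Generators of Feller Q-processes *)

Section Feller_generator.
Context {R : realType} (a b : nat -> R) (p : R -> nat -> nat -> R).
Hypotheses (hab : rates a b) (hs : (sigma a b < +oo)%E) (hp : Q_process a b p).
Implicit Types (F G H : nat -> R) (al c l M N e : R) (s t : R).
Local Notation Qseq := (Qseq a b).
Local Notation PP := (PP p).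
Local Notation RR := (RR p).
(** Non-branching of infinity in terms of sequences; [FellerP] shows that it is equivalent to
    [Feller_Q_process]. *)
Hypothesis hF : forall G, cvgn G -> al * limn (RR al G) @[al --> +oo] --> limn G.

(** With c the limit of G, the error is that of al Phi on G - c, which vanishes at infinity, plus
    (al lim R_al G - c) u. The first is small by [PhiO_strong], the second by [hF]. *)
Lemma RR_strong G e : cvgn G -> 0 < e ->
  exists2 al, 0 < al & forall k, `|al * RR al G k - G k| <= e.
Proof.
move=> cG e0; have e4 : e / 4 + e / 4 * 1 <= e by lra.
set c : R := limn G; have [M M0 GM] := cvgn_bounded cG.
pose G0 k := G k - c.
have G00 : G0 @ \oo --> (0 : R).
  by rewrite -(subrr c); apply: cvgB; [exact: cG|exact: cvg_cst].
have cc : cvgn (fun _ : nat => c) by exact: is_cvg_cst.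
have [A A0 HA] := PhiO_strong hab hs G00 (e := e / 4) ltac:(lra).
have /cvg_pinfty_epsP/(_ (e / 4) ltac:(lra))[A1 HA1] := hF cG.
pose al := Num.max A (A1 + 1).
have [alA al1] : A <= al /\ A1 < al.
  by rewrite /al; split; [rewrite le_max lexx|rewrite lt_max ltrDl ltr01 orbT].
have al0 : 0 < al by exact: lt_le_trans alA.
exists al => // k.
have [_ /(_ k) ->] := RR_decomp hab hs hp al0 GM.
have cM (i : nat) : `|c| <= `|c| by [].
have E : PhiO a b al G k = PhiO a b al G0 k + PhiO a b al (fun=> c) k.
  have := PhiOB hab hs al0 k GM cM; rewrite -/G0 => ->; ring.
have E2 := PhiO_cst hab hs al0 c k.
have H1 := HA al alA k; have H2 := HA1 al al1.
have u0 := uu_norm hab hs al0 k.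
have -> : al * (PhiO a b al G k + limn (RR al G) * uu a b al k) - G k =
  (al * PhiO a b al G0 k - G0 k) + (al * limn (RR al G) - c) * uu a b al k.
  by rewrite E mulrDr (mulrDr al (PhiO a b al G0 k)) E2 /G0; ring.
apply: (le_trans (ler_normD _ _)).
have : `|(al * limn (RR al G) - c) * uu a b al k| <= e / 4 * 1 by rewrite normrM ler_pM.
by move=> H3; apply: le_trans e4; exact: lerD.
Qed.

Lemma RR_bounded al G M : 0 < al -> (forall k, `|G k| <= M) -> forall k, `|RR al G k| <= M / al.
Proof. by move=> al0 GM k; exact: (RR_bound hp k al0 GM). Qed.

Lemma PP_RR_lip al t G M i : 0 < al -> 0 < t -> al * t <= 2^-1 -> (forall k, `|G k| <= M) ->
  `|PP t (RR al G) i - RR al G i| <= 9 * M * t.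
Proof.
move=> al0 t0 alt GM; have M0 : 0 <= M by exact: le_trans (GM 0%N).
have bh := PP_bcont hp i GM.
(* The oscillation of t -> P_t G(i) is bounded crudely by 2 M. The error is then at most (4 M + 3 M)
   t since al t <= 1/2, and the main term adds 2 M t: this is the constant 9. *)
have H := laplace_shift_expand al0 t0 alt bh (e := 2 * M).
rewrite (PP_RR hp i al0 (ltW t0) GM).
have := H _ => /(_ _)/wrap[s s0 st|].
  rewrite (PP_0 hp) (le_trans (ler_normB _ _)) // mulr2n mulrDl mul1r lerD //.
  exact: (PP_bound hp).
rewrite -/(RR al G i) (PP_0 hp); set A := laplace al _; set L := RR al G i => H1.
have H2 : `|al * L| <= M by rewrite normrM gtr0_norm // mulrC -ler_pdivlMr // RR_bounded.
have H3 : `|al * L - G i| <= 2 * M.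
  by rewrite (le_trans (ler_normB _ _)) // mulr2n mulrDl mul1r lerD.
have H4 : `|t * (al * L - G i)| <= t * (2 * M) by rewrite normrM gtr0_norm // ler_pM2l.
have -> : A - L = (A - L - t * (al * L - G i)) + t * (al * L - G i) by ring.
apply: (le_trans (ler_normD _ _)).
have : al * M * t <= M * 2^-1 by rewrite mulrAC mulrC ler_wpM2l.
move=> H5; have : t * (6 * (al * M * t)) <= t * (6 * (M * 2^-1)) by rewrite ler_pM2l //; lra.
lra.
Qed.

Lemma PP_strong G e : cvgn G -> 0 < e ->
  exists2 d, 0 < d & forall s, 0 <= s -> s < d -> forall k, `|PP s G k - G k| <= e.
Proof.
move=> cG e0; have [M M0 GM] := cvgn_bounded cG.
have [al al0 Hal] := RR_strong cG (e := e / 4) ltac:(lra).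
pose F k := al * RR al G k.
have FM k : `|F k| <= M.
  by rewrite normrM gtr0_norm // mulrC -ler_pdivlMr // RR_bounded.
(* For s below the inverse of this number, the first summand ensures al 9 M s <= e / 2 and the
   second al s <= 1/2, as [PP_RR_lip] requires. *)
have K0 : 0 < al * (9 * M) * 2 / e + 2 * al.
  by rewrite ltr_wpDl ?mulr_gt0 // divr_ge0 ?mulr_ge0 // ltW.
exists (al * (9 * M) * 2 / e + 2 * al)^-1; first by rewrite invr_gt0.
move=> s; rewrite le_eqVlt => /predU1P[<-|s0] sd k.
  by rewrite (PP_0 hp) subrr normr0 ltW.
have sK : s * (al * (9 * M) * 2 / e + 2 * al) <= 1.
  by rewrite -ler_pdivlMr // mul1r ltW.
have X0 : 0 <= al * (9 * M) * 2 / e by rewrite divr_ge0 ?mulr_ge0 // ltW.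
have Y0 : 0 <= s * (al * (9 * M) * 2 / e) by rewrite mulr_ge0 // ltW.
have als : al * s <= 2^-1 by nra.
have H1 := PP_RR_lip k al0 s0 als GM.
have H2 : `|PP s F k - F k| <= e / 2.
  rewrite /F (PPZ hp al k (ltW s0) (RR_bounded al0 GM)) -mulrBr normrM gtr0_norm //.
  apply: (le_trans (ler_wpM2l (ltW al0) H1)).
  have : s * (al * (9 * M) * 2 / e) <= 1 by nra.
  have -> : s * (al * (9 * M) * 2 / e) = (al * (9 * M * s) * 2) / e by field; exact: lt0r_neq0.
  rewrite ler_pdivrMr //; lra.
have H3 : `|PP s (fun k => F k - G k) k| <= e / 4 by exact: (PP_bound hp k (ltW s0) Hal).
rewrite (PPB hp k (ltW s0) FM GM) in H3.
have -> : PP s G k - G k = (PP s F k - F k) - (PP s F k - PP s G k) + (F k - G k) by ring.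
apply: (le_trans (ler_normD _ _)); apply: (le_trans (lerD (ler_normB _ _) (lexx _))).
by have := Hal k; rewrite -/(F k); lra.
Qed.

(** al R_al (P_t G) converges by [RR_decomp]; by commutation it equals P_t (al R_al G), which is
    uniformly close to P_t G. *)
Lemma PP_cvgn t G : 0 <= t -> cvgn G -> cvgn (PP t G).
Proof.
move=> t0 cG; have [M M0 GM] := cvgn_bounded cG; apply: cvgn_unif => e e0.
have [al al0 Hal] := RR_strong cG e0.
exists (fun k => al * RR al (PP t G) k) => [|k].
  apply: is_cvgZr; have [c _] := RR_decomp hab hs hp al0 (fun k => PP_bound hp k t0 GM).
  by apply/cvg_ex; eexists; exact: c.
have E : RR al (PP t G) k = PP t (RR al G) k.
  rewrite (PP_RR hp k al0 t0 GM); apply: eq_laplace => s s0.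
  by rewrite addrC (PP_semigroup hp k s0 t0 GM).
have FM j : `|al * RR al G j| <= M.
  by rewrite normrM gtr0_norm // mulrC -ler_pdivlMr // RR_bounded.
rewrite E -(PPZ hp al k t0 (RR_bounded al0 GM)) distrC -(PPB hp k t0 FM GM).
exact: (PP_bound hp).
Qed.

(* [generator_lim] without the point at infinity, see [generator_limP]. *)
Definition gen F G : Prop := forall e, 0 < e -> exists2 d, 0 < d &
  forall t, 0 < t -> t < d -> forall i, `|(PP t F i - F i) / t - G i| <= e.

Lemma gen_RR al G : 0 < al -> cvgn G -> gen (RR al G) (fun i => al * RR al G i - G i).
Proof.
move=> al0 cG e e0; have [M M0 GM] := cvgn_bounded cG.
have [d d0 Hd] := PP_strong cG (e := e / 4) ltac:(lra).
have K0 : 0 < 12 * (al * M) + 1 by have := mulr_ge0 (ltW al0) M0; lra.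
exists (Num.min d (Num.min ((2 * al)^-1) (e / (12 * (al * M) + 1)))).
  by rewrite !lt_min d0 invr_gt0 mulr_gt0 //= divr_gt0.
move=> t t0; rewrite !lt_min => /and3P[td ta te] i.
have alt : al * t <= 2^-1 by rewrite mulrC -ler_pdivlMr // -invfM ltW // mulrC.
have := laplace_shift_expand al0 t0 alt (PP_bcont hp i GM) (e := e / 4).
move=> /(_ _)/wrap[s s0 st|].
  by rewrite (PP_0 hp); apply: Hd => //; exact: le_lt_trans td.
rewrite (PP_RR hp i al0 (ltW t0) GM) (PP_0 hp) -/(RR al G i).
set A := laplace al _; set L := RR al G i => H.
have -> : (A - L) / t - (al * L - G i) = (A - L - t * (al * L - G i)) / t.
  by field; exact: lt0r_neq0.
rewrite normrM normfV (gtr0_norm t0) ler_pdivrMr // [leRHS]mulrC; apply: (le_trans H).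
rewrite ler_pM2l //; rewrite ltr_pdivlMr // in te.
have : 0 <= t by exact: ltW.
nra.
Qed.

Lemma genB F F' G G' M N : (forall k, `|F k| <= M) -> (forall k, `|F' k| <= N) ->
  gen F G -> gen F' G' -> gen (fun k => F k - F' k) (fun k => G k - G' k).
Proof.
move=> FM FN g1 g2 e e0.
have [d1 d10 H1] := g1 (e / 2) ltac:(lra); have [d2 d20 H2] := g2 (e / 2) ltac:(lra).
exists (Num.min d1 d2); first by rewrite lt_min d10.
move=> t t0; rewrite lt_min => /andP[td1 td2] i.
rewrite (PPB hp i (ltW t0) FM FN).
have -> : (PP t F i - PP t F' i - (F i - F' i)) / t - (G i - G' i) =
  ((PP t F i - F i) / t - G i) - ((PP t F' i - F' i) / t - G' i) by field; exact: lt0r_neq0.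
apply: (le_trans (ler_normB _ _)); have := H1 t t0 td1 i; have := H2 t t0 td2 i; lra.
Qed.

Lemma gen_opp F G M : (forall k, `|F k| <= M) -> gen F G ->
  gen (fun k => - F k) (fun k => - G k).
Proof.
move=> FM g e e0; have [d d0 H] := g e e0; exists d => // t t0 td i.
have -> : PP t (fun k => - F k) i = - PP t F i.
  rewrite -mulN1r -(PPZ hp (-1) i (ltW t0) FM); congr (PP t _ i).
  by apply/funext => k; rewrite mulN1r.
by rewrite -opprD mulNr -opprD normrN; exact: H.
Qed.

Lemma gen_Qseq F G M i : (forall k, `|F k| <= M) -> gen F G -> G i = Qseq F i.
Proof.
move=> FM g; apply: (cvg_unique _ _ (PP_gen hab hp (i := i) FM)) => //.
apply/cvg_right0_epsP => e /g[d d0 H]; exists d => // t t0 td; exact: H.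
Qed.

(** Positive maximum principle at infinity. If G(oo) > 0, fix t such that the difference quotient is
    uniformly within G(oo) / 2 of G. Since P_t F <= F(oo), letting the state tend to infinity gives
    G(oo) / 2 <= 0. *)
Lemma gen_max F G : cvgn F -> cvgn G -> gen F G -> (forall k, F k <= limn F) ->
  0 <= limn F -> limn G <= 0.
Proof.
move=> cF cG g Fm m0; rewrite leNgt; apply/negP => G0.
have [M M0 FM] := cvgn_bounded cF.
have [d d0 H] := g (limn G / 2) ltac:(lra).
have t0 : 0 < d / 2 by lra.
have {}H := H (d / 2) t0 ltac:(lra).
have mM (k : nat) : `|limn F| <= `|limn F| by [].
have PF i : PP (d / 2) F i <= limn F.
  apply: le_trans (PP_le hp i (ltW t0) FM mM Fm) _.
  have one (k : nat) : `|1 : R| <= 1 by rewrite normr1.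
  have := PPZ hp (limn F) i (ltW t0) one.
  under [X in _ (d / 2) X i = _]eq_fun do rewrite mulr1.
  move=> ->; rewrite ler_piMr //; apply: le_trans (ler_norm _) _; exact: (PP_bound hp i (ltW t0) one).
have K i : G i - limn G / 2 <= (limn F - F i) / (d / 2).
  have := H i; rewrite ler_distl => /andP[H2 _].
  have : (PP (d / 2) F i - F i) / (d / 2) <= (limn F - F i) / (d / 2).
    by rewrite ler_pM2r ?invr_gt0 // lerB.
  exact: le_trans.
have L1 : (fun i => G i - limn G / 2) @ \oo --> limn G - limn G / 2.
  by apply: cvgB; [exact: cG|exact: cvg_cst].
have L2 : (fun i => (limn F - F i) / (d / 2)) @ \oo --> (limn F - limn F) / (d / 2).
  by apply: cvgMl; apply: cvgB; [exact: cvg_cst|exact: cF].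
have := cvgn_le_lim L1 L2 K; rewrite subrr mul0r subr_le0.
by rewrite ler_pdivlMr // mulr_natr mulr2n gerDl leNgt G0.
Qed.

Lemma RR_cvgn al G M : 0 < al -> (forall k, `|G k| <= M) -> cvgn (RR al G).
Proof.
by move=> al0 GM; have [c _] := RR_decomp hab hs hp al0 GM; apply/cvg_ex; eexists; exact: c.
Qed.

Lemma resol_cvgn al F : cvgn F -> cvgn (Qseq F) -> cvgn (fun k => al * F k - Qseq F k).
Proof. by move=> cF cQ; apply: is_cvgB => //; exact: is_cvgZr. Qed.

(** Forward, D = F - R_al H satisfies [gen D (al D)], hence D = c u, and c > 0 or c < 0 contradicts
    the maximum principle for D or - D. Backward, F and R_al H solve the same equation with the same
    limit, so they coincide. *)
Lemma gen_iff al F G : 0 < al -> cvgn F -> cvgn G ->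
  gen F G <-> (forall i, G i = Qseq F i) /\
    limn F = rsum (fun j => rr p al j * (al * F j - Qseq F j)).
Proof.
move=> al0 cF cG; have [M M0 FM] := cvgn_bounded cF.
have HQ : (forall i, G i = Qseq F i) -> cvgn (Qseq F).
  by move=> E; rewrite -(funext E).
pose H k := al * F k - Qseq F k.
split=> [g|[GQ E]].
  have GQ i := gen_Qseq i FM g; split=> //.
  have cH : cvgn H by apply: resol_cvgn => //; exact: HQ.
  have [N N0 HN] := cvgn_bounded cH.
  have cR := RR_cvgn al0 HN; have RN := RR_bounded al0 HN.
  pose D k := F k - RR al H k.
  have cD : cvgn D by exact: is_cvgB.
  have gD : gen D (fun k => al * D k).
    have := genB FM RN g (gen_RR al0 cH).
    congr gen; apply/funext => k; rewrite GQ /D /H; ring.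
  have DM k : `|D k| <= M + N / al by rewrite (le_trans (ler_normB _ _)) // lerD.
  have ker k : Qseq D k = al * D k by rewrite (gen_Qseq k DM gD).
  have DE := ker_uu hab hs al0 cD ker.
  have limaD : limn (fun k => al * D k) = al * limn D.
    by apply/cvg_lim => //; apply: cvgZr; exact: cD.
  have caD : cvgn (fun k => al * D k) by exact: is_cvgZr.
  have caD' : cvgn (fun k => - (al * D k)) by exact: is_cvgN.
  have c0 : limn D = 0.
    apply/eqP; rewrite eq_le; apply/andP; split; rewrite leNgt; apply/negP => D0.
      have := gen_max cD caD gD _ (ltW D0); rewrite limaD.
      move=> /(_ _)/wrap[k|]; first by rewrite DE ler_piMr ?(ltW D0) // uu_le1.
      by rewrite leNgt mulr_gt0.
    have cD' : cvgn (fun k => - D k) by exact: is_cvgN.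
    have limD' : limn (fun k => - D k) = - limn D by apply/cvg_lim => //; apply: cvgN; exact: cD.
    have := gen_max cD' caD' (gen_opp DM gD); rewrite limD'.
    move=> /(_ _)/wrap[k|]; first by rewrite DE -mulNr ler_piMr ?uu_le1 // oppr_ge0 ltW.
    move=> /(_ _)/wrap[|]; first by rewrite oppr_ge0 ltW.
    have -> : limn (fun k => - (al * D k)) = - (al * limn D).
      by apply/cvg_lim => //; apply: cvgN; apply: cvgZr; exact: cD.
    by rewrite leNgt oppr_gt0 pmulr_rlt0 // D0.
  rewrite -(RR_limn hab hs hp al0 HN).
  have -> : limn F = limn D + limn (RR al H).
    apply/cvg_lim => //; have -> : F = fun k => D k + RR al H k.
      by apply/funext => k; rewrite /D subrK.
    by apply: cvgD.
  by rewrite c0 add0r.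
have cH : cvgn H by apply: resol_cvgn => //; exact: HQ.
have [N N0 HN] := cvgn_bounded cH.
rewrite -/H -(RR_limn hab hs hp al0 HN) in E.
have FE k : F k = RR al H k.
  have [_ ->] := RR_decomp hab hs hp al0 HN; rewrite -E.
  exact: (PhiO_unique hab hs al0 cF HN (fun=> erefl)).
have := gen_RR al0 cH; rewrite -(funext FE).
by congr gen; apply/funext => k; rewrite GQ /H; ring.
Qed.

(** With c the value of the sum, H = F + c u has limit c and the same image as F under al - Q, so it
    lies in the domain by [gen_iff]. If c < 0, then - H is largest at infinity, where Q(- H) tends
    to - al c > 0, against [gen_max]. *)
Lemma rr_min al F : 0 < al -> F @ \oo --> (0 : R) -> Qseq F @ \oo --> (0 : R) ->
  (forall k, 0 <= F k) -> 0 <= rsum (fun j => rr p al j * (al * F j - Qseq F j)).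
Proof.
move=> al0 F0 Q0 Fp; set c := rsum _; rewrite leNgt; apply/negP => c0.
have cu : cvgn (uu a b al) by apply/cvg_ex; exists 1; exact: uu_cvg.
pose H k := F k + c * uu a b al k.
have Hc : H @ \oo --> c.
  by rewrite -[X in _ --> X](mulr1 c) -[X in _ --> X]add0r; apply: cvgD => //; apply: cvgZr; exact: uu_cvg.
have QH k : Qseq H k = Qseq F k + al * (c * uu a b al k).
  by rewrite /H QseqD QseqZ uu_eq //; ring.
have QHc : Qseq H @ \oo --> al * c.
  rewrite (funext QH) -[X in _ --> X]add0r; apply: cvgD => //; apply: cvgZr.
  by rewrite -[X in _ --> X](mulr1 c); apply: cvgZr; exact: uu_cvg.
have cH : cvgn H by apply/cvg_ex; exists c.
have cQH : cvgn (Qseq H) by apply/cvg_ex; exists (al * c).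
have g : gen H (Qseq H).
  apply/(gen_iff al0 cH cQH); split=> //; rewrite (cvg_lim _ Hc) //.
  congr rsum; apply/funext => j; rewrite QH /H; ring.
have [M M0 HM] := cvgn_bounded cH.
have l1 : limn (fun k => - H k) = - c by apply/cvg_lim => //; exact: cvgN.
have l2 : limn (fun k => - Qseq H k) = - (al * c) by apply/cvg_lim => //; exact: cvgN.
have cH' : cvgn (fun k => - H k) by exact: is_cvgN.
have cQH' : cvgn (fun k => - Qseq H k) by exact: is_cvgN.
have := gen_max cH' cQH' (gen_opp HM g); rewrite l1 l2.
move=> /(_ _)/wrap[k|].
  rewrite /H opprD -mulNr ler_wnDl ?oppr_le0 // ler_piMr ?uu_le1 //.
  by rewrite oppr_ge0 ltW.
move=> /(_ _)/wrap[|]; first by rewrite oppr_ge0 ltW.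
by rewrite leNgt oppr_gt0 pmulr_rlt0 // c0.
Qed.

End Feller_generator.

(** * The resolvent of a triple *)

Section triple.
Context {R : realType} (a b : nat -> R).
Hypotheses (hab : rates a b) (hs : (sigma a b < +oo)%E).
Implicit Types (F G H : nat -> R) (al c l M N e : R).
Local Notation Qseq := (Qseq a b).
Local Notation mu := (mu a b).
Local Notation tl := (tl a b).
Local Notation uu := (uu a b).
Local Notation Phi := (Phi a b).
Local Notation PhiO := (PhiO a b).

(* [n] are the masses nu_k; given [hs], [0 < be -> asum mu] says that infinity is
   regular when beta > 0. *)
Definition adm (n : nat -> R) (g be : R) : Prop :=
  [/\ forall k, 0 <= n k, 0 <= g /\ 0 <= be, asum (fun k => n k * tl k),
      0 < be -> asum mu & ~ asum n \/ 0 < be].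

Variables (n : nat -> R) (g be : R).

Definition numer al j : R := rsum (fun k => n k * Phi al k j) + be * (mu j * uu al j).
(** The factor be stays inside the series: when infinity is an exit the series of mu u diverges, and
    the term is then the sum of zeros. *)
Definition denom al : R :=
  g + rsum (fun k => n k * (1 - uu al k)) + al * rsum (fun k => be * (mu k * uu al k)).
(* The boundary condition, with beta F^+(oo) / 2 written as a series by
   [Qseq_sum_mu]. *)
Definition BC F : R :=
  be * rsum (fun i => mu i * Qseq F i) + rsum (fun k => (limn F - F k) * n k) + g * limn F.
Definition ell al G : R := rsum (fun j => numer al j * G j) / denom al.
Definition RT al G i : R := PhiO al G i + ell al G * uu al i.

Hypothesis hadm : adm n g be.

Lemma n_ge0 k : 0 <= n k. Proof. by case: hadm. Qed.
Lemma g_ge0 : 0 <= g. Proof. by case: hadm => _ []. Qed.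
Lemma be_ge0 : 0 <= be. Proof. by case: hadm => _ []. Qed.

Section fixed_al.
Variable al : R.
Hypothesis al0 : 0 < al.

Lemma u1_ge0 k : 0 <= 1 - uu al k.
Proof. by rewrite subr_ge0 uu_le1. Qed.

Lemma u1_gt0 k : 0 < 1 - uu al k.
Proof.
apply: lt_le_trans (uu_tl_ge hab hs al0 k).
have h1 := uu_gt0 hab hs al0 0; have h2 := tl_gt0 hab hs k.
by rewrite mulr_gt0 // mulr_gt0 // mulr_gt0.
Qed.

Lemma asum_nu : asum (fun k => n k * (1 - uu al k)).
Proof.
case: hadm => _ _ cn _ _; apply: (asum_dom (asumZ (c := 2 * al) cn)) => k.
rewrite mulrCA normrM [leRHS]normrM ler_wpM2l //.
rewrite ger0_norm ?u1_ge0 // (le_trans (uu_tl_le hab hs al0 k)) // ler_norm //.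
Qed.

Lemma Phi_le1u k j : al * Phi al k j <= 1 - uu al k.
Proof.
have [c H] := Phi_asum hab hs al0 k; apply: le_trans H.
by rewrite ler_pM2l // (rsum_term j c (Phi_ge0 hab hs al0 k)).
Qed.

Lemma asum_nPhi j : asum (fun k => n k * Phi al k j).
Proof.
apply: (asum_dom (asumZ (c := al^-1) asum_nu)) => k.
have P0 := Phi_ge0 hab hs al0 k j.
rewrite [in leRHS]mulrCA normrM [leRHS]normrM ler_wpM2l // (ger0_norm P0).
by apply: le_trans (ler_norm _); rewrite mulrC ler_pdivlMr // mulrC Phi_le1u.
Qed.

Lemma asum_bmuu : asum (fun k => be * (mu k * uu al k)).
Proof.
have [b0|b0] := eqVneq be 0.
  by have [|+ _] := @rsum_fin _ (fun k => be * (mu k * uu al k)) 0; first by rewrite b0 => k _; rewrite mul0r.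
have bp : 0 < be by rewrite lt_def b0 be_ge0.
by case: hadm => _ _ _ /(_ bp) cm _; apply: asumZ; apply: (asum_mulr (M := 1)) => // k; exact: uu_norm.
Qed.

Lemma bmuu_ge0 k : 0 <= be * (mu k * uu al k).
Proof.
apply: mulr_ge0; first exact: be_ge0.
by apply: mulr_ge0; apply: ltW; [exact: mu_gt0|exact: uu_gt0].
Qed.

Lemma numer_ge0 j : 0 <= numer al j.
Proof.
apply: addr_ge0 (bmuu_ge0 j); apply: rsum_ge0; first exact: asum_nPhi.
by move=> k; apply: mulr_ge0; [exact: n_ge0|exact: Phi_ge0].
Qed.

Lemma asum_nPhiO G M : (forall k, `|G k| <= M) -> asum (fun k => n k * PhiO al G k).
Proof.
move=> GM; apply: (asum_dom (asumZ (c := M / al) asum_nu)) => k.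
rewrite mulrCA normrM [leRHS]normrM ler_wpM2l //.
by apply: (le_trans (PhiO_bound hab hs al0 k GM)); rewrite mulrAC ler_norm.
Qed.

Lemma numer_fubini G M : (forall k, `|G k| <= M) ->
  series (fun j => numer al j * G j) @ \oo -->
   rsum (fun k => n k * PhiO al G k) + rsum (fun j => be * (mu j * uu al j) * G j).
Proof.
move=> GM; have M0 : 0 <= M by exact: le_trans (GM 0%N).
have cF k : asum (fun j => n k * (Phi al k j * G j)) by apply: asumZ; exact: PhiO_asum GM.
have cg : asum (fun k => M / al * (n k * (1 - uu al k))) by apply: asumZ; exact: asum_nu.
have [|_ L _] := rsum_fubini cg cF.
  move=> k; under [X in rsum X]eq_fun do rewrite normrM.
  have cP : asum (fun j => `|Phi al k j * G j|) by apply: asum_norm; exact: PhiO_asum GM.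
  rewrite rsumZ // (ger0_norm (n_ge0 k)) mulrCA ler_wpM2l ?n_ge0 //.
  have [c H] := Phi_asum hab hs al0 k.
  apply: (@le_trans _ _ (rsum (fun j => M * Phi al k j))).
    apply: ler_rsum => //; first exact: asumZ.
    by move=> j; rewrite normrM mulrC (ger0_norm (Phi_ge0 hab hs al0 _ _)) ler_wpM2r ?Phi_ge0.
  by rewrite rsumZ // -mulrA ler_wpM2l // mulrC ler_pdivlMr // mulrC.
have cb : asum (fun j => be * (mu j * uu al j) * G j) by apply: asum_mulr GM; exact: asum_bmuu.
have -> : series (fun j => numer al j * G j) =
  series (fun j => rsum (fun k => n k * (Phi al k j * G j))) + series (fun j => be * (mu j * uu al j) * G j).
  rewrite -seriesD; congr series; apply/funext => j; rewrite /numer mulrDl; congr (_ + _).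
  rewrite mulrC -rsumZ; last exact: asum_nPhi.
  by congr rsum; apply/funext => k; ring.
apply: cvgD; last exact: rsum_cvg.
have -> : (fun k => n k * PhiO al G k) = fun k => rsum (fun j => n k * (Phi al k j * G j)).
  by apply/funext => k; rewrite rsumZ //; exact: PhiO_asum GM.
exact: L.
Qed.

Lemma numer_rsum G M : (forall k, `|G k| <= M) -> rsum (fun j => numer al j * G j) =
   rsum (fun k => n k * PhiO al G k) + rsum (fun j => be * (mu j * uu al j) * G j).
Proof. by move=> GM; apply/rsum_eq; exact: numer_fubini GM. Qed.

(** [numer_fubini] for G = 1, using al Phi 1 = 1 - u. The gap g between the two totals is the
    killing at infinity. *)
Lemma numer_asum : asum (numer al) /\ al * rsum (numer al) = denom al - g.
Proof.
have one (k : nat) : `|1 : R| <= 1 by rewrite normr1.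
have L := numer_fubini one.
have E1 : (fun j => numer al j * 1) = numer al by apply/funext => j; rewrite mulr1.
have E2 : (fun k => n k * PhiO al (fun=> 1) k) = fun k => al^-1 * (n k * (1 - uu al k)).
  by apply/funext => k; have := PhiO_cst hab hs al0 1 k; rewrite mul1r => <-; field; exact: lt0r_neq0.
rewrite E1 E2 (rsumZ _ asum_nu) in L; split.
  rewrite /asum; under [X in series X]eq_fun do rewrite (ger0_norm (numer_ge0 _)).
  by apply/cvg_ex; eexists; exact: L.
rewrite (rsum_eq L); under [X in _ + rsum X]eq_fun do rewrite mulr1.
by rewrite /denom; field; exact: lt0r_neq0.
Qed.

Lemma numer_mul_asum G M : (forall k, `|G k| <= M) -> asum (fun j => numer al j * G j).
Proof. by move=> GM; apply: asum_mulr GM; have [] := numer_asum. Qed.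

Lemma denom_gt0 : 0 < denom al.
Proof.
have n0 k : 0 <= n k * (1 - uu al k) by rewrite mulr_ge0 ?n_ge0 ?u1_ge0.
have A1 : 0 <= rsum (fun k => n k * (1 - uu al k)) by apply: rsum_ge0 => //; exact: asum_nu.
have A2 : 0 <= al * rsum (fun k => be * (mu k * uu al k)).
  rewrite mulr_ge0 ?(ltW al0) //; apply: rsum_ge0; first exact: asum_bmuu.
  exact: bmuu_ge0.
have g0 := g_ge0.
case: hadm => _ _ _ _ [cn|be0].
  have [k nk] : exists k, 0 < n k.
    apply: contrapT => H; apply: cn.
    have [|//] := @rsum_fin _ n 0; move=> k _; apply/eqP; rewrite eq_le n_ge0 andbT leNgt.
    by apply/negP => nk; apply: H; exists k.
  have : 0 < rsum (fun k => n k * (1 - uu al k)).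
    apply: lt_le_trans (rsum_term k asum_nu n0).
    by rewrite mulr_gt0 ?u1_gt0.
  by rewrite /denom; lra.
have : 0 < al * rsum (fun k => be * (mu k * uu al k)).
  rewrite mulr_gt0 //; apply: lt_le_trans (rsum_term 0 asum_bmuu bmuu_ge0).
  by apply: mulr_gt0 => //; apply: mulr_gt0; [exact: mu_gt0|exact: uu_gt0].
by rewrite /denom; lra.
Qed.

Lemma numer_le_den : al * rsum (numer al) <= denom al.
Proof. by have [_ ->] := numer_asum; have := g_ge0; lra. Qed.

Lemma BC_sum F G M : cvgn F -> (forall k, `|G k| <= M) ->
  (forall k, al * F k - Qseq F k = G k) -> asum (fun k => (limn F - F k) * n k) /\
  rsum (fun k => (limn F - F k) * n k) =
    limn F * rsum (fun k => n k * (1 - uu al k)) - rsum (fun k => n k * PhiO al G k).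
Proof.
move=> cF GM FG; set c : R := limn F.
have FE k : F k = PhiO al G k + c * uu al k := PhiO_unique hab hs al0 cF GM FG k.
have -> : (fun k => (c - F k) * n k) =
    (fun k => c * (n k * (1 - uu al k)) - n k * PhiO al G k).
  by apply/funext => k; rewrite FE; ring.
have c1 := asumZ (c := c) asum_nu; have c2 := asum_nPhiO GM.
by split; [exact: asumB|rewrite rsumB ?(rsumZ c asum_nu)].
Qed.

(* Symmetry of [mu_i Phi_ij] moves the sum of [mu * al PhiO G] onto [1 - u]. *)
Lemma BC_mu F G M : asum mu -> cvgn F -> (forall k, `|G k| <= M) ->
  (forall k, al * F k - Qseq F k = G k) -> asum (fun i => mu i * Qseq F i) /\
  rsum (fun i => mu i * Qseq F i) =
    al * limn F * rsum (fun k => mu k * uu al k) - rsum (fun j => mu j * uu al j * G j).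
Proof.
move=> cm cF GM FG; set c : R := limn F; have M0 : 0 <= M by exact: le_trans (GM 0%N).
have FE k : F k = PhiO al G k + c * uu al k := PhiO_unique hab hs al0 cF GM FG k.
have cu : asum (fun k => mu k * uu al k) by apply: (asum_mulr (M := 1)) => // k; exact: uu_norm.
have PM k : `|PhiO al G k| <= M / al.
  apply: (le_trans (PhiO_bound hab hs al0 k GM)); rewrite ler_pM2r ?invr_gt0 // ler_piMr //.
  by have := uu_gt0 hab hs al0 k; lra.
have cP : asum (fun i => mu i * PhiO al G i) by exact: asum_mulr PM.
have cG : asum (fun i => mu i * G i) by exact: asum_mulr GM.
have cuG : asum (fun i => mu i * uu al i * G i) by exact: asum_mulr GM.
have E : (fun i => mu i * Qseq F i) =
    fun i => (al * (mu i * PhiO al G i) + al * c * (mu i * uu al i)) - mu i * G i.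
  by apply/funext => i; have := FG i; have := FE i => -> Hi; rewrite -Hi; ring.
have c1 : asum (fun i => al * (mu i * PhiO al G i)) by exact: asumZ.
have c2 : asum (fun i => al * c * (mu i * uu al i)) by exact: asumZ.
rewrite E; split; first by apply: asumB => //; exact: asumD.
rewrite rsumB ?rsumD ?(rsumZ _ cP) ?(rsumZ _ cu) //; last exact: asumD.
suff -> : al * rsum (fun i => mu i * PhiO al G i) =
    rsum (fun i => mu i * G i) - rsum (fun j => mu j * uu al j * G j) by ring.
have cF' i : asum (fun j => mu i * (Phi al i j * G j)) by apply: asumZ; exact: PhiO_asum GM.
have cg : asum (fun i => M / al * mu i) by exact: asumZ.
have -> : (fun i => mu i * PhiO al G i) = fun i => rsum (fun j => mu i * (Phi al i j * G j)).
  by apply/funext => i; rewrite rsumZ //; exact: PhiO_asum GM.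
have [|_ _ <-] := rsum_fubini cg cF'; last first.
  have -> : (fun j => rsum (fun i => mu i * (Phi al i j * G j))) =
     (fun j => al^-1 * (mu j * G j - mu j * uu al j * G j)).
    apply/funext => j.
    transitivity (rsum (fun i => (mu j * G j) * Phi al j i)).
      congr rsum; apply/funext => i; rewrite mulrA (Phi_sym _ _ al); ring.
    have [c3 _] := Phi_asum hab hs al0 j.
    by rewrite rsumZ // -[rsum _](mulKf (lt0r_neq0 al0)) (Phi_rsum hab hs al0); ring.
  by rewrite rsumZ ?rsumB ?mulVKf // ?lt0r_neq0 //; exact: asumB.
move=> i; under [X in rsum X]eq_fun do rewrite normrM.
have cA : asum (fun j => `|Phi al i j * G j|) by apply: asum_norm; exact: PhiO_asum GM.
rewrite rsumZ // (gtr0_norm (mu_gt0 hab i)) mulrC ler_pM2r ?mu_gt0 //.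
have [c3 H] := Phi_asum hab hs al0 i.
apply: (@le_trans _ _ (rsum (fun j => M * Phi al i j))).
  apply: ler_rsum => //; first exact: asumZ.
  by move=> j; rewrite normrM mulrC (ger0_norm (Phi_ge0 hab hs al0 _ _)) ler_wpM2r ?Phi_ge0.
rewrite rsumZ // ler_wpM2l // -[leRHS]mul1r ler_pdivlMr // mulrC (le_trans H) //.
by have := uu_gt0 hab hs al0 i; lra.
Qed.

(** Solving BC F = 0 for the limit of F gives [ell], so this identity yields both that the range of
    [RT] satisfies the boundary condition and that every such F is in that range. *)
Lemma BC_eq F G M : cvgn F -> (forall k, `|G k| <= M) ->
  (forall k, al * F k - Qseq F k = G k) ->
  BC F = limn F * denom al - rsum (fun j => numer al j * G j).
Proof.
move=> cF GM FG; have [c1 E1] := BC_sum cF GM FG.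
rewrite /BC E1 (numer_rsum GM) /denom.
suff -> : be * rsum (fun i => mu i * Qseq F i) =
   limn F * (al * rsum (fun k => be * (mu k * uu al k))) - rsum (fun j => be * (mu j * uu al j) * G j).
  by ring.
have [b0|b0] := eqVneq be 0.
  have [|_ E2] := @rsum_fin _ (fun k => be * (mu k * uu al k)) 0.
    by rewrite b0 => k _; rewrite mul0r.
  have [|_ E3] := @rsum_fin _ (fun k => be * (mu k * uu al k) * G k) 0.
    by rewrite b0 => k _; rewrite !mul0r.
  by rewrite E2 E3 !big_geq // b0; ring.
have bp : 0 < be by rewrite lt_def b0 be_ge0.
have cm : asum mu by case: hadm => _ _ _ /(_ bp).
have [_ ->] := BC_mu cm cF GM FG.
have cu : asum (fun k => mu k * uu al k) by apply: (asum_mulr (M := 1)) => // k; exact: uu_norm.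
have cuG : asum (fun i => mu i * uu al i * G i) by exact: asum_mulr GM.
rewrite (rsumZ be cu).
have -> : (fun j => be * (mu j * uu al j) * G j) = fun j => be * (mu j * uu al j * G j).
  by apply/funext => j; ring.
by rewrite (rsumZ be cuG); ring.
Qed.

Lemma ell_bound G M : (forall k, `|G k| <= M) -> `|ell al G| <= M / al.
Proof.
move=> GM; have M0 : 0 <= M by exact: le_trans (GM 0%N).
have [cn En] := numer_asum; have d0 := denom_gt0.
rewrite /ell normrM normfV (gtr0_norm d0) ler_pdivrMr //.
apply: (@le_trans _ _ (rsum (fun j => M * numer al j))).
  apply: rsum_norm => [|k]; first exact: asumZ.
  by rewrite normrM mulrC (ger0_norm (numer_ge0 _)) ler_wpM2r ?numer_ge0.
rewrite rsumZ // -mulrA ler_wpM2l // mulrC ler_pdivlMr // mulrC; exact: numer_le_den.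
Qed.

Lemma ell_ge0 G M : (forall k, `|G k| <= M) -> (forall k, 0 <= G k) -> 0 <= ell al G.
Proof.
move=> GM G0; apply: divr_ge0; last exact: ltW denom_gt0.
apply: rsum_ge0; first exact: numer_mul_asum GM.
by move=> k; apply: mulr_ge0 => //; exact: numer_ge0.
Qed.

Lemma RT_bound G M i : (forall k, `|G k| <= M) -> `|RT al G i| <= M / al.
Proof.
move=> GM; have H1 := PhiO_bound hab hs al0 i GM; have H2 := ell_bound GM.
rewrite /RT (le_trans (ler_normD _ _)) // normrM (gtr0_norm (uu_gt0 hab hs al0 i)).
have : `|ell al G| * uu al i <= M / al * uu al i by rewrite ler_pM2r ?uu_gt0.
have E : M * (1 - uu al i) / al = M / al - M / al * uu al i by ring.
by rewrite E in H1; lra.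
Qed.

Lemma RT_cvg G M : (forall k, `|G k| <= M) -> RT al G @ \oo --> ell al G.
Proof.
move=> GM; rewrite -[X in _ --> X]mulr1 -[X in _ --> X]add0r; apply: cvgD.
  exact: PhiO_cvg0 GM.
by apply: cvgZr; exact: uu_cvg.
Qed.

Lemma RT_Qseq G M i : (forall k, `|G k| <= M) -> Qseq (RT al G) i = al * RT al G i - G i.
Proof. by move=> GM; rewrite /RT QseqD QseqZ uu_eq // (PhiO_eq hab hs al0 i GM); ring. Qed.

Lemma RT_ge0 G M i : (forall k, `|G k| <= M) -> (forall k, 0 <= G k) -> 0 <= RT al G i.
Proof.
move=> GM G0; rewrite addr_ge0 //; last by rewrite mulr_ge0 ?(ell_ge0 GM) // ltW // uu_gt0.
by apply: rsum_ge0 => [|k]; [exact: PhiO_asum GM|rewrite mulr_ge0 ?Phi_ge0].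
Qed.

Lemma RTB G H M N i : (forall k, `|G k| <= M) -> (forall k, `|H k| <= N) ->
  RT al (fun k => G k - H k) i = RT al G i - RT al H i.
Proof.
move=> GM HN; rewrite /RT (PhiOB hab hs al0 i GM HN) /ell.
have -> : (fun j => numer al j * (G j - H j)) = fun j => numer al j * G j - numer al j * H j.
  by apply/funext => j; rewrite mulrBr.
by rewrite rsumB; [ring|exact: numer_mul_asum GM|exact: numer_mul_asum HN].
Qed.

Lemma RTZ G M c i : (forall k, `|G k| <= M) -> RT al (fun k => c * G k) i = c * RT al G i.
Proof.
move=> GM; rewrite /RT (PhiOZ hab hs al0 c i GM) /ell.
have -> : (fun j => numer al j * (c * G j)) = fun j => c * (numer al j * G j).
  by apply/funext => j; ring.
by rewrite rsumZ; [ring|exact: numer_mul_asum GM].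
Qed.

Lemma RT_dlt i j : RT al (dlt j) i = Phi al i j + uu al i * (numer al j / denom al).
Proof.
rewrite /RT PhiO_dlt /ell mulrC; congr (_ + _ * (_ / _)).
have [|_] := @rsum_single _ (fun k => numer al k * dlt j k) j.
  by move=> k kj; rewrite /dlt (negbTE kj) mulr0.
by rewrite /dlt eqxx mulr1.
Qed.

Lemma RT_rsum G M i : (forall k, `|G k| <= M) ->
  asum (fun j => RT al (dlt j) i * G j) /\ RT al G i = rsum (fun j => RT al (dlt j) i * G j).
Proof.
move=> GM; have -> : (fun j => RT al (dlt j) i * G j) =
    fun j => Phi al i j * G j + uu al i / denom al * (numer al j * G j).
  by apply/funext => j; rewrite RT_dlt; ring.
have c1 := PhiO_asum hab hs al0 (i := i) GM.
have c2 := asumZ (c := uu al i / denom al) (numer_mul_asum GM).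
split; first exact: asumD.
rewrite rsumD // (rsumZ _ (numer_mul_asum GM)) /RT /ell /PhiO; ring.
Qed.

Lemma RT_BC G M : (forall k, `|G k| <= M) -> BC (RT al G) = 0.
Proof.
move=> GM; have L := RT_cvg GM; have d0 := denom_gt0.
have cR : cvgn (RT al G) by apply/cvg_ex; eexists; exact: L.
rewrite (BC_eq cR GM); last by move=> k; rewrite (RT_Qseq k GM); ring.
by rewrite (cvg_lim _ L) // /ell; field; exact: lt0r_neq0.
Qed.

Lemma BC_RT F G M : cvgn F -> (forall k, `|G k| <= M) ->
  (forall k, al * F k - Qseq F k = G k) -> BC F = 0 -> forall k, F k = RT al G k.
Proof.
move=> cF GM FG B0 k; rewrite (PhiO_unique hab hs al0 cF GM FG k) /RT.
have d0 := lt0r_neq0 denom_gt0; congr (_ + _ * _).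
move: B0; rewrite (BC_eq cF GM FG) => /eqP; rewrite subr_eq0 => /eqP H.
by rewrite /ell -H mulfK.
Qed.

(** Subtracting c u leaves (al - Q) F unchanged and lowers the limit by c. In other words BC u =
    [denom al], so a multiple of u can correct any boundary value. *)
Lemma BC_subuu F c : cvgn F -> cvgn (Qseq F) ->
  BC (fun k => F k - c * uu al k) = BC F - c * denom al.
Proof.
move=> cF cQ; have [N N0 FN] := cvgn_bounded cF; have [N1 _ QN] := cvgn_bounded cQ.
have H1 k : `|al * F k - Qseq F k| <= al * N + N1.
  by rewrite (le_trans (ler_normB _ _)) // lerD // normrM gtr0_norm // ler_pM2l.
have cF' : (fun k => F k - c * uu al k) @ \oo --> limn F - c.
  apply: cvgB => //; rewrite -[X in _ --> X]mulr1.
  by apply: cvgZr; exact: uu_cvg.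
rewrite (BC_eq cF H1) // (BC_eq (G := fun k => al * F k - Qseq F k) _ H1).
- by rewrite (cvg_lim _ cF') // mulrBl addrAC.
- by apply/cvg_ex; eexists; exact: cF'.
- by move=> k; rewrite QseqB QseqZ uu_eq //; ring.
Qed.

End fixed_al.

(** Each alternative of condition (c) suffices: if |nu| is infinite, 1 - u_k >= 1/2 on a finite set
    of large mass; if beta > 0, the term al beta sum mu u is large because u has to climb from at
    most 1/2 to 1 along a short tail. *)
Lemma denom_unbounded K : exists2 A, 0 < A & forall al, A <= al -> K <= denom al.
Proof.
have g0 := g_ge0.
wlog K0 : K / 0 < K.
  move=> W; have [|A A0 HA] := W (`|K| + 1); first by rewrite ltr_wpDl.
  exists A => // al /HA; apply: le_trans; apply: le_trans (ler_norm K) _.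
  by rewrite lerDl.
case: (hadm) => _ _ _ cm [cn|be0].
  have [m Hm] : exists m, 2 * K < \sum_(0 <= k < m) n k.
    apply: contrapT => H; apply: cn; have [|//] := @asum_bound _ n (2 * K) n_ge0.
    by move=> m; rewrite leNgt; apply/negP => Hm; apply: H; exists m.
  have S0 : 0 <= \sum_(0 <= k < m) 2 * b k.
    by apply: sumr_ge0 => k _; rewrite mulr_ge0 // ltW // (b_gt0 hab).
  (* Beyond this value al >= 2 b_k for all k < m at once, so u_k <= 1/2 by [uu_b]. *)
  exists (\sum_(0 <= k < m) 2 * b k + 1) => [|al Aal]; first by rewrite ltr_wpDl.
  have al0 : 0 < al by lra.
  have half k : (k < m)%N -> uu al k <= 2^-1.
    move=> km; apply: (le_trans (uu_b hab hs al0 k)).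
    rewrite ler_pdivrMr //; suff : 2 * b k <= al by lra.
    apply: le_trans Aal; rewrite (bigD1_seq k) //= ?iota_uniq ?mem_index_iota //.
    rewrite -addrA lerDl addr_ge0 // sumr_ge0 // => i _.
    by rewrite mulr_ge0 // ltW // (b_gt0 hab).
  have A2 : 0 <= al * rsum (fun k => be * (mu k * uu al k)).
    rewrite mulr_ge0 ?(ltW al0) // rsum_ge0 //; first exact: asum_bmuu.
    by move=> k; exact: bmuu_ge0.
  have n0 k : 0 <= n k * (1 - uu al k) by rewrite mulr_ge0 ?n_ge0 ?u1_ge0.
  have A3 := rsum_part m (asum_nu al0) n0.
  have A4 : 2^-1 * \sum_(0 <= k < m) n k <= \sum_(0 <= k < m) n k * (1 - uu al k).
    rewrite mulr_sumr big_nat_cond [leRHS]big_nat_cond; apply: ler_sum => k /andP[/andP[_ km] _].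
    by rewrite mulrC ler_wpM2l ?n_ge0 //; have := half k km; lra.
  rewrite /denom; lra.
have {}cm := cm be0.
(* The state k is chosen with tail at most be / (4 K). Then 1/2 <= 1 - u_k <= 2 al S be / (4 K),
   which is K <= al be S. *)
have Kb : 0 < be / (4 * K) by rewrite divr_gt0 // mulr_gt0.
have /cvgn_epsP/(_ _ Kb)[k Hk] := tl_cvg0 hab hs.
have := Hk k (leqnn k); rewrite subr0 ger0_norm ?tl_ge0 // => tk.
have b0 := b_gt0 hab k.
exists (2 * b k) => [|al Aal]; first lra.
have al0 : 0 < al by lra.
have half : uu al k <= 2^-1.
  by apply: (le_trans (uu_b hab hs al0 k)); rewrite ler_pdivrMr //; lra.
have cu : asum (fun k => mu k * uu al k) by apply: (asum_mulr (M := 1)) => // j; exact: uu_norm.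
have mu0 j : 0 <= mu j * uu al j by rewrite mulr_ge0 // ltW ?mu_gt0 ?uu_gt0.
set S := rsum (fun k => mu k * uu al k).
have S0 : 0 <= S by exact: rsum_ge0.
have H1 : 1 - uu al k <= 2 * al * S * tl k.
  apply: (incr_le hab hs k (uu_cvg hab hs al0)) => j; rewrite (Qseq_incr hab).
  apply: (@le_trans _ _ ((bmu a b j)^-1 * (al * S))).
    rewrite ler_wpM2l ?invr_ge0 ?(ltW (bmu_gt0 hab _)) //.
    under eq_bigr do rewrite uu_eq // mulrCA.
    by rewrite -mulr_sumr ler_pM2l // rsum_part.
  have -> : 2 * al * S * st a b j = 2 * st a b j * (al * S) by ring.
  by rewrite ler_wpM2r ?bmu_st // mulr_ge0 // ltW.
have H2 : 2^-1 <= 2 * al * S * (be / (4 * K)).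
  apply: (@le_trans _ _ (1 - uu al k)); first by lra.
  by apply: (le_trans H1); rewrite ler_wpM2l // !mulr_ge0 // ltW.
have H3 : K <= al * (be * S).
  rewrite -(ler_pM2r (_ : 0 < (2 * K)^-1)) ?invr_gt0 ?mulr_gt0 //.
  have -> : K / (2 * K) = 2^-1 by field; exact: lt0r_neq0.
  by have -> : al * (be * S) / (2 * K) = 2 * al * S * (be / (4 * K)) by field; exact: lt0r_neq0.
have A1 : 0 <= rsum (fun k => n k * (1 - uu al k)).
  by apply: rsum_ge0 => [|j]; [exact: asum_nu|rewrite mulr_ge0 ?n_ge0 ?u1_ge0].
by rewrite /denom (rsumZ be cu) -/S; lra.
Qed.

(** The beta term disappears: by [Qseq_sum_mu] the partial sums of mu Q(dlt k) are right derivatives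
    of [dlt k], which vanish beyond k. With [BC_cst], it lets the functional recover nu and
    gamma. *)
Lemma BC_dlt k : BC (dlt k) = - n k.
Proof.
have Q0 : forall i, (k.+1 < i)%N -> Qseq (dlt k) i = 0.
  move=> i ki; rewrite Qseq_dlt.
  have [-> -> ->] : [/\ (i == k.+1) = false, (i == k) = false & (i.+1 == k) = false].
    by split; lia.
  by rewrite !mulr0 subrr addr0.
have l0 : limn (dlt k) = 0 :> R by apply/cvg_lim => //; exact: dlt_cvg0.
rewrite /BC l0 mulr0 addr0.
have [|_ ->] := @rsum_single _ (fun i => (0 - dlt k i) * n i) k.
  by move=> i ik; rewrite /dlt (negbTE ik) subrr mul0r.
rewrite {2}/dlt eqxx sub0r mulN1r.
have [|_ ->] := @rsum_fin _ (fun i => mu i * Qseq (dlt k) i) k.+2.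
  by move=> i ki; rewrite Q0 // mulr0.
rewrite -(Qseq_sum_mu hab) /dlt !gtn_eqF // subrr mulr0 mulr0 add0r //.
Qed.

Lemma BC_cst : BC (fun=> 1) = g.
Proof.
have l1 : limn (fun _ : nat => 1 : R) = 1 by apply/cvg_lim => //; exact: cvg_cst.
rewrite /BC l1 mulr1.
have [|_ ->] := @rsum_fin _ (fun k => (1 - 1) * n k) 0; first by move=> k _; rewrite subrr mul0r.
have [|_ ->] := @rsum_fin _ (fun i => mu i * Qseq (fun=> 1) i) 0.
  by move=> k _; rewrite Qseq_cst // mulr0.
by rewrite !big_geq // mulr0 !add0r.
Qed.

End triple.

(** * The semigroup of a triple *)

Section semigroup_construction.
Context {R : realType} (a b : nat -> R).
Hypotheses (hab : rates a b) (hs : (sigma a b < +oo)%E).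
Variables (n : nat -> R) (g be : R).
Hypothesis hadm : adm a b n g be.
Implicit Types (F G : nat -> R) (al c l M N C e h s t : R).
Local Notation Qseq := (Qseq a b).
Local Notation RT := (RT a b n g be).
Local Notation BC := (BC a b n g be).
Local Notation uu := (uu a b).

Definition dom F : Prop := [/\ cvgn F, cvgn (Qseq F) & BC F = 0].
(* Backward Euler step: [euler h] is (1 - h L)^-1 for the generator L. *)
Definition euler h F i : R := h^-1 * RT h^-1 F i.

Section fixed_h.
Variable h : R.
Hypothesis h0 : 0 < h.
Let al0 : 0 < h^-1. Proof. by rewrite invr_gt0. Qed.

Lemma euler_bound F M i : (forall k, `|F k| <= M) -> `|euler h F i| <= M.
Proof.
move=> FM; rewrite /euler normrM gtr0_norm // mulrC -ler_pdivlMr //.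
exact: (RT_bound hab hs hadm al0 i FM).
Qed.

Lemma euler_Qseq F M i : (forall k, `|F k| <= M) -> Qseq (euler h F) i = h^-1 * (euler h F i - F i).
Proof.
by move=> FM; rewrite /euler QseqZ (RT_Qseq hab hs n g be al0 i FM); ring.
Qed.

Lemma eulerB F G M N i : (forall k, `|F k| <= M) -> (forall k, `|G k| <= N) ->
  euler h (fun k => F k - G k) i = euler h F i - euler h G i.
Proof. by move=> FM GN; rewrite /euler (RTB hab hs hadm al0 i FM GN) mulrBr. Qed.

Lemma eulerZ F M c i : (forall k, `|F k| <= M) -> euler h (fun k => c * F k) i = c * euler h F i.
Proof. by move=> FM; rewrite /euler (RTZ hab hs hadm al0 c i FM); ring. Qed.

Lemma euler_ge0 F M i : (forall k, `|F k| <= M) -> (forall k, 0 <= F k) -> 0 <= euler h F i.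
Proof.
by move=> FM F0; rewrite /euler mulr_ge0 ?(ltW al0) // (RT_ge0 hab hs hadm al0 i FM F0).
Qed.

Lemma euler_cvgn F M : (forall k, `|F k| <= M) -> cvgn (euler h F).
Proof.
move=> FM; apply: is_cvgZr; apply/cvg_ex.
exists (ell a b n g be h^-1 F); exact: (RT_cvg hab hs al0 FM).
Qed.

Lemma euler_dom F : cvgn F -> dom (euler h F).
Proof.
move=> cF; have [M M0 FM] := cvgn_bounded cF; have cJ := euler_cvgn FM; split => //.
  have -> : Qseq (euler h F) = fun i => h^-1 * (euler h F i - F i).
    by apply/funext => i; rewrite (euler_Qseq i FM).
  by apply: is_cvgZr; exact: is_cvgB.
have -> : euler h F = RT h^-1 (fun k => h^-1 * F k).
  by apply/funext => i; rewrite (RTZ hab hs hadm al0 _ i FM).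
have FM' k : `|h^-1 * F k| <= h^-1 * M by rewrite normrM gtr0_norm // ler_pM2l.
exact: (RT_BC hab hs hadm al0 FM').
Qed.

Lemma dom_euler F : dom F -> forall i, euler h F i - F i = h * euler h (Qseq F) i.
Proof.
move=> [cF cQ B0] i; have [M M0 FM] := cvgn_bounded cF; have [N N0 QN] := cvgn_bounded cQ.
have FM' k : `|h^-1 * F k| <= h^-1 * M by rewrite normrM gtr0_norm // ler_pM2l.
have HM k : `|h^-1 * F k - Qseq F k| <= h^-1 * M + N by rewrite (le_trans (ler_normB _ _)) // lerD.
have := BC_RT hab hs hadm al0 cF HM (fun=> erefl) B0 i.
rewrite (RTB hab hs hadm al0 i FM' QN) (RTZ hab hs hadm al0 _ i FM) => E.
rewrite {1}/euler [X in _ - X]E /euler mulVKf ?lt0r_neq0 //; ring.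
Qed.

Lemma dom_euler_comm F : dom F -> Qseq (euler h F) = euler h (Qseq F).
Proof.
move=> dF; have [cF _ _] := dF; have [M M0 FM] := cvgn_bounded cF.
by apply/funext => i; rewrite (euler_Qseq i FM) (dom_euler dF) mulKf // lt0r_neq0.
Qed.

End fixed_h.

Lemma domB F G : dom F -> dom G -> dom (fun k => F k - G k).
Proof.
move=> dF dG; have [cF cQF BF] := dF; have [cG cQG BG] := dG.
have [M M0 FM] := cvgn_bounded cF; have [N N0 GN] := cvgn_bounded cG.
have [M1 _ QM] := cvgn_bounded cQF; have [N1 _ QN] := cvgn_bounded cQG.
have cFG : cvgn (fun k => F k - G k) by exact: is_cvgB.
(* Elements of the domain are values of [RT 1], so stability under differences follows from the
   linearity of [RT] instead of that of the series in [BC]. *)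
have E : (fun k => F k - G k) = RT 1 (fun k => (F k - Qseq F k) - (G k - Qseq G k)).
  have H1 k : `|F k - Qseq F k| <= M + M1 by rewrite (le_trans (ler_normB _ _)) // lerD.
  have H2 k : `|G k - Qseq G k| <= N + N1 by rewrite (le_trans (ler_normB _ _)) // lerD.
  apply/funext => i; rewrite (RTB hab hs hadm ltr01 i H1 H2).
  congr (_ - _); first by apply: (BC_RT hab hs hadm ltr01 cF H1) => // k; rewrite mul1r.
  by apply: (BC_RT hab hs hadm ltr01 cG H2) => // k; rewrite mul1r.
split => //.
  have -> : Qseq (fun k => F k - G k) = fun k => Qseq F k - Qseq G k.
    by apply/funext => k; rewrite QseqB.
  exact: is_cvgB.
have H k : `|(F k - Qseq F k) - (G k - Qseq G k)| <= (M + M1) + (N + N1).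
  by do 3 (rewrite ?(le_trans (ler_normB _ _)) // ?lerD //).
by rewrite E; exact: (RT_BC hab hs hadm ltr01 H).
Qed.

Lemma domZ c F : dom F -> dom (fun k => c * F k).
Proof.
move=> dF; have [cF cQF BF] := dF.
have [M M0 FM] := cvgn_bounded cF; have [M1 _ QM] := cvgn_bounded cQF.
have cc : cvgn (fun k => c * F k) by exact: is_cvgZr.
have H1 k : `|F k - Qseq F k| <= M + M1 by rewrite (le_trans (ler_normB _ _)) // lerD.
have E : (fun k => c * F k) = RT 1 (fun k => c * (F k - Qseq F k)).
  apply/funext => i; rewrite (RTZ hab hs hadm ltr01 _ i H1); congr (_ * _).
  by apply: (BC_RT hab hs hadm ltr01 cF H1) => // k; rewrite mul1r.
split => //.
  have -> : Qseq (fun k => c * F k) = fun k => c * Qseq F k.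
    by apply/funext => k; rewrite QseqZ.
  exact: is_cvgZr.
have H k : `|c * (F k - Qseq F k)| <= `|c| * (M + M1) by rewrite normrM ler_wpM2l.
by rewrite E; exact: (RT_BC hab hs hadm ltr01 H).
Qed.

Definition dom_closure F : Prop := forall e, 0 < e -> exists2 F', dom F' & forall k, `|F k - F' k| <= e.

Lemma dom_closureB F G : dom_closure F -> dom_closure G -> dom_closure (fun k => F k - G k).
Proof.
move=> dF dG e e0; have [F' F1 F2] := dF (e / 2) ltac:(lra).
have [G' G1 G2] := dG (e / 2) ltac:(lra).
exists (fun k => F' k - G' k); first exact: domB.
move=> k; have -> : F k - G k - (F' k - G' k) = (F k - F' k) - (G k - G' k) by ring.
by apply: (le_trans (ler_normB _ _)); have := F2 k; have := G2 k; lra.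
Qed.

Lemma dom_closure_unif F : (forall e, 0 < e -> exists2 F', dom_closure F' & forall k, `|F k - F' k| <= e) -> dom_closure F.
Proof.
move=> H e e0; have [F' F1 F2] := H (e / 2) ltac:(lra).
have [G G1 G2] := F1 (e / 2) ltac:(lra); exists G => // k.
have -> : F k - G k = (F k - F' k) + (F' k - G k) by ring.
by apply: (le_trans (ler_normD _ _)); have := F2 k; have := G2 k; lra.
Qed.

(* Since [denom al] is unbounded, a small multiple of [uu al] corrects F into the domain. *)
Lemma dom_closure_Qseq F : cvgn F -> cvgn (Qseq F) -> dom_closure F.
Proof.
move=> cF cQ e e0.
have [A A0 HA] := denom_unbounded hab hs hadm (`|BC F| / e).
have d0 := denom_gt0 hab hs hadm A0; have u0 := uu_norm hab hs A0.
pose c := BC F / denom a b n g be A.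
have cu : cvgn (uu A) by apply/cvg_ex; exists 1; exact: uu_cvg.
have QE k : Qseq (fun k => F k - c * uu A k) k = Qseq F k - c * (A * uu A k).
  by rewrite QseqB QseqZ uu_eq.
have cF' : cvgn (fun k => F k - c * uu A k) by apply: is_cvgB => //; exact: is_cvgZr.
have cQ' : cvgn (Qseq (fun k => F k - c * uu A k)).
  by rewrite (funext QE); apply: is_cvgB => //; apply: is_cvgZr; exact: is_cvgZr.
exists (fun k => F k - c * uu A k); last first.
  move=> k; rewrite opprB addrCA subrr addr0 normrM.
  apply: (@le_trans _ _ (`|c| * 1)); first by rewrite ler_wpM2l.
  rewrite mulr1 /c normrM normfV (gtr0_norm d0) ler_pdivrMr // mulrC -ler_pdivrMr //.
  exact: HA.
split => //; rewrite (BC_subuu hab hs hadm A0 c cF cQ) /c mulfVK ?subrr //.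
exact: lt0r_neq0.
Qed.

Lemma dom_dense F : cvgn F -> dom_closure F.
Proof.
move=> cF; have dc c : dom_closure (fun=> c).
  apply: (dom_closure_Qseq); first exact: is_cvg_cst.
  by rewrite (funext (Qseq_cst hab c)); exact: is_cvg_cst.
have dt m G : dom_closure (trunc m G).
  apply: (dom_closure_Qseq); apply/cvg_ex; exists 0; first exact: trunc_cvg0.
  apply/cvgn_epsP => e e0; exists m.+1 => k mk.
  by rewrite Qseq_trunc_0 // subr0 normr0 ltW.
set c : R := limn F; apply: dom_closure_unif => e e0.
have /cvgn_epsP/(_ e e0)[m Hm] := cF.
exists (fun k => trunc m (fun i => F i - c) k - (- c)); first exact: dom_closureB.
move=> k; rewrite opprK /trunc; case: ltnP => km.
  by rewrite subrK subrr normr0 ltW.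
by rewrite add0r; exact: Hm.
Qed.

(** The domain of L^2 with bounds on LF and L^2 F. Euler steps are contractions commuting with Q
    there, so the same C1 and C2 hold along all iterates and second order errors are uniform in the
    state. *)
Definition dom2 C1 C2 F : Prop := [/\ dom F, dom (Qseq F),
  forall k, `|Qseq F k| <= C1 & forall k, `|Qseq (Qseq F) k| <= C2].

Lemma dom2_euler h C1 C2 F : 0 < h -> dom2 C1 C2 F -> dom2 C1 C2 (euler h F).
Proof.
move=> h0 [dF dQ H1 H2]; have [cF cQF _] := dF; have [cQ cQQ _] := dQ.
have E1 := dom_euler_comm h0 dF; have E2 := dom_euler_comm h0 dQ.
split; rewrite ?E1 ?E2; [exact: euler_dom|exact: euler_dom| |] => k; exact: euler_bound.
Qed.

Lemma euler_near h F C i : 0 < h -> dom F -> (forall k, `|Qseq F k| <= C) ->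
  `|euler h F i - F i| <= h * C.
Proof.
move=> h0 dF QC; rewrite (dom_euler h0 dF) normrM gtr0_norm // ler_pM2l //.
exact: euler_bound.
Qed.

(** One Euler step maps the domain into the domain of L^2; the step h is chosen so that h C <= e /
    2, which bounds the displacement. *)
Lemma dom2_dense F e : cvgn F -> 0 < e -> exists C1 C2, exists2 F',
  dom2 C1 C2 F' & forall k, `|F k - F' k| <= e.
Proof.
move=> cF e0; have [F' dF' H1] := dom_dense cF (e := e / 2) ltac:(lra).
have [cF' cQ _] := dF'; have [C C0 QC] := cvgn_bounded cQ.
pose h := e / 2 / (C + 1); have h0 : 0 < h by rewrite divr_gt0; lra.
have dJ := euler_dom h0 cF'.
have E := dom_euler_comm h0 dF'.
have dQ : dom (Qseq (euler h F')) by rewrite E; exact: euler_dom.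
have [_ cQJ _] := dJ; have [_ cQQJ _] := dQ.
have [C1 _ HC1] := cvgn_bounded cQJ; have [C2 _ HC2] := cvgn_bounded cQQJ.
exists C1, C2, (euler h F'); first by split.
move=> k; have := euler_near k h0 dF' QC; have := H1 k.
have hC : h * C <= e / 2.
  by rewrite /h mulrAC ler_pdivrMr; [nra|lra].
have -> : F k - euler h F' k = (F k - F' k) - (euler h F' k - F' k) by ring.
move=> A B; apply: (le_trans (ler_normB _ _)); lra.
Qed.

Lemma dom_cvg F : dom F -> cvgn F. Proof. by case. Qed.

Section iterates.
Variable h : R.
Hypothesis h0 : 0 < h.
Local Notation I k := (iter k (euler h)).

Lemma I_bound k F M i : (forall j, `|F j| <= M) -> `|I k F i| <= M.
Proof. by move=> FM; elim: k i => //= k IH i; exact: euler_bound. Qed.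

Lemma IB k F G M N i : (forall j, `|F j| <= M) -> (forall j, `|G j| <= N) ->
  I k (fun j => F j - G j) i = I k F i - I k G i.
Proof.
move=> FM GN; elim: k i => //= k IH i.
by rewrite (funext IH) (eulerB h0 i (fun j => I_bound k j FM) (fun j => I_bound k j GN)).
Qed.

Lemma IZ k F M c i : (forall j, `|F j| <= M) -> I k (fun j => c * F j) i = c * I k F i.
Proof.
move=> FM; elim: k i => //= k IH i.
by rewrite (funext IH) (eulerZ h0 c i (fun j => I_bound k j FM)).
Qed.

Lemma I_ge0 k F M i : (forall j, `|F j| <= M) -> (forall j, 0 <= F j) -> 0 <= I k F i.
Proof.
move=> FM F0; elim: k i => //= k IH i.
exact: (euler_ge0 h0 i (fun j => I_bound k j FM) IH).
Qed.

Lemma I_cvgn k F : cvgn F -> cvgn (I k F).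
Proof.
move=> cF; case: k => //= k; have [M M0 FM] := cvgn_bounded cF.
exact: (euler_cvgn h0 (fun j => I_bound k j FM)).
Qed.

Lemma dom2_I k C1 C2 F : dom2 C1 C2 F -> dom2 C1 C2 (I k F).
Proof. by move=> dF; elim: k => //= k IH; exact: dom2_euler. Qed.

Lemma I_near k C1 C2 F i : dom2 C1 C2 F -> `|I k F i - F i| <= k%:R * h * C1.
Proof.
move=> dF; elim: k => [|k IH]; first by rewrite subrr normr0 !mul0r.
have [dI _ QC _] := dom2_I k dF; have H := euler_near i h0 dI QC.
rewrite iterS; set X := euler h _ i in H *; set Y := I k F i in H IH *.
have -> : X - F i = (X - Y) + (Y - F i) by ring.
apply: (le_trans (ler_normD _ _)); rewrite -natr1; lra.
Qed.

(** From J F = F + h J(QF), the error of step k + 1 is J applied to the error of step k, plus (k +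
    1) h (J - 1) QF; the latter is at most (k + 1) h h C2, which fits between the consecutive
    squares. *)
Lemma I_expand k C1 C2 F i : dom2 C1 C2 F ->
  `|I k F i - F i - k%:R * h * Qseq F i| <= (k%:R * h) ^+ 2 * C2.
Proof.
move=> dF; have [dom1 domQ QC1 QC2] := dF.
have [M M0 FM] := cvgn_bounded (dom_cvg dom1).
have C20 : 0 <= C2 by exact: le_trans (QC2 0%N).
elim: k i => [|k IH] i; first by rewrite !mul0r !subrr normr0 expr0n mul0r.
have IM j := I_bound k j FM.
pose D j := I k F j - F j - k%:R * h * Qseq F j.
have DE : euler h D i = I k.+1 F i - euler h F i - k%:R * h * euler h (Qseq F) i.
  have qM j : `|k%:R * h * Qseq F j| <= `|k%:R * h| * C1 by rewrite normrM ler_wpM2l.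
  have dM j : `|I k F j - F j| <= M + M by rewrite (le_trans (ler_normB _ _)) // lerD.
  by rewrite /D (eulerB h0 i dM qM) (eulerB h0 i IM FM) (eulerZ h0 _ i QC1).
have H1 : `|euler h D i| <= (k%:R * h) ^+ 2 * C2 by exact: euler_bound.
have H2 := euler_near i h0 domQ QC2.
have H3 := dom_euler h0 dom1 i.
have -> : I k.+1 F i - F i - k.+1%:R * h * Qseq F i =
   euler h D i + (k.+1%:R * h) * (euler h (Qseq F) i - Qseq F i).
  have E : euler h F i = F i + h * euler h (Qseq F) i by rewrite -H3 addrC subrK.
  by rewrite DE E -natr1; ring.
have k0 : 0 <= k%:R * h by rewrite mulr_ge0 // ltW.
have k1 : 0 <= k.+1%:R * h by rewrite mulr_ge0 // ltW.
apply: (le_trans (ler_normD _ _)).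
have H4 : `|k.+1%:R * h * (euler h (Qseq F) i - Qseq F i)| <= k.+1%:R * h * (h * C2).
  by rewrite normrM ger0_norm // ler_wpM2l.
have -> : (k.+1%:R * h) ^+ 2 * C2 = (k%:R * h) ^+ 2 * C2 + (k.+1%:R * h * (h * C2)) + k%:R * h * h * C2.
  by rewrite -natr1; ring.
have : 0 <= k%:R * h * h * C2 by rewrite !mulr_ge0 // ltW.
lra.
Qed.

(** The left factor is the discrete chance of not leaving i: as X = I^(k+1) F is nonnegative, I^k
    F(i) = X_i - h QX(i) is at most (1 + h q_i) X_i. *)
Lemma I_low k F M i : (forall j, `|F j| <= M) -> (forall j, 0 <= F j) ->
  (1 + h * (a i + b i)) ^- k * F i <= I k F i.
Proof.
move=> FM F0; have q0 := q_gt0 hab i.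
have d0 : 0 < 1 + h * (a i + b i) by have := mulr_gt0 h0 q0; lra.
elim: k => [|k IH]; first by rewrite expr0 invr1 mul1r.
have IM j := I_bound k j FM; have Ip j : 0 <= I k F j := I_ge0 k j FM F0.
have Jp j : 0 <= I k.+1 F j := I_ge0 k.+1 j FM F0.
have H : I k F i <= (1 + h * (a i + b i)) * I k.+1 F i.
  have := euler_Qseq h0 i IM; rewrite -/(I k.+1 F) => E.
  have -> : I k F i = I k.+1 F i - h * Qseq (I k.+1 F) i.
    by rewrite E mulVKf ?lt0r_neq0 //= subKr.
  have : 0 <= h * (Qseq (I k.+1 F) i + (a i + b i) * I k.+1 F i).
    rewrite mulr_ge0 ?(ltW h0) // /Qseq.
    have A1 : 0 <= a i * (if i is j.+1 then I k.+1 F j else 0).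
      by rewrite mulr_ge0 ?(a_ge0 hab) //; case: (i) => [|j].
    have A2 : 0 <= b i * I k.+1 F i.+1 by rewrite mulr_ge0 // ltW // (b_gt0 hab).
    lra.
  lra.
rewrite -(ler_pM2l d0); apply: le_trans H; apply: le_trans IH.
by rewrite exprS invfM mulrA mulrA mulfV ?lt0r_neq0 // mul1r.
Qed.

End iterates.

(** To first order both sides move F by 2 s QF. With G = QF the difference is s times 2 (J_2s G - G)
    - (J_s G - G) - (J_s J_s G - G), bounded by 4 s C2 + s C2 + 2 s C2: hence 7. *)
Lemma euler_half s C1 C2 F i : 0 < s -> dom2 C1 C2 F ->
  `|euler (2 * s) F i - euler s (euler s F) i| <= 7 * s ^+ 2 * C2.
Proof.
move=> s0 dF; have [dF0 dQ QC1 QC2] := dF.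
have s20 : 0 < 2 * s by rewrite mulr_gt0.
have [dJ _ _ _] := dom2_euler s0 dF.
have E1 := dom_euler s20 dF0 i; have E2 := dom_euler s0 dF0 i; have E3 := dom_euler s0 dJ i.
rewrite (dom_euler_comm s0 dF0) in E3.
have H1 := euler_near i s20 dQ QC2; have H2 := euler_near i s0 dQ QC2.
have H3 := I_near s0 2 i (C1 := C2) (C2 := C2) (F := Qseq F).
set G := Qseq F in E1 E2 E3 H1 H2 H3.
have H4 : `|euler s (euler s G) i - G i| <= 2 * s * C2.
  have dJG := euler_dom s0 (dom_cvg dQ).
  have QJ k : `|Qseq (euler s G) k| <= C2 by rewrite (dom_euler_comm s0 dQ); exact: euler_bound.
  have A := euler_near i s0 dJG QJ.
  have -> : euler s (euler s G) i - G i = (euler s (euler s G) i - euler s G i) + (euler s G i - G i) by ring.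
  by apply: (le_trans (ler_normD _ _)); lra.
have -> : euler (2 * s) F i - euler s (euler s F) i =
  s * ((2 * (euler (2 * s) G i - G i) - (euler s G i - G i)) - (euler s (euler s G) i - G i)).
  have A1 : euler (2 * s) F i = F i + 2 * s * euler (2 * s) G i by rewrite -E1 addrC subrK.
  have A2 : euler s (euler s F) i = euler s F i + s * euler s (euler s G) i by rewrite -E3 addrC subrK.
  have A3 : euler s F i = F i + s * euler s G i by rewrite -E2 addrC subrK.
  by rewrite A1 A2 A3; ring.
rewrite normrM gtr0_norm //.
have -> : 7 * s ^+ 2 * C2 = s * (2 * (2 * s * C2) + s * C2 + 2 * s * C2) by ring.
rewrite ler_pM2l //; apply: (le_trans (ler_normB _ _)); apply: lerD => //.
apply: (le_trans (ler_normB _ _)); apply: lerD => //.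
by rewrite normrM ger0_norm // ler_pM2l.
Qed.

Lemma I_half s k C1 C2 F i : 0 < s -> dom2 C1 C2 F ->
  `|iter k (euler (2 * s)) F i - iter k.*2 (euler s) F i| <= k%:R * (7 * s ^+ 2 * C2).
Proof.
move=> s0; have s20 : 0 < 2 * s by rewrite mulr_gt0.
elim: k F i => [|k IH] F i dF; first by rewrite subrr normr0 mul0r.
rewrite iterSr doubleS 2!iterSr.
have dB := dom2_euler s0 (dom2_euler s0 dF); have dA := dom2_euler s20 dF.
have [dA0 _ _ _] := dA; have [dB0 _ _ _] := dB.
have [M M0 AM] := cvgn_bounded (dom_cvg dA0); have [N N0 BN] := cvgn_bounded (dom_cvg dB0).
have H1 : `|iter k (euler (2 * s)) (fun j => euler (2 * s) F j - euler s (euler s F) j) i| <= 7 * s ^+ 2 * C2.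
  by apply: I_bound => // j; exact: (euler_half j s0 dF).
rewrite (IB s20 k i AM BN) in H1.
have H2 := IH _ i dB.
have -> : k.+1%:R * (7 * s ^+ 2 * C2) = 7 * s ^+ 2 * C2 + k%:R * (7 * s ^+ 2 * C2).
  by rewrite -natr1; ring.
apply: le_trans (lerD H1 H2); apply: le_trans (ler_normD _ _).
by rewrite addrA subrK.
Qed.

End semigroup_construction.

(** * Sequences with geometrically decreasing increments *)

Section dyadic_limit.
Context {R : realType}.

(** x_m - K 2^-m increases and x_m + K 2^-m decreases; the two enclose the limit, which gives
    convergence and its rate together. *)
Lemma dyadic_cauchy (x : nat -> R) (K : R) :
  (forall m, `|x m.+1 - x m| <= K * (2 ^+ m.+1)^-1) ->
  cvgn x /\ forall m, `|x m - limn x| <= K * (2 ^+ m)^-1.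
Proof.
move=> H.
have p0 m : 0 < 2 ^+ m :> R by rewrite exprn_gt0.
have E m : K * (2 ^+ m)^-1 = K * (2 ^+ m.+1)^-1 + K * (2 ^+ m.+1)^-1.
  by rewrite exprS; field; exact: lt0r_neq0.
have K0 : 0 <= K.
  have := le_trans (normr_ge0 _) (H 0%N); by rewrite pmulr_lge0 // invr_gt0.
have P0 m : 0 <= K * (2 ^+ m)^-1 by rewrite mulr_ge0 // invr_ge0 ltW.
have inc : {homo (fun m => x m - K * (2 ^+ m)^-1) : m1 m2 / (m1 <= m2)%N >-> m1 <= m2}.
  apply: homo_leq (@le_refl _ _) (@le_trans _ _) _ => m.
  by have := H m; rewrite ler_distl (E m) => /andP[]; lra.
have dec : {homo (fun m => x m + K * (2 ^+ m)^-1) : m1 m2 / (m1 <= m2)%N >-> m2 <= m1}.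
  apply: homo_leq (@le_refl _ _) _ _ => [y z w /[swap]|m]; first exact: le_trans.
  by have := H m; rewrite ler_distl (E m) => /andP[]; lra.
have c1 : cvgn (fun m => x m - K * (2 ^+ m)^-1).
  apply: nondecreasing_is_cvgn => //; exists (x 0%N + K * (2 ^+ 0)^-1) => _ [m _ <-].
  by have := dec 0%N m (leq0n m); have := P0 m; lra.
have c2 : (fun m => K * (2 ^+ m)^-1) @ \oo --> (0 : R).
  rewrite -[X in _ --> X](mulr0 K); apply: cvgZr.
  have -> : (fun m => (2 ^+ m)^-1) = (fun m => (2^-1 : R) ^+ m) by apply/funext => m; rewrite exprVn.
  by apply: cvg_expr; rewrite ger0_norm; lra.
have L1 : x @ \oo --> limn (fun m => x m - K * (2 ^+ m)^-1).
  rewrite -[X in _ --> X]addr0.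
  have -> : x = fun m => (x m - K * (2 ^+ m)^-1) + K * (2 ^+ m)^-1.
    by apply/funext => m; rewrite subrK.
  apply: cvgD => //; under [X in limn X]eq_fun do rewrite subrK; exact: c1.
have cx : cvgn x by apply/cvg_ex; eexists; exact: L1.
have L2 : (fun m => x m + K * (2 ^+ m)^-1) @ \oo --> limn x.
  by rewrite -[X in _ --> X]addr0; apply: cvgD.
split => // m; rewrite distrC ler_distl; apply/andP; split.
  rewrite (cvg_lim _ L1) //; exact: (nondecreasing_cvgn_le inc c1).
have c3 : cvgn (fun m => x m + K * (2 ^+ m)^-1) by apply/cvg_ex; exists (limn x).
by have := nonincreasing_cvgn_ge dec c3 m; rewrite (cvg_lim _ L2).
Qed.

End dyadic_limit.

Lemma nat_between (x z : nat) : (x < z.+1)%N -> (z < x.+2)%N -> z = x \/ z = x.+1.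
Proof. lia. Qed.

(** * The semigroup as a limit along dyadic steps *)

Section semigroup_limit.
Context {R : realType} (a b : nat -> R).
Hypotheses (hab : rates a b) (hs : (sigma a b < +oo)%E).
Variables (n : nat -> R) (g be : R).
Hypothesis hadm : adm a b n g be.
Implicit Types (F G : nat -> R) (al c l M N C e s t : R).
Local Notation Qseq := (Qseq a b).
Local Notation RT := (RT a b n g be).
Local Notation euler := (euler a b n g be).
Local Notation dom := (dom a b n g be).
Local Notation dom2 := (dom2 a b n g be).

Definition dyadic_step (m : nat) : R := (2 ^+ m)^-1.
Definition nsteps (m : nat) (t : R) : nat := Num.truncn (t * 2 ^+ m).
(** Euler steps of size 2^-m up to t rounded down. Dyadic sizes are nested, so consecutive
    approximations compare by [I_half] up to one extra step. *)
Definition AT m t F := iter (nsteps m t) (euler (dyadic_step m)) F.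
Definition PT t F i : R := limn (fun m => AT m t F i).

Lemma dyadic_step_gt0 m : 0 < dyadic_step m. Proof. by rewrite invr_gt0 exprn_gt0. Qed.

Lemma dyadic_stepS m : dyadic_step m = 2 * dyadic_step m.+1.
Proof. by rewrite /dyadic_step exprS invfM mulrA mulfV ?mul1r. Qed.

Lemma dyadic_step_cvg0 : dyadic_step @ \oo --> (0 : R).
Proof.
have -> : dyadic_step = (fun m => (2^-1 : R) ^+ m) by apply/funext => m; rewrite /dyadic_step exprVn.
by apply: cvg_expr; rewrite ger0_norm; lra.
Qed.

Lemma nsteps_itv m t : 0 <= t -> (nsteps m t)%:R * dyadic_step m <= t < (nsteps m t)%:R * dyadic_step m + dyadic_step m.
Proof.
move=> t0; have p0 : 0 < 2 ^+ m :> R by rewrite exprn_gt0.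
have /truncn_itv : 0 <= t * 2 ^+ m by rewrite mulr_ge0 // ltW.
have E : (nsteps m t).+1%:R = (nsteps m t)%:R + 1 :> R by rewrite natr1.
rewrite -/(nsteps m t) E /dyadic_step => /andP[H1 H2].
by rewrite ler_pdivrMr // H1 /= -[X in _ < _ + X]mul1r -mulrDl ltr_pdivlMr.
Qed.

Lemma nstepsS m t : 0 <= t -> nsteps m.+1 t = (nsteps m t).*2 \/ nsteps m.+1 t = (nsteps m t).*2.+1.
Proof.
move=> t0; have h0 := dyadic_step_gt0 m.+1.
have /andP[H1 H2] := nsteps_itv m t0; have /andP[H3 H4] := nsteps_itv m.+1 t0.
rewrite dyadic_stepS in H1 H2.
have A1 : ((nsteps m t).*2 < (nsteps m.+1 t).+1)%N.
  rewrite -(ltr_nat R) -muln2 natrM -natr1 -(ltr_pM2r h0); lra.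
have A2 : (nsteps m.+1 t < (nsteps m t).+1.*2)%N.
  rewrite -(ltr_nat R) -muln2 natrM -natr1 -(ltr_pM2r h0); lra.
by rewrite doubleS in A2; exact: nat_between A1 A2.
Qed.

Lemma nsteps_cvg t : 0 <= t -> (fun m => (nsteps m t)%:R * dyadic_step m) @ \oo --> t.
Proof.
move=> t0; apply/cvgn_epsP => e e0; have /cvgn_epsP/(_ e e0)[N HN] := dyadic_step_cvg0.
exists N => m Nm; have := HN m Nm; rewrite subr0 ger0_norm ?(ltW (dyadic_step_gt0 _)) // => H.
by have /andP[H1 H2] := nsteps_itv m t0; rewrite ler_distl; lra.
Qed.

Lemma AT_bound m t F M i : (forall k, `|F k| <= M) -> `|AT m t F i| <= M.
Proof. by move=> FM; apply: (I_bound hab hs hadm (dyadic_step_gt0 m)). Qed.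

Lemma ATB m t F G M N i : (forall k, `|F k| <= M) -> (forall k, `|G k| <= N) ->
  AT m t (fun k => F k - G k) i = AT m t F i - AT m t G i.
Proof. by move=> FM GN; exact: (IB hab hs hadm (dyadic_step_gt0 m) _ i FM GN). Qed.

(** The term 7 t C2 comes from halving the steps ([I_half]), the term C1 from the step that rounding
    may add. *)
Lemma AT_step m t C1 C2 F i : 0 <= t -> dom2 C1 C2 F ->
  `|AT m.+1 t F i - AT m t F i| <= (7 * t * C2 + C1) * dyadic_step m.+1.
Proof.
move=> t0 dF; have h0 := dyadic_step_gt0 m.+1; have [dF0 _ QC1 QC2] := dF.
have C20 : 0 <= C2 by exact: le_trans (QC2 0%N).
have C10 : 0 <= C1 by exact: le_trans (QC1 0%N).
have H1 := I_half hab hs hadm (nsteps m t) i h0 dF; rewrite -dyadic_stepS in H1.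
have H2 : `|AT m.+1 t F i - iter (nsteps m t).*2 (euler (dyadic_step m.+1)) F i| <= dyadic_step m.+1 * C1.
  rewrite /AT; case: (nstepsS m t0) => ->; first by rewrite subrr normr0 mulr_ge0 // ltW.
  have [dX _ QX _] := dom2_I hab hs hadm h0 (nsteps m t).*2 dF.
  by rewrite iterS; exact: (euler_near hab hs hadm i h0 dX QX).
have /andP[kt _] := nsteps_itv m t0; rewrite dyadic_stepS in kt.
have H3 : (nsteps m t)%:R * (7 * dyadic_step m.+1 ^+ 2 * C2) <= 7 * t * C2 * dyadic_step m.+1.
  have -> : (nsteps m t)%:R * (7 * dyadic_step m.+1 ^+ 2 * C2) =
     ((nsteps m t)%:R * dyadic_step m.+1) * (7 * C2 * dyadic_step m.+1) by ring.
  have -> : 7 * t * C2 * dyadic_step m.+1 = t * (7 * C2 * dyadic_step m.+1) by ring.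
  rewrite ler_wpM2r // ?mulr_ge0 // ?(ltW h0) //.
  have : 0 <= (nsteps m t)%:R * dyadic_step m.+1 by rewrite mulr_ge0 // ltW.
  lra.
rewrite -/(AT m t F) in H1.
set X := AT m.+1 t F i in H2 *; set Z := AT m t F i in H1 *.
set Y := iter _ _ _ i in H1 H2.
have -> : X - Z = (X - Y) - (Z - Y) by ring.
by apply: (le_trans (ler_normB _ _)); lra.
Qed.

Lemma AT_dom2 t C1 C2 F : 0 <= t -> dom2 C1 C2 F ->
  forall m i, `|AT m t F i - PT t F i| <= (7 * t * C2 + C1) * dyadic_step m.
Proof.
by move=> t0 dF m i; have [|_] := @dyadic_cauchy R (fun m => AT m t F i) (7 * t * C2 + C1) => [k|]; [exact: AT_step|exact].
Qed.

Lemma AT_cauchy t F e : 0 <= t -> cvgn F -> 0 < e ->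
  exists N : nat, forall m m' i, (N <= m)%N -> (N <= m')%N -> `|AT m t F i - AT m' t F i| <= e.
Proof.
move=> t0 cF e0; have [M M0 FM] := cvgn_bounded cF.
have [C1 [C2 [F' dF' H]]] := dom2_dense hab hs hadm cF (e := e / 8) ltac:(lra).
have [dF0 _ QC1 QC2] := dF'; have [M' M0' FM'] := cvgn_bounded (dom_cvg dF0).
have C20 : 0 <= C2 by exact: le_trans (QC2 0%N).
have C10 : 0 <= C1 by exact: le_trans (QC1 0%N).
set K := 7 * t * C2 + C1; have K0 : 0 <= K by rewrite addr_ge0 // !mulr_ge0.
have /cvgn_epsP/(_ (e / 8 / (K + 1)) _)[|N HN] := dyadic_step_cvg0; first by rewrite divr_gt0; lra.
have near m i : (N <= m)%N -> `|AT m t F i - PT t F' i| <= e / 4.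
  move=> Nm; have A1 := AT_dom2 t0 dF' m i; rewrite -/K in A1.
  have A2 : `|AT m t (fun k => F k - F' k) i| <= e / 8 by exact: AT_bound.
  rewrite (ATB m t i FM FM') in A2.
  have := HN m Nm; rewrite subr0 ger0_norm ?(ltW (dyadic_step_gt0 _)) // => A3.
  have A4 : K * dyadic_step m <= e / 8.
    apply: (le_trans (ler_wpM2l K0 A3)); rewrite mulrA ler_pdivrMr; [nra|lra].
  have -> : AT m t F i - PT t F' i = (AT m t F i - AT m t F' i) + (AT m t F' i - PT t F' i) by ring.
  by apply: (le_trans (ler_normD _ _)); lra.
exists N => m m' i Nm Nm'; have A := near m i Nm; have B := near m' i Nm'.
have -> : AT m t F i - AT m' t F i = (AT m t F i - PT t F' i) - (AT m' t F i - PT t F' i) by ring.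
by apply: (le_trans (ler_normB _ _)); lra.
Qed.

Lemma AT_cvg t F i : 0 <= t -> cvgn F -> (fun m => AT m t F i) @ \oo --> PT t F i.
Proof.
move=> t0 cF; suff : cvgn (fun m => AT m t F i) by [].
apply/cauchy_cvgP/cauchy_exP => e e0.
have [N HN] := AT_cauchy t0 cF (e := e / 2) ltac:(lra).
exists (AT N t F i), N => // m /= Nm; rewrite /ball /=.
by apply: le_lt_trans (HN N m i (leqnn N) Nm) _; lra.
Qed.

Lemma AT_unif t F e : 0 <= t -> cvgn F -> 0 < e ->
  exists N : nat, forall m i, (N <= m)%N -> `|AT m t F i - PT t F i| <= e.
Proof.
move=> t0 cF e0; have [N HN] := AT_cauchy t0 cF (e := e / 2) ltac:(lra).
exists N => m i Nm.
have /cvgn_epsP/(_ (e / 2) ltac:(lra))[N' HN'] := AT_cvg (i := i) t0 cF.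
have H1 := HN m (maxn N N') i Nm (leq_maxl _ _).
have H2 := HN' (maxn N N') (leq_maxr _ _).
set X := AT (maxn N N') t F i in H1 H2.
have -> : AT m t F i - PT t F i = (AT m t F i - X) + (X - PT t F i) by ring.
by apply: (le_trans (ler_normD _ _)); lra.
Qed.

Lemma PT_bound t F M i : 0 <= t -> cvgn F -> (forall k, `|F k| <= M) -> `|PT t F i| <= M.
Proof.
move=> t0 cF FM; apply: limn_norm_le => [|m]; last exact: AT_bound.
by apply/cvg_ex; exists (PT t F i); exact: AT_cvg.
Qed.

Lemma PT_cvgn t F : 0 <= t -> cvgn F -> cvgn (PT t F).
Proof.
move=> t0 cF; apply: cvgn_unif => e e0; have [N HN] := AT_unif t0 cF e0.
exists (AT N t F) => [|k]; last by rewrite distrC; exact: HN.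
exact: (I_cvgn hab hs hadm (dyadic_step_gt0 N)).
Qed.

Lemma PTB t F G i : 0 <= t -> cvgn F -> cvgn G ->
  PT t (fun k => F k - G k) i = PT t F i - PT t G i.
Proof.
move=> t0 cF cG; have [M _ FM] := cvgn_bounded cF; have [N _ GN] := cvgn_bounded cG.
apply/cvg_lim => //; under eq_fun do rewrite (ATB _ _ _ FM GN).
by apply: cvgB; exact: AT_cvg.
Qed.

Lemma PTZ t c F i : 0 <= t -> cvgn F -> PT t (fun k => c * F k) i = c * PT t F i.
Proof.
move=> t0 cF; have [M _ FM] := cvgn_bounded cF.
apply/cvg_lim => //; rewrite /AT; under eq_fun do rewrite (IZ hab hs hadm (dyadic_step_gt0 _) _ _ _ FM).
by apply: cvgZr; exact: AT_cvg.
Qed.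

(** The chain stays at i up to t with probability at least exp(- q_i t). Besides positivity, this
    persistence is what [PT_tail] and [PT_deriv] rest on. *)
Lemma PT_low t F i : 0 <= t -> cvgn F -> (forall k, 0 <= F k) ->
  expR (- ((a i + b i) * t)) * F i <= PT t F i.
Proof.
move=> t0 cF F0; have [M _ FM] := cvgn_bounded cF; have q0 := q_gt0 hab i.
have cA : cvgn (fun m => AT m t F i) by apply/cvg_ex; exists (PT t F i); exact: AT_cvg.
apply: limn_ge => // m; have h0 := dyadic_step_gt0 m.
apply: le_trans (I_low hab hs hadm h0 (nsteps m t) i FM F0).
rewrite ler_wpM2r // expRN -exprVn exprVn.
have d0 : 0 < 1 + dyadic_step m * (a i + b i) by have := mulr_gt0 h0 q0; lra.
rewrite lef_pV2 ?posrE ?exprn_gt0 ?expR_gt0 //.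
apply: (@le_trans _ _ (expR (dyadic_step m * (a i + b i)) ^+ nsteps m t)).
  by rewrite lerXn2r ?nnegrE ?expR_ge0 ?(ltW d0) // expR_ge1Dx.
rewrite -expRM_natl ler_expR; have /andP[H _] := nsteps_itv m t0.
by rewrite mulrA mulrC ler_wpM2l // ltW.
Qed.

Lemma PT_ge0 t F i : 0 <= t -> cvgn F -> (forall k, 0 <= F k) -> 0 <= PT t F i.
Proof.
move=> t0 cF F0; apply: le_trans (PT_low i t0 cF F0).
by rewrite mulr_ge0 // expR_ge0.
Qed.

Lemma PT_0 F i : PT 0 F i = F i.
Proof.
apply/cvg_lim => //; have -> : (fun m => AT m 0 F i) = fun=> F i.
  by apply/funext => m; rewrite /AT /nsteps mul0r truncn0.
exact: cvg_cst.
Qed.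

Lemma PT_expand t C1 C2 F i : 0 <= t -> dom2 C1 C2 F ->
  `|PT t F i - F i - t * Qseq F i| <= t ^+ 2 * C2.
Proof.
move=> t0 dF; have [dF0 _ _ _] := dF.
have L1 : (fun m => `|AT m t F i - F i - (nsteps m t)%:R * dyadic_step m * Qseq F i|) @ \oo -->
    `|PT t F i - F i - t * Qseq F i|.
  apply: cvg_norm; apply: cvgB; last by apply: cvgMl; exact: nsteps_cvg.
  by apply: cvgB; [apply: AT_cvg => //; exact: dom_cvg dF0|exact: cvg_cst].
have L2 : (fun m => ((nsteps m t)%:R * dyadic_step m) ^+ 2 * C2) @ \oo --> t ^+ 2 * C2.
  by apply: cvgMl; rewrite expr2; under eq_fun do rewrite expr2; apply: cvgM; exact: nsteps_cvg.
apply: (cvgn_le_lim L1 L2) => m.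
exact: (I_expand hab hs hadm (dyadic_step_gt0 m) _ i dF).
Qed.

Lemma ler_norm4 (x y z w A B C D : R) : `|x| <= A -> `|y| <= B -> `|z| <= C -> `|w| <= D ->
  `|x - y + z + w| <= A + B + C + D.
Proof.
move=> h1 h2 h3 h4; apply: (le_trans (ler_normD _ _)); apply: lerD => //.
apply: (le_trans (ler_normD _ _)); apply: lerD => //.
by apply: (le_trans (ler_normB _ _)); exact: lerD.
Qed.

Lemma PT_strong F e : cvgn F -> 0 < e ->
  exists2 d, 0 < d & forall s, 0 <= s -> s < d -> forall i, `|PT s F i - F i| <= e.
Proof.
move=> cF e0; have [C1 [C2 [F' dF' H]]] := dom2_dense hab hs hadm cF (e := e / 4) ltac:(lra).
have [dF0 _ QC1 QC2] := dF'.
have C20 : 0 <= C2 by exact: le_trans (QC2 0%N).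
have C10 : 0 <= C1 by exact: le_trans (QC1 0%N).
exists (Num.min 1 (e / 4 / (C1 + C2 + 1))).
  by rewrite lt_min ltr01 divr_gt0; lra.
move=> s s0; rewrite lt_min ltr_pdivlMr ?ltr_wpDl ?addr_ge0 // => /andP[s1 sd] i.
have H1 := PT_expand i s0 dF'.
have H2 : `|s * Qseq F' i| <= s * C1 by rewrite normrM ger0_norm // ler_wpM2l.
have H3 : s ^+ 2 * C2 <= s * C2 by rewrite ler_wpM2r // expr2 ler_piMr // ltW.
have cF' := dom_cvg dF0.
have H4 : `|PT s (fun k => F k - F' k) i| <= e / 4 by apply: PT_bound => //; exact: is_cvgB.
rewrite (PTB i s0 cF cF') in H4.
have -> : PT s F i - F i = (PT s F i - PT s F' i) - (F i - F' i) +
   (PT s F' i - F' i - s * Qseq F' i) + s * Qseq F' i by ring.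
apply: (le_trans (ler_norm4 H4 (H i) H1 H2)).
nra.
Qed.

Lemma PT_semigroup s t F i : 0 <= s -> 0 <= t -> cvgn F ->
  PT (s + t) F i = PT s (PT t F) i.
Proof.
move=> s0 t0 cF; have st0 : 0 <= s + t by rewrite addr_ge0.
have [M M0 FM] := cvgn_bounded cF.
have cP := PT_cvgn t0 cF; have PM k := PT_bound k t0 cF FM.
apply: (@eq_eps _ _ _ 1) => e e0; rewrite mul1r.
have [N1 H1] := AT_unif st0 cF (e := e / 8) ltac:(lra).
have [N2 H2] := AT_unif t0 cF (e := e / 8) ltac:(lra).
have [N3 H3] := AT_unif s0 cP (e := e / 8) ltac:(lra).
have [F' dF' HF'] := dom_dense hab hs hadm cF (e := e / 8) ltac:(lra).
have [cF' cQ _] := dF'; have [C C0 QC] := cvgn_bounded cQ.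
have /cvgn_epsP/(_ (e / 8 / (C + 1)) _)[|N4 H4] := dyadic_step_cvg0; first by rewrite divr_gt0; lra.
pose m := maxn (maxn N1 N2) (maxn N3 N4).
have m1 : (N1 <= m)%N by rewrite /m !leq_max leqnn.
have m2 : (N2 <= m)%N by rewrite /m !leq_max leqnn orbT.
have m3 : (N3 <= m)%N by rewrite /m !leq_max leqnn !orbT.
have m4 : (N4 <= m)%N by rewrite /m !leq_max leqnn !orbT.
have h0 := dyadic_step_gt0 m.
have hC : dyadic_step m * C <= e / 8.
  have := H4 m m4; rewrite subr0 ger0_norm ?(ltW h0) // => A.
  by apply: (le_trans (ler_wpM2r C0 A)); rewrite mulrAC ler_pdivrMr; [nra|lra].
have [M' _ FM'] := cvgn_bounded cF'.
have JF k : `|euler (dyadic_step m) F k - F k| <= 3 * (e / 8).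
  have A1 : `|euler (dyadic_step m) (fun k => F k - F' k) k| <= e / 8 by exact: (euler_bound hab hs hadm h0).
  rewrite (eulerB hab hs hadm h0 k FM FM') in A1.
  have A2 := euler_near hab hs hadm k h0 dF' QC; have A3 := HF' k.
  have -> : euler (dyadic_step m) F k - F k = (euler (dyadic_step m) F k - euler (dyadic_step m) F' k) - (F k - F' k) +
    (euler (dyadic_step m) F' k - F' k) + 0 by ring.
  apply: (le_trans (ler_norm4 A1 A3 A2 (D := 0) _)); first by rewrite normr0.
  lra.
have K : nsteps m (s + t) = (nsteps m s + nsteps m t)%N \/ nsteps m (s + t) = (nsteps m s + nsteps m t).+1.
  have /andP[a1 a2] := nsteps_itv m s0; have /andP[a3 a4] := nsteps_itv m t0.
  have /andP[a5 a6] := nsteps_itv m st0.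
  have A1 : (nsteps m s + nsteps m t < (nsteps m (s + t)).+1)%N.
    rewrite -(ltr_nat R) natrD -natr1 -(ltr_pM2r h0); lra.
  have A2 : (nsteps m (s + t) < (nsteps m s + nsteps m t).+2)%N.
    rewrite -(ltr_nat R) -natr1 -natr1 natrD -(ltr_pM2r h0); lra.
  exact: nat_between A1 A2.
have B1 : `|AT m (s + t) F i - AT m s (AT m t F) i| <= 3 * (e / 8).
  rewrite /AT -iterD; case: K => ->; first by rewrite subrr normr0; lra.
  rewrite iterSr -(IB hab hs hadm h0 _ i (fun k => euler_bound hab hs hadm h0 k FM) FM).
  exact: (I_bound hab hs hadm h0).
have B2 : `|AT m s (fun k => AT m t F k - PT t F k) i| <= e / 8.
  by apply: AT_bound => k; exact: H2.
rewrite (ATB m s i (fun k => AT_bound m t k FM) PM) in B2.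
have B3 := H3 m i m3; have B4 := H1 m i m1.
have -> : PT (s + t) F i - PT s (PT t F) i =
  (AT m (s + t) F i - AT m s (AT m t F) i) - (AT m (s + t) F i - PT (s + t) F i) +
  (AT m s (AT m t F) i - AT m s (PT t F) i) + (AT m s (PT t F) i - PT s (PT t F) i) by ring.
by apply: (le_trans (ler_norm4 B1 B4 B2 B3)); lra.
Qed.

Lemma PT_bcont F M i : cvgn F -> (forall k, `|F k| <= M) -> bcont M (fun t => PT t F i).
Proof.
move=> cF FM; split=> [e e0|t t0]; last exact: PT_bound.
have [d d0 Hd] := PT_strong cF e0; exists d => // s t.
wlog st : s t / s <= t.
  move=> W s0 t0 std; have [st|/ltW ts] := leP s t; first exact: W.
  by rewrite distrC; apply: W => //; rewrite distrC.
move=> s0 t0; rewrite distrC ger0_norm ?subr_ge0 // => std; rewrite distrC.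
have ts0 : 0 <= t - s by rewrite subr_ge0.
have -> : PT t F i = PT s (PT (t - s) F) i by rewrite -PT_semigroup // addrC subrK.
have cP := PT_cvgn ts0 cF.
rewrite -(PTB i s0 cP cF); apply: PT_bound => //; first exact: is_cvgB.
by move=> k; exact: Hd.
Qed.

(* On the domain, the difference quotient of the shifted transform is computed in
   two ways. *)
Lemma laplace_PT al F i : 0 < al -> cvgn F -> laplace al (fun t => PT t F i) = RT al F i.
Proof.
move=> al0 cF; have [M M0 FM] := cvgn_bounded cF.
have base C1 C2 G : dom2 C1 C2 G ->
   al * laplace al (fun t => PT t G i) - G i = laplace al (fun t => PT t (Qseq G) i).
  move=> dG; have [dG0 dQ QC1 QC2] := dG; have cG := dom_cvg dG0; have cQ := dom_cvg dQ.
  have [N N0 GN] := cvgn_bounded cG.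
  have bG := PT_bcont i cG GN; have bQ := PT_bcont i cQ QC1.
  have C20 : 0 <= C2 by exact: le_trans (QC2 0%N).
  have L1 := laplace_deriv al0 bG; rewrite PT_0 in L1.
  apply: (cvg_unique _ L1) => //; apply/cvg_right0_epsP => e e0.
  exists (e * al / (C2 + 1)) => [|t t0 td]; first by rewrite divr_gt0 ?mulr_gt0; lra.
  have bS := bcont_shift (ltW t0) bG.
  have E (s : R) : 0 <= s -> `|PT (t + s) G i - PT s G i - t * PT s (Qseq G) i| <= t ^+ 2 * C2.
    move=> s0; rewrite (addrC t s) (PT_semigroup i s0 (ltW t0) cG).
    have cP := PT_cvgn (ltW t0) cG.
    have cPG : cvgn (fun k => PT t G k - G k) by exact: is_cvgB.
    have ctQ : cvgn (fun k => t * Qseq G k) by exact: is_cvgZr.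
    rewrite -(PTB i s0 cP cG) -(PTZ t i s0 cQ) -(PTB i s0 cPG ctQ).
    apply: PT_bound => //; first exact: is_cvgB.
    by move=> k; exact: (PT_expand k (ltW t0) dG).
  have b1 := bcontD bS (bcontZ (-1) bG); have b2 := bcontD b1 (bcontZ (- t) bQ).
  have b3 : bcont (t ^+ 2 * C2) (fun s => (PT (t + s) G i + -1 * PT s G i) + - t * PT s (Qseq G) i).
    split; first by case: b2.
    by move=> s s0; rewrite mulN1r mulNr; exact: E.
  have := laplace_bound al0 b3.
  rewrite (laplaceD al0 b1 (bcontZ (- t) bQ)) (laplaceD al0 bS (bcontZ (-1) bG)).
  rewrite (laplaceZ _ al0 bQ) (laplaceZ _ al0 bG) mulN1r mulNr.
  set A := laplace al (fun s => PT (t + s) G i); set L := laplace al (fun t => PT t G i).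
  set B := laplace al _ => H.
  have -> : (A - L) / t - B = (A - L - t * B) / t by field; exact: lt0r_neq0.
  rewrite normrM normfV (gtr0_norm t0) ler_pdivrMr //; apply: (le_trans H).
  rewrite ler_pdivrMr // [leRHS]mulrAC expr2 -mulrA mulrC ler_wpM2r ?(ltW t0) //.
  rewrite ltr_pdivlMr in td; [nra|lra].
(* For H = al R_al G one has QH = al (H - G), so [base] applied to H reads H(i) = al times the
   transform of P_t G: the transform of H cancels. *)
have onD G : dom G -> laplace al (fun t => PT t G i) = RT al G i.
  move=> dG; have cG := dom_cvg dG; have [N N0 GN] := cvgn_bounded cG.
  have alV : 0 < al^-1 by rewrite invr_gt0.
  pose H := euler al^-1 G.
  have HE : H = fun k => al * RT al G k by apply/funext => k; rewrite /H /euler invrK.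
  have dH : dom H := euler_dom hab hs hadm alV cG.
  have QH : Qseq H = fun k => al * (H k - G k).
    by apply/funext => k; rewrite (euler_Qseq hab hs n g be alV k GN) invrK.
  have dQH : dom (Qseq H).
    by rewrite QH; apply: (domZ hab hs hadm); exact: (domB hab hs hadm).
  have [C1 _ HC1] := cvgn_bounded (dom_cvg dQH).
  have [_ cQQ _] := dQH; have [C2 _ HC2] := cvgn_bounded cQQ.
  have := base C1 C2 H (And4 dH dQH HC1 HC2).
  have cH := dom_cvg dH; have [N' _ HN'] := cvgn_bounded cH.
  have bH := PT_bcont i cH HN'; have bG := PT_bcont i cG GN.
  have -> : laplace al (fun t => PT t (Qseq H) i) =
      al * (laplace al (fun t => PT t H i) - laplace al (fun t => PT t G i)).
    rewrite -(laplaceB al0 bH bG) -(laplaceZ al al0 (bcontB bH bG)).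
    apply: eq_laplace => t t0; rewrite QH (PTZ al i t0 (is_cvgB cH cG)).
    by rewrite (PTB i t0 cH cG).
  rewrite mulrBr => /eqP; rewrite -subr_eq0 opprB addrC subrKA => /eqP E.
  apply: (mulfI (lt0r_neq0 al0)); have := congr1 (fun f => f i) HE; rewrite /= => <-.
  lra.
apply: (@eq_eps _ _ _ (2 / al)) => e e0.
have [F' dF' HF] := dom_dense hab hs hadm cF e0; have cF' := dom_cvg dF'.
have [M' _ FM'] := cvgn_bounded cF'; have cD : cvgn (fun k => F k - F' k) by exact: is_cvgB.
have H1 := laplace_bound al0 (PT_bcont i cD HF).
have H2 := RT_bound hab hs hadm al0 i HF.
rewrite (RTB hab hs hadm al0 i FM FM') in H2.
have E : laplace al (fun t => PT t (fun k => F k - F' k) i) =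
    laplace al (fun t => PT t F i) - laplace al (fun t => PT t F' i).
  rewrite -(laplaceB al0 (PT_bcont i cF FM) (PT_bcont i cF' FM')).
  by apply: eq_laplace => t t0; exact: PTB.
rewrite E (onD _ dF') in H1.
have -> : laplace al (fun t => PT t F i) - RT al F i =
   (laplace al (fun t => PT t F i) - RT al F' i) - (RT al F i - RT al F' i) by ring.
apply: (le_trans (ler_normB _ _)); have -> : 2 / al * e = e / al + e / al by ring.
exact: lerD.
Qed.

End semigroup_limit.

(** * The transition matrix of the semigroup *)

Section process_of_triple.
Context {R : realType} (a b : nat -> R).
Hypotheses (hab : rates a b) (hs : (sigma a b < +oo)%E).
Variables (n : nat -> R) (g be : R).
Hypothesis hadm : adm a b n g be.
Implicit Types (F G : nat -> R) (al c l M C e s t : R).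
Local Notation Qseq := (Qseq a b).
Local Notation RT := (RT a b n g be).
Local Notation PT := (PT a b n g be).

Definition pT t (i j : nat) : R := PT t (dlt j) i.
(** The indicator of the states from m on. Its limit is 1 for every m, so [PT] applied to it
    measures, as m grows, the mass located at infinity. *)
Definition tail_ind (m : nat) : nat -> R := fun k => 1 - trunc m (fun=> 1) k.

Lemma cvgn_dlt j : cvgn (dlt j : nat -> R).
Proof. by apply/cvg_ex; exists 0; exact: dlt_cvg0. Qed.
Arguments cvgn_dlt : clear implicits.

Lemma cvgn_trunc m F : cvgn (trunc m F).
Proof. by apply/cvg_ex; exists 0; exact: trunc_cvg0. Qed.
Arguments cvgn_trunc : clear implicits.

Lemma cvgn_cst c : cvgn (fun _ : nat => c).
Proof. exact: is_cvg_cst. Qed.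
Arguments cvgn_cst : clear implicits.

Lemma cvgn_tail m : cvgn (tail_ind m).
Proof. by apply: is_cvgB; [exact: cvgn_cst|exact: cvgn_trunc]. Qed.
Arguments cvgn_tail : clear implicits.

Lemma tail_ind01 m k : 0 <= tail_ind m k <= 1.
Proof. by rewrite /tail_ind /trunc; case: ifP => _; rewrite ?subrr ?subr0 ?lexx ?ler01. Qed.

Lemma PT_trunc t m F i : 0 <= t -> PT t (trunc m F) i = \sum_(0 <= j < m) pT t i j * F j.
Proof.
move=> t0; elim: m => [|m IH].
  rewrite big_geq //; have -> : trunc 0 F = fun=> 0 * 0 by apply/funext => k; rewrite mul0r.
  by rewrite (PTZ hab hs hadm 0 i t0 (cvgn_cst 0)) mul0r.
have -> : trunc m.+1 F = fun j => trunc m F j - (- F m) * dlt m j.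
  apply/funext => j; rewrite /trunc /dlt ltnS; case: ltngtP => [jm|mj|->] /=;
  by rewrite ?mulr0 ?mulr1 ?subr0 ?sub0r ?opprK.
rewrite (PTB hab hs hadm i t0 (cvgn_trunc m F) (is_cvgZr (cvgn_dlt m))).
by rewrite (PTZ hab hs hadm _ i t0 (cvgn_dlt m)) IH big_nat_recr //= mulNr opprK mulrC.
Qed.

Lemma pT_ge0 t i j : 0 <= t -> 0 <= pT t i j.
Proof.
move=> t0; apply: (PT_ge0 hab hs hadm i t0 (cvgn_dlt j)) => k.
by rewrite /dlt; case: eqP => _; rewrite ?ler01.
Qed.

Lemma PT_le t F G i : 0 <= t -> cvgn F -> cvgn G -> (forall k, F k <= G k) -> PT t F i <= PT t G i.
Proof.
move=> t0 cF cG FG; rewrite -subr_ge0 -(PTB hab hs hadm i t0 cG cF).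
by apply: (PT_ge0 hab hs hadm i t0 (is_cvgB cG cF)) => k; rewrite subr_ge0.
Qed.

Lemma PT_one_le1 t i : 0 <= t -> PT t (fun=> 1) i <= 1.
Proof.
move=> t0; apply: le_trans (ler_norm _) _.
by apply: (PT_bound hab hs hadm i t0 (cvgn_cst 1)) => k; rewrite normr1.
Qed.

Lemma pT_sum t i : 0 <= t -> asum (pT t i) /\ rsum (pT t i) <= 1.
Proof.
move=> t0; apply: asum_bound => [j|m]; first exact: pT_ge0.
have := PT_trunc m (fun=> 1) i t0; under eq_bigr do rewrite mulr1.
move=> <-; apply: le_trans (PT_one_le1 i t0).
apply: PT_le t0 (cvgn_trunc _ _) (cvgn_cst 1) _ => k.
by rewrite /trunc; case: ifP => _; rewrite ?ler01.
Qed.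

Lemma expN_bcont q : 0 <= q -> bcont 1 (fun s => expR (- (q * s))).
Proof.
move=> q0; split=> [e e0|s s0]; last first.
  by rewrite ger0_norm ?expR_ge0 // -expR0 ler_expR oppr_le0 mulr_ge0.
exists (e / (q + 1)) => [|s t]; first by rewrite divr_gt0; lra.
wlog st : s t / s <= t.
  move=> W s0 t0 std; have [st|/ltW ts] := leP s t; first exact: W.
  by rewrite distrC; apply: W => //; rewrite distrC.
move=> s0 t0; rewrite distrC (ger0_norm (_ : 0 <= t - s)) ?subr_ge0 // ltr_pdivlMr; last by lra.
move=> std; rewrite ger0_norm; last by rewrite subr_ge0 ler_expR lerN2 ler_wpM2l.
have -> : expR (- (q * t)) = expR (- (q * s)) * expR (- (q * (t - s))).
  by rewrite -expRD; congr expR; ring.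
have H1 := expR_ge1Dx (- (q * (t - s))); have H2 := expR_gt0 (- (q * s)).
have H3 : expR (- (q * s)) <= 1 by rewrite -expR0 ler_expR oppr_le0 mulr_ge0.
have H4 : 0 <= q * (t - s) by rewrite mulr_ge0 // subr_ge0.
have H5 : expR (- (q * s)) * (1 - expR (- (q * (t - s)))) <= 1 * (q * (t - s)).
  have H6 : expR (- (q * (t - s))) <= 1 by rewrite -expR0 ler_expR oppr_le0.
  by apply: ler_pM H3 _; lra.
have : 0 <= t - s by rewrite subr_ge0.
lra.
Qed.

Lemma laplace_expN al q : 0 < al -> 0 <= q -> laplace al (fun s => expR (- (q * s))) = (al + q)^-1.
Proof.
move=> al0 q0; rewrite -[RHS]mul1r -laplace_cst ?ltr_wpDr //.
apply: eq_Rintegral => s _; rewrite mulr1 -expRD; congr expR; ring.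
Qed.

(* A mass of PT t at infinity would survive for a positive amount of time and be
   charged by the resolvent, which is a kernel on nat. *)
Lemma PT_tail t i : 0 <= t -> (fun m => PT t (tail_ind m) i) @ \oo --> (0 : R).
Proof.
rewrite le_eqVlt => /predU1P[<-|t0].
  under eq_fun do rewrite (PT_0 a b n g be).
  apply/cvgn_epsP => e e0; exists i.+1 => m im.
  by rewrite /tail_ind /trunc im !subrr normr0 ltW.
have q0 := q_gt0 hab i; set q := a i + b i in q0.
have one (k : nat) : `|1 : R| <= 1 by rewrite normr1.
have hM m k : `|tail_ind m k| <= 1.
  by have /andP[h0 h1] := tail_ind01 m k; rewrite ger0_norm.
(* By [PT_low], P_(t+s) of the tail is at least exp(- q s) times P_t of it. Integrating against
   exp(- s) gives the factor 1 / (1 + q), and undoing the shift by t costs exp t. *)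
have low m : PT t (tail_ind m) i <= (1 + q) * (expR (1 * t) * RT 1 (tail_ind m) i).
  have bh := PT_bcont hab hs hadm i (cvgn_tail m) (hM m).
  have P0 s : 0 <= s -> 0 <= PT s (tail_ind m) i.
    move=> s0; apply: (PT_ge0 hab hs hadm i s0 (cvgn_tail m)) => k.
    by have /andP[] := tail_ind01 m k.
  have := laplace_shift_le ltr01 t0 bh P0.
  rewrite (laplace_PT hab hs hadm i ltr01 (cvgn_tail m)) => H1.
  have bs := bcont_shift (ltW t0) bh.
  have be1 := bcontZ (PT t (tail_ind m) i) (expN_bcont (ltW q0)).
  have H2 : laplace 1 (fun s => PT t (tail_ind m) i * expR (- (q * s))) <=
      laplace 1 (fun s => PT (t + s) (tail_ind m) i).
    apply: (le_laplace ltr01 be1 bs) => s s0.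
    rewrite (addrC t s) (PT_semigroup hab hs hadm i s0 (ltW t0) (cvgn_tail m)) mulrC.
    apply: (PT_low hab hs hadm i s0); first exact: (PT_cvgn hab hs hadm (ltW t0) (cvgn_tail m)).
    move=> k; apply: (PT_ge0 hab hs hadm k (ltW t0) (cvgn_tail m)) => j.
    by have /andP[] := tail_ind01 m j.
  rewrite (laplaceZ _ ltr01 (expN_bcont (ltW q0))) laplace_expN ?(ltW q0) // in H2.
  have q1 : 0 < 1 + q by rewrite addr_gt0.
  move: H2; rewrite ler_pdivrMr // => H2.
  by apply: (le_trans H2); rewrite mulrC ler_wpM2l // ltW.
(* [RT] is given by a summable kernel on nat, hence the tails tend to 0. *)
have R0 : (fun m => RT 1 (tail_ind m) i) @ \oo --> (0 : R).
  have E m : RT 1 (tail_ind m) i = RT 1 (fun=> 1) i - \sum_(0 <= j < m) RT 1 (dlt j) i * 1.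
    rewrite /tail_ind (RTB hab hs hadm ltr01 i one (fun k => trunc_norm m k one)); congr (_ - _).
    have [_ ->] := RT_rsum hab hs hadm ltr01 i (fun k => trunc_norm m k one).
    have [|_ ->] := @rsum_fin _ (fun j => RT 1 (dlt j) i * trunc m (fun=> 1) j) m.
      by move=> k mk; rewrite /trunc ltnNge mk mulr0.
    rewrite big_nat_cond [RHS]big_nat_cond; apply: eq_bigr => k /andP[/andP[_ km] _].
    by rewrite /trunc km.
  have [c E2] := RT_rsum hab hs hadm ltr01 i one.
  rewrite (funext E) -[X in _ --> X](subrr (RT 1 (fun=> 1) i)).
  by apply: cvgB; [exact: cvg_cst|rewrite E2; exact: rsum_cvg].
apply: (@squeeze_cvgr _ _ _ _ (fun=> 0) (fun m => (1 + q) * (expR (1 * t) * RT 1 (tail_ind m) i))).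
- apply: nearW => m; rewrite low andbT.
  apply: (PT_ge0 hab hs hadm i (ltW t0) (cvgn_tail m)) => k.
  by have /andP[] := tail_ind01 m k.
- exact: cvg_cst.
- by rewrite -[X in _ --> X](mulr0 (1 + q)) -[in X in _ --> X](mulr0 (expR (1 * t))); do 2 apply: cvgZr.
Qed.

(** The error of truncating F at m is at most M [tail_ind m], whose image vanishes by [PT_tail]: the
    operator is thus given by the matrix [pT]. *)
Lemma PT_rsum t F i : 0 <= t -> cvgn F ->
  series (fun j => pT t i j * F j) @ \oo --> PT t F i.
Proof.
move=> t0 cF; have [M M0 FM] := cvgn_bounded cF.
have -> : series (fun j => pT t i j * F j) = fun m => PT t (trunc m F) i.
  by apply/funext => m; rewrite PT_trunc.
apply/cvgn_epsP => e e0.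
have /cvgn_epsP/(_ (e / (M + 1)) _)[|N HN] := PT_tail i t0; first by rewrite divr_gt0; lra.
exists N => m Nm; have := HN m Nm; rewrite subr0 => H.
have cT := cvgn_trunc m F; have cD : cvgn (fun k => F k - trunc m F k) by exact: is_cvgB.
have MT : cvgn (fun k => M * tail_ind m k) by apply: is_cvgZr; exact: cvgn_tail.
have MT' : cvgn (fun k => (- M) * tail_ind m k) by apply: is_cvgZr; exact: cvgn_tail.
have B k : `|F k - trunc m F k| <= M * tail_ind m k.
  rewrite /tail_ind /trunc; case: ifP => _; first by rewrite !subrr normr0 mulr0.
  by rewrite !subr0 mulr1.
rewrite distrC -(PTB hab hs hadm i t0 cF cT).
apply: (@le_trans _ _ (M * PT t (tail_ind m) i)).
  rewrite ler_norml -mulNr -!(PTZ hab hs hadm _ i t0 (cvgn_tail m)).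
  by apply/andP; split; apply: PT_le => // k; have := B k; rewrite ler_norml ?mulNr => /andP[].
apply: (le_trans (ler_wpM2l M0 (le_trans (ler_norm _) H))).
by rewrite mulrA ler_pdivrMr; [nra|lra].
Qed.

(** It is needed for F = dlt j, in general outside the domain. The bound [small] controls the
    quotient of F - F' at the state i by the sup norm, so F may be replaced by a close F' in [dom2],
    where [PT_expand] applies. *)
Lemma PT_deriv F i : cvgn F -> (PT t F i - F i) / t @[t --> 0^'+] --> Qseq F i.
Proof.
move=> cF; have q0 := q_gt0 hab i; set q := a i + b i in q0.
have small G M t : 0 < t -> cvgn G -> (forall k, `|G k| <= M) -> `|PT t G i - G i| <= 2 * M * q * t.
  move=> t0 cG GM; have M0 : 0 <= M by exact: le_trans (GM 0%N).
  have H0 : 1 - q * t <= expR (- (q * t)) by exact: expR_ge1Dx.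
  (* Persistence at i ([PT_low]) for the nonnegative sequence H + M gives the lower bound; the upper
     one follows with - G in place of G. *)
  have one H : cvgn H -> (forall k, `|H k| <= M) -> - (2 * M * q * t) <= PT t H i - H i.
    move=> cH HM; have cHM : cvgn (fun k => H k - (- M) * 1).
      by apply: is_cvgB => //; exact: is_cvg_cst.
    have cM : cvgn (fun _ : nat => - M * 1) by exact: is_cvg_cst.
    have := PT_low hab hs hadm i (ltW t0) cHM.
    rewrite (PTB hab hs hadm i (ltW t0) cH cM) (PTZ hab hs hadm (- M) i (ltW t0) (cvgn_cst 1)).
    have := PT_one_le1 i (ltW t0); have := HM i; rewrite ler_norml => /andP[h1 h2] h3.
    move=> /(_ _)/wrap[k|]; first by have := HM k; rewrite ler_norml => /andP[]; lra.
    rewrite -/q => h4.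
    have h5 : (1 - q * t) * (H i - - M * 1) <= expR (- (q * t)) * (H i - - M * 1).
      by rewrite ler_wpM2r //; lra.
    have h6 : q * t * (H i + M) <= q * t * (2 * M).
      by rewrite ler_wpM2l ?mulr_ge0 ?(ltW q0) ?(ltW t0) //; lra.
    have h7 : M * PT t (fun=> 1) i <= M * 1 by rewrite ler_wpM2l.
    lra.
  rewrite ler_norml (one _ cG GM) /=.
  have cN : cvgn (fun k => (-1) * G k) by exact: is_cvgZr.
  have := one _ cN; rewrite (PTZ hab hs hadm (-1) i (ltW t0) cG) => /(_ _)/wrap[k|].
    by rewrite normrM normrN1 mul1r.
  by rewrite !mulN1r; lra.
apply/cvg_right0_epsP => e e0.
pose d := e / (8 * (q + 1)); have d0 : 0 < d by rewrite divr_gt0 // mulr_gt0; lra.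
have dq : d * q <= e / 8.
  by rewrite /d mulrAC ler_pdivrMr ?mulr_gt0 //; [nra|lra].
have [C1 [C2 [F' dF' HF]]] := dom2_dense hab hs hadm cF d0.
have [dF0 _ QC1 QC2] := dF'; have cF' := dom_cvg dF0.
have C20 : 0 <= C2 by exact: le_trans (QC2 0%N).
exists (e / 4 / (C2 + 1)) => [|t t0]; first by rewrite divr_gt0; lra.
rewrite ltr_pdivlMr; last by lra.
move=> te; have cD : cvgn (fun k => F k - F' k) by exact: is_cvgB.
have H1 := small _ _ t t0 cD HF; rewrite (PTB hab hs hadm i (ltW t0) cF cF') in H1.
have H2 := PT_expand hab hs hadm i (ltW t0) dF'.
have H3 := Qseq_bound hab i HF; rewrite QseqB -/q in H3.
have -> : (PT t F i - F i) / t - Qseq F i =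
   ((PT t F i - PT t F' i - (F i - F' i)) + (PT t F' i - F' i - t * Qseq F' i)
     - t * (Qseq F i - Qseq F' i)) / t by field; exact: lt0r_neq0.
rewrite normrM normfV (gtr0_norm t0) ler_pdivrMr //.
apply: (le_trans (ler_normB _ _)); apply: (le_trans (lerD (ler_normD _ _) (lexx _))).
rewrite [X in _ + X]normrM (gtr0_norm t0).
have H4 : t * `|Qseq F i - Qseq F' i| <= t * (2 * q * d) by rewrite ler_pM2l.
have H5 : t * (d * q) <= t * (e / 8) by rewrite ler_pM2l.
have H6 : t * (t * (C2 + 1)) <= t * (e / 4) by rewrite ler_pM2l // ltW.
have H7 : 0 <= t * t by rewrite mulr_ge0 // ltW.
rewrite expr2 in H2. have H8 : 0 <= e * t by rewrite mulr_ge0 // ltW.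
lra.
Qed.

Lemma pT_process : Q_process a b pT.
Proof.
have p0 t i j : 0 <= t -> 0 <= pT t i j by move=> ?; exact: pT_ge0.
have p_0 i j : pT 0 i j = dlt j i by rewrite /pT (PT_0 a b n g be).
split.
- split=> [t i j|t i t0|i j|s t i j s0 t0]; first exact: p0.
  + by have [c H] := pT_sum i t0; rewrite esum_asum // ?lee_fin // => j; exact: p0.
  + by rewrite p_0.
  + have cP := PT_cvgn hab hs hadm t0 (cvgn_dlt j).
    have L := PT_rsum (i := i) s0 cP.
    have c : asum (fun k => pT s i k * pT t k j).
      have [cs _] := pT_sum i s0; apply: (asum_mulr (M := 1)) => // k.
      have [ct Ht] := pT_sum k t0; rewrite ger0_norm ?p0 //.
      by apply: le_trans Ht; apply: rsum_term => // l; exact: p0.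
    rewrite esum_asum //; last by move=> k; rewrite mulr_ge0 ?p0.
    congr EFin; rewrite /pT (PT_semigroup hab hs hadm i s0 t0 (cvgn_dlt j)).
    by rewrite -(rsum_eq L).
- move=> i j; apply/cvg_right0_epsP => e e0.
  have [d d0 H] := PT_strong hab hs hadm (cvgn_dlt j) e0.
  by exists d => // t t0 td; exact: H (ltW t0) td i.
- move=> i j; rewrite p_0.
  have := PT_deriv (i := i) (cvgn_dlt j); have -> : Qseq (dlt j) i = Qmatrix a b i j => //.
  rewrite -(sum_Qmatrix hab); have [ij|ij] := ltnP j i.+2.
    have jm : j \in index_iota 0 i.+2 by rewrite mem_index_iota.
    rewrite (bigD1_seq j jm (iota_uniq _ _)) /= /dlt eqxx mulr1.
    by rewrite big1 ?addr0 // => k kj; rewrite (negbTE kj) mulr0.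
  rewrite big_nat_cond big1 => [|k /andP[/andP[_ ki] _]].
    by rewrite /Qmatrix; do 3 (case: eqP => [|_]; first by lia).
  by rewrite /dlt ltn_eqF ?mulr0 //; exact: leq_trans ki ij.
Qed.

Lemma pT_resolvent al i j : 0 < al -> resolvent pT al i j = RT al (dlt j) i.
Proof. by move=> al0; rewrite -(laplace_PT hab hs hadm i al0 (cvgn_dlt j)). Qed.

Lemma RR_pT al G M i : 0 < al -> (forall k, `|G k| <= M) -> RR pT al G i = RT al G i.
Proof.
move=> al0 GM; rewrite (RR_rsum pT_process i al0 GM).
have [_ ->] := RT_rsum hab hs hadm al0 i GM.
by congr rsum; apply/funext => j; rewrite pT_resolvent.
Qed.

Lemma pT_rr al j : 0 < al ->
  rr pT al j = numer a b n be al j / denom a b n g be al.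
Proof.
move=> al0; have dM := @dlt_norm R j.
rewrite /rr (funext (fun i => RR_pT i al0 dM)).
rewrite (cvg_lim _ (RT_cvg hab hs (n := n) (g := g) (be := be) al0 dM)) // /ell; congr (_ / _).
have [|_ ->] := @rsum_single _ (fun k => numer a b n be al k * dlt j k) j.
  by move=> k kj; rewrite /dlt (negbTE kj) mulr0.
by rewrite /dlt eqxx mulr1.
Qed.

(** al R_al G is an Euler step of size 1 / al, uniformly close to G for large al; the estimate
    passes to the limit of the states. *)
Lemma pT_nonbranching G : cvgn G -> al * limn (RR pT al G) @[al --> +oo] --> limn G.
Proof.
move=> cG; have [M M0 GM] := cvgn_bounded cG; apply/cvg_pinfty_epsP => e e0.
have [G' dG' HG] := dom_dense hab hs hadm cG (e := e / 4) ltac:(lra).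
have [cG' cQ _] := dG'; have [C C0 QC] := cvgn_bounded cQ.
exists ((C + 1) / (e / 4)) => al Aal.
have A0 : 0 < (C + 1) / (e / 4) by rewrite divr_gt0; lra.
have al0 : 0 < al by exact: lt_trans Aal.
have alV : 0 < al^-1 by rewrite invr_gt0.
have HJ k : `|al * RT al G k - G k| <= e.
  have [M' _ GM'] := cvgn_bounded cG'.
  have := euler_bound hab hs hadm alV k HG; rewrite (eulerB hab hs hadm alV k GM GM').
  have := euler_near hab hs hadm k alV dG' QC; rewrite /euler invrK => H1 H2.
  have H3 : al^-1 * C <= e / 4.
    rewrite mulrC ler_pdivrMr // mulrC -ler_pdivrMr; last by lra.
    by apply: le_trans (ltW Aal); rewrite ler_pM2r ?invr_gt0; lra.
  have H4 := HG k.
  have -> : al * RT al G k - G k = (al * RT al G k - al * RT al G' k) - (G k - G' k) +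
     (al * RT al G' k - G' k) + 0 by ring.
  apply: (le_trans (ler_norm4 H2 H4 H1 (D := 0) _)); first by rewrite normr0.
  lra.
have E : RR pT al G = RT al G by apply/funext => k; exact: RR_pT GM.
have L := RT_cvg hab hs (n := n) (g := g) (be := be) al0 GM.
rewrite E (cvg_lim _ L) //.
have L2 : (fun k => `|al * RT al G k - G k|) @ \oo --> `|al * ell a b n g be al G - limn G|.
  by apply: cvg_norm; apply: cvgB; [apply: cvgZr; exact: L|exact: cG].
apply: (cvgn_le_lim L2 (cvg_cst e)) => k; exact: HJ.
Qed.

End process_of_triple.

(** * The triple of a generator *)

Section triple_of_generator.
Context {R : realType} (a b : nat -> R) (p : R -> nat -> nat -> R).
Hypotheses (hab : rates a b) (hs : (sigma a b < +oo)%E) (hp : Q_process a b p).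
Hypothesis hF : forall G, cvgn G -> al * limn (RR p al G) @[al --> +oo] --> limn G.
Implicit Types (F G H : nat -> R) (al c l M N e : R).
Local Notation Qseq := (Qseq a b).
Local Notation mu := (mu a b).
Local Notation tl := (tl a b).
Local Notation uu := (uu a b 1).
Local Notation Phi := (Phi a b 1).
Local Notation PhiO := (PhiO a b 1).
Local Notation r := (rr p 1).

Let x j := r j / mu j.

Definition jump_weight k : R := mu k * (x k - Qseq x k).
Local Notation n := jump_weight.

Let r_ge0 j : 0 <= r j := rr_ge0 hab hs hp j ltr01.
Let r_asum : asum r := (rr_asum hab hs hp ltr01).1.
Let r_le1 : rsum r <= 1. Proof. by have [_] := rr_asum hab hs hp ltr01; rewrite mul1r. Qed.
Let mu0 k : 0 < mu k := mu_gt0 hab k.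

Let x_ge0 j : 0 <= x j. Proof. by rewrite divr_ge0 // ltW. Qed.

(* By detailed balance, n is the negative of the boundary functional on dlt k. *)
Lemma jump_weight_dlt k :
  rsum (fun j => r j * (1 * dlt k j - Qseq (dlt k) j)) = n k.
Proof.
have rx j : r j = mu j * x j by rewrite mulrC divfK // gt_eqF.
have far j : (k.+1 < j)%N -> r j * (1 * dlt k j - Qseq (dlt k) j) = 0.
  move=> kj; rewrite Qseq_dlt /dlt.
  have [-> -> ->] : [/\ (j == k.+1) = false, (j == k) = false & (j.+1 == k) = false].
    by split; lia.
  by rewrite !mulr0 subrr addr0 subrr mulr0.
have [_ ->] := rsum_fin far; rewrite /n /=.
rewrite big_nat_recr //= !rx; case: k far => [|k] far.
  have := muS hab 0; rewrite big_nat1 !rx !Qseq_dlt /dlt /Qseq !eqxx /= => E.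
  have {}E := congr1 ( *%R^~ (x 1%N)) E; rewrite /= in E; rewrite (a0 hab); lra.
rewrite !big_nat_recr //= !rx !Qseq_dlt big_nat_cond big1 => [|j /andP[/andP[_ jk] _]].
  have /= E1 := congr1 ( *%R^~ (x k)) (muS hab k).
  have /= E2 := congr1 ( *%R^~ (x k.+2)) (muS hab k.+1).
  rewrite /dlt /Qseq !eqxx.
  have [-> -> ->] : [/\ (k == k.+2) = false, (k == k.+1) = false & (k.+1 == k.+2) = false].
    by split; lia.
  have [-> ->] : (k.+2 == k.+1) = false /\ (k.+3 == k.+1) = false.
    by split; lia.
  rewrite /=; move: E1 E2; lra.
rewrite Qseq_dlt /dlt.
have [-> -> ->] : [/\ (j == k.+2) = false, (j == k.+1) = false & (j.+1 == k.+1) = false].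
  by split; lia.
by rewrite !mulr0 subrr addr0 subrr mulr0.
Qed.

Lemma jump_weight_ge0 k : 0 <= n k.
Proof.
rewrite -jump_weight_dlt; apply: (rr_min hab hs hp hF ltr01 (dlt_cvg0 k)).
  apply/cvgn_epsP => e e0; exists k.+2 => j kj; rewrite subr0.
  rewrite Qseq_dlt.
  have [-> -> ->] : [/\ (j == k.+1) = false, (j == k) = false & (j.+1 == k) = false].
    by split; lia.
  by rewrite !mulr0 subrr addr0 normr0 ltW.
by move=> j; rewrite /dlt; case: eqP => _; rewrite ?ler01.
Qed.

Let w k := x k - Qseq x k.

Let w_ge0 k : 0 <= w k.
Proof. by have := jump_weight_ge0 k; rewrite /n pmulr_rge0. Qed.

(** Truncating the charge w makes its potential vanish at infinity, while x is merely nonnegative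
    there; al - Q maps the difference to the untruncated rest of w, which is nonnegative. *)
Let PhiO_le_x m j : PhiO (trunc m w) j <= x j.
Proof.
have [M HM] : exists M, forall k, `|trunc m w k| <= M.
  have [M M0 H] := cvgn_bounded (@cvgn_trunc _ m w); by exists M.
rewrite -subr_ge0; move: j; apply: (maxp_liminf hab ltr01) => [e e0|k].
  have /cvgn_epsP/(_ e e0)[N HN] := PhiO_cvg0 hab hs ltr01 HM.
  exists N => k /HN; rewrite subr0 ler_norml => /andP[_ H]; have := x_ge0 k; lra.
rewrite QseqB (PhiO_eq hab hs ltr01 k HM) !mul1r.
have -> : x k - PhiO (trunc m w) k - (Qseq x k - (PhiO (trunc m w) k - trunc m w k)) = w k - trunc m w k.
  by rewrite /w; ring.
by rewrite /trunc; case: ifP => _; rewrite ?subrr ?subr0 ?w_ge0.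
Qed.

Let PhiO_trunc m j : PhiO (trunc m w) j * mu j = \sum_(0 <= k < m) n k * Phi k j.
Proof.
rewrite /PhiO.
have [|_ ->] := @rsum_fin _ (fun k => Phi j k * trunc m w k) m.
  by move=> k mk; rewrite /trunc ltnNge mk mulr0.
rewrite big_distrl /= big_nat_cond [RHS]big_nat_cond; apply: eq_bigr => k /andP[/andP[_ km] _].
by rewrite /trunc km /n -/(w k) mulrAC [_ * mu j]mulrC Phi_sym; ring.
Qed.

Lemma nPhi_sum j : asum (fun k => n k * Phi k j) /\ rsum (fun k => n k * Phi k j) <= r j.
Proof.
apply: asum_bound => [k|m]; first by rewrite mulr_ge0 ?jump_weight_ge0 ?(Phi_ge0 hab hs ltr01).
by rewrite -PhiO_trunc -[r j](divfK (lt0r_neq0 (mu0 j))) ler_pM2r // PhiO_le_x.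
Qed.

(** The harmonic part of x: nonnegative and solving Qy = y, hence a multiple of u, whose coefficient
    is beta. *)
Let y j := x j - rsum (fun k => Phi j k * w k).

Let asum_Phiw j : asum (fun k => Phi j k * w k).
Proof.
have [c _] := nPhi_sum j; have := asumZ (c := (mu j)^-1) c; congr asum; apply/funext => k.
rewrite /n -/(w k) mulrAC Phi_sym; field; exact: lt0r_neq0.
Qed.

Let y_ge0 j : 0 <= y j.
Proof.
rewrite subr_ge0; apply: (asum_bound (M := x j) _ _).2 => [k|m]; first by rewrite mulr_ge0 ?w_ge0 ?(Phi_ge0 hab hs ltr01).
have := PhiO_le_x m j; congr (_ <= _).
rewrite /PhiO.
have [|_ ->] := @rsum_fin _ (fun k => Phi j k * trunc m w k) m.
  by move=> k mk; rewrite /trunc ltnNge mk mulr0.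
rewrite big_nat_cond [RHS]big_nat_cond; apply: eq_bigr => k /andP[/andP[_ km] _].
by rewrite /trunc km.
Qed.

Let y_eq j : Qseq y j = 1 * y j.
Proof.
have [c E] := Qseq_rsum a b (h := fun i k => Phi i k * w k) j asum_Phiw.
rewrite /y QseqB E mul1r.
have -> : (fun k => Qseq (fun i => Phi i k * w k) j) =
    fun k => Phi j k * w k - (if k == j then w j else 0).
  apply/funext => k; under [in LHS](eq_fun : _) do idtac.
  have -> : (fun i => Phi i k * w k) = fun i => w k * Phi i k by apply/funext => i; rewrite mulrC.
  rewrite QseqZ (Phi_eq hab ltr01) mul1r /dlt eq_sym mulrBr mulrC.
  by case: eqP => [->|_]; rewrite ?mulr1 ?mulr0.
have [|c1 E1] := @rsum_single _ (fun k => if k == j then w j else 0) j.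
  by move=> k /negbTE ->.
by rewrite (rsumB (@asum_Phiw j) c1) E1 eqxx /w; ring.
Qed.

Definition diffusion_weight : R := y 0%N / uu 0%N.
Local Notation be := diffusion_weight.

Lemma diffusion_weight_ge0 : 0 <= be.
Proof. by rewrite divr_ge0 ?y_ge0 // ltW // uu_gt0. Qed.

(** Convergence of y is not known here, so both solutions are compared through their values at 0 by
    [ker_vv]. *)
Let y_uu j : y j = be * uu j.
Proof.
rewrite (ker_vv hab y_eq) (ker_vv hab (uu_eq hab 1) j) /be mulrA divfK //.
by rewrite gt_eqF // uu_gt0.
Qed.

Lemma rr_numer j : r j = numer a b n be 1 j.
Proof.
rewrite /numer mulrCA -y_uu /y mulrBr mulrC divfK ?gt_eqF //.
rewrite -rsumZ; last exact: asum_Phiw.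
have -> : (fun k => mu j * (Phi j k * w k)) = fun k => n k * Phi k j.
  by apply/funext => k; rewrite /n -/(w k) mulrA -Phi_sym; ring.
by rewrite addrC subrK.
Qed.

Lemma rr_bmuu j : be * (mu j * uu j) <= r j.
Proof.
rewrite rr_numer /numer lerDr; have [c _] := nPhi_sum j; apply: rsum_ge0 c _ => k.
by rewrite mulr_ge0 ?jump_weight_ge0 ?Phi_ge0.
Qed.

(** 1 - u_k is the sum over j of Phi_kj; exchanging the sums bounds the total by the sum of the
    r_j. *)
Lemma asum_n1u : asum (fun k => n k * (1 - uu k)).
Proof.
have n0 := jump_weight_ge0.
apply: (asum_bound (M := rsum r) _ _).1 => [k|m].
  by rewrite mulr_ge0 ?u1_ge0.
have cP k : asum (fun j => n k * Phi k j) by apply: asumZ; exact: (Phi_asum hab hs ltr01 k).1.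
have -> : \sum_(0 <= k < m) n k * (1 - uu k) = \sum_(0 <= k < m) rsum (fun j => n k * Phi k j).
  apply: eq_bigr => k _; rewrite rsumZ -?(Phi_rsum hab hs ltr01) ?mul1r //.
  exact: (Phi_asum hab hs ltr01 k).1.
have [c <-] := asum_sum m cP; apply: ler_rsum => // j.
have [cj H] := nPhi_sum j; apply: le_trans H; apply: rsum_part => // k.
by rewrite mulr_ge0 ?Phi_ge0.
Qed.

Lemma asum_ntl : asum (fun k => n k * tl k).
Proof.
apply: asum_dom (asumZ (c := (2 * uu 0%N)^-1) asum_n1u) _ => k.
have u0 := uu_gt0 hab hs ltr01 0; have n0 := jump_weight_ge0 k.
have H := uu_tl_ge hab hs ltr01 k; rewrite mulr1 in H.
have u20 : 0 < 2 * uu 0 by rewrite mulr_gt0.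
rewrite (ger0_norm (mulr_ge0 n0 (tl_ge0 hab hs k))) ger0_norm; last first.
  by rewrite mulr_ge0 ?invr_ge0 ?(ltW u20) // mulr_ge0 // subr_ge0 uu_le1.
by rewrite ler_pdivlMl // mulrCA ler_wpM2l.
Qed.

(** be mu_k u_0 <= be mu_k u_k <= r_k, and the weights r are summable. *)
Lemma asum_mu_be : 0 < be -> asum mu.
Proof.
move=> be0; have u0 := uu_gt0 hab hs ltr01 0.
apply: asum_dom (asumZ (c := (be * uu 0%N)^-1) r_asum) _ => k.
have H := rr_bmuu k; rewrite ger0_norm ?(ltW (mu0 k)) // ger0_norm; last first.
  by rewrite mulr_ge0 // invr_ge0 mulr_ge0 // ltW.
rewrite (ler_pdivlMl _ _ (mulr_gt0 be0 u0)); apply: le_trans _ H.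
by rewrite -mulrA ler_pM2l // mulrC ler_pM2l //; apply: uu_nd.
Qed.

Lemma active : ~ asum n \/ 0 < be.
Proof.
have [be0|be0] := ltP 0 be; first by right.
have {}be0 : be = 0 by apply/eqP; rewrite eq_le be0 diffusion_weight_ge0.
left => cn; have n0 := jump_weight_ge0.
have L G : cvgn G -> limn (RR p 1 G) = rsum (fun k => n k * PhiO G k).
  move=> cG; have [M M0 GM] := cvgn_bounded cG.
  rewrite (RR_limn hab hs hp ltr01 GM).
  have cF k : asum (fun j => n k * (Phi k j * G j)) by apply: asumZ; exact: PhiO_asum GM.
  have cg := asumZ (c := M) cn.
  have -> : (fun k => n k * PhiO G k) = fun k => rsum (fun j => n k * (Phi k j * G j)).
    by apply/funext => k; rewrite rsumZ //; exact: PhiO_asum GM.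
  have [k|_ _ <-] := rsum_fubini cg cF.
    have c := PhiO_asum hab hs ltr01 (i := k) GM.
    under [X in rsum X]eq_fun do rewrite normrM.
    rewrite rsumZ; last exact: asum_norm.
    rewrite (ger0_norm (n0 k)) mulrC ler_wpM2r //.
    have [cP HP] := Phi_asum hab hs ltr01 k; rewrite mul1r in HP.
    apply: (@le_trans _ _ (rsum (fun j => M * Phi k j))).
      apply: ler_rsum; [exact: asum_norm|exact: asumZ|move=> j].
      by rewrite normrM mulrC (ger0_norm (Phi_ge0 hab hs ltr01 _ _)) ler_wpM2r ?Phi_ge0.
    rewrite rsumZ // -[leRHS]mulr1 ler_wpM2l //; apply: (le_trans HP).
    by rewrite gerBl ltW // uu_gt0.
  congr rsum; apply/funext => j; rewrite rr_numer /numer be0 mul0r addr0 mulrC -rsumZ.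
    by congr rsum; apply/funext => k; ring.
  by have [] := nPhi_sum j.
have S0 : 0 <= rsum n by exact: rsum_ge0.
(* F = al R_al u is in the domain and within e of u. So Phi G = (F - u) - (F(oo) - 1) u is at most 2
   e, whence |F(oo)| <= 2 e |nu|, while |F(oo) - 1| <= e. This is impossible because e (1 + |nu|) =
   1/4. *)
pose e := (4 * (1 + rsum n))^-1; have e0 : 0 < e by rewrite invr_gt0 mulr_gt0 // ltr_pwDl.
have cu : cvgn uu by apply/cvg_ex; exists 1; exact: uu_cvg.
have [al al0 H] := RR_strong hab hs hp hF cu e0.
pose F k := al * RR p al uu k.
have uM := uu_norm hab hs ltr01.
have cR := RR_cvgn hab hs hp al0 uM.
have RM := RR_bounded hp al0 uM.
have cF : cvgn F by exact: is_cvgZr.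
pose G k := 1 * F k - Qseq F k.
have QF k : Qseq F k = al * (F k - uu k).
  by rewrite /F QseqZ (RR_gen hab hp k al0 uM).
have cQF : cvgn (Qseq F).
  by rewrite (funext QF); apply: is_cvgZr; exact: is_cvgB.
have cG : cvgn G by apply: is_cvgB => //; exact: is_cvgZr.
have [N N0 GN] := cvgn_bounded cG.
have gF : gen p F (Qseq F).
  apply/(gen_iff hab hs hp hF al0 cF cQF); split=> //.
  have -> : (fun j => rr p al j * (al * F j - Qseq F j)) = fun j => al * (rr p al j * uu j).
    by apply/funext => j; rewrite QF; ring.
  rewrite rsumZ -?(RR_limn hab hs hp al0 uM); last exact: (rr_mul_asum hab hs hp al0 uM).
  by apply/cvg_lim => //; apply: cvgZr; exact: cR.
have [_ E] := (gen_iff hab hs hp hF ltr01 cF cQF).1 gF.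
rewrite -(RR_limn hab hs hp ltr01 GN) L // in E.
have FE := PhiO_unique hab hs ltr01 cF GN (fun=> erefl).
have lF : `|limn F - 1| <= e.
  have c : (fun k => F k - uu k) @ \oo --> limn F - 1 by apply: cvgB; [exact: cF|exact: uu_cvg].
  by rewrite -(cvg_lim _ c) //; apply: limn_norm_le H; apply/cvg_ex; eexists; exact: c.
have : `|limn F| <= 2 * e * rsum n.
  rewrite E -rsumZ //; apply: rsum_norm => [|k]; first exact: asumZ.
  rewrite normrM (ger0_norm (n0 k)) mulrC ler_wpM2r //.
  have -> : PhiO G k = (F k - uu k) - (limn F - 1) * uu k by rewrite (FE k); ring.
  apply: (le_trans (ler_normB _ _)); rewrite normrM.
  have := H k; have := uM k; have := normr_ge0 (limn F - 1); nra.
have eS : e * (1 + rsum n) = 4^-1.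
  by rewrite /e; field; lra.
move: lF; rewrite !ler_norml => /andP[h1 h2] /andP[h3 h4]; lra.
Qed.

(** Since the numerators at al = 1 are the r_j themselves, the denominator has to be 1, and
    [numer_asum] then leaves 1 - sum r_j for gamma. *)
Lemma triple_of_generator : exists2 g, adm a b n g be & denom a b n g be 1 = 1.
Proof.
have A : adm a b n (1 - rsum r) be.
  split; [exact: jump_weight_ge0| | exact: asum_ntl | exact: asum_mu_be| exact: active].
  by rewrite subr_ge0 r_le1 diffusion_weight_ge0.
exists (1 - rsum r) => //.
have [_] := numer_asum hab hs A ltr01; rewrite mul1r -(funext rr_numer); lra.
Qed.

End triple_of_generator.

(** * The boundary condition of a generator *)

Section generator_boundary.
Context {R : realType} (a b : nat -> R) (p : R -> nat -> nat -> R).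
Hypotheses (hab : rates a b) (hs : (sigma a b < +oo)%E) (hp : Q_process a b p).
Hypothesis hF : forall G, cvgn G -> al * limn (RR p al G) @[al --> +oo] --> limn G.

(** If r = numer / denom for one al, then BC F is denom times the functional of [gen_iff], so both
    have the same kernel. It serves for a given process as well as for the constructed one. *)
Lemma gen_BC n g be al F G : adm a b n g be -> 0 < al ->
  (forall j, rr p al j = numer a b n be al j / denom a b n g be al) ->
  cvgn F -> cvgn G ->
  gen p F G <-> (forall i, G i = Qseq a b F i) /\ BC a b n g be F = 0.
Proof.
move=> hadm al0 hr cF cG; rewrite (gen_iff hab hs hp hF al0 cF cG).
have d0 := denom_gt0 hab hs hadm al0.
have E : (forall i, G i = Qseq a b F i) -> BC a b n g be F = denom a b n g be al *
    (limn F - rsum (fun j => rr p al j * (al * F j - Qseq a b F j))).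
  move=> GQ; have cH : cvgn (fun k => al * F k - Qseq a b F k).
    by apply: resol_cvgn => //; rewrite -(funext GQ).
  have [M M0 HM] := cvgn_bounded cH.
  rewrite (BC_eq hab hs hadm al0 cF HM) // mulrBr [limn F * _]mulrC; congr (_ - _).
  rewrite -rsumZ; last exact: (rr_mul_asum hab hs hp al0 HM).
  congr rsum; apply/funext => j; rewrite hr mulrA mulrCA mulfV ?mulr1 //; exact: lt0r_neq0.
split=> -[GQ H]; split=> //; first by rewrite E // -H subrr mulr0.
by move/eqP: H; rewrite E // mulf_eq0 (gt_eqF d0) /= subr_eq0 => /eqP.
Qed.

Lemma gen_boundary : exists n g be, adm a b n g be /\
  forall F G, cvgn F -> cvgn G ->
  (gen p F G <-> (forall i, G i = Qseq a b F i) /\ BC a b n g be F = 0).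
Proof.
have [g hadm d1] := triple_of_generator hab hs hp hF.
exists (jump_weight a b p), g, (diffusion_weight a b p); split=> // F G.
apply: gen_BC ltr01 _ => // j.
by rewrite d1 divr1 (rr_numer hab hs hp hF).
Qed.

(** R_al maps [dlt j] into the domain of the generator, hence into the kernel of [BC], where [BC_RT]
    identifies it. *)
Lemma gen_resolvent n g be al i j : adm a b n g be -> 0 < al ->
  (forall F, cvgn F -> cvgn (Qseq a b F) -> gen p F (Qseq a b F) -> BC a b n g be F = 0) ->
  resolvent p al i j = RT a b n g be al (dlt j) i.
Proof.
move=> hadm al0 H; have cd : cvgn (dlt j : nat -> R) by exact: cvgn_dlt.
have dM := @dlt_norm R j; rewrite -RR_dlt.
have cR := RR_cvgn hab hs hp al0 dM.
have QR k := RR_gen hab hp k al0 dM.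
apply: (BC_RT hab hs hadm al0 cR dM) => [k|]; first by rewrite QR; ring.
by apply: H => //; rewrite (funext QR); [apply: is_cvgB => //; exact: is_cvgZr|exact: (gen_RR hab hs hp hF al0 cd)].
Qed.

End generator_boundary.

(** * The compactified state spaces *)

Section compactification.
Context {R : realType}.

(* Near-covering for the filter of the cofinal families of finite sets. *)
Lemma discrete_compact_finite (T : topologicalType) (K : set T) :
  (forall A : set T, open A) -> compact K -> finite_set K.
Proof.
move=> oT /compact_near_coveringP cK.
pose F := filter_from (@finite_set T) (fun D => [set B | D `<=` B]).
have FF : Filter F.
  apply: filter_from_filter; first by exists set0; exact: finite_set0.
  move=> A B fA fB; exists (A `|` B); first by rewrite finite_setU.
  by move=> C /= ABC; split=> x Dx; apply: ABC; [left|right].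
have [x Kx|D fD DK] := cK _ F (fun B x => B x) FF.
  exists ([set x], [set B | B x]) => [|[y B] /= [-> //]].
  split; first by apply: open_nbhs_nbhs; split.
  by exists [set x]; [exact: finite_set1|move=> B /=; apply].
exact: sub_finite_set (DK D (fun=> id)) fD.
Qed.

Lemma opc_continuousP (T : topologicalType) (f : one_point_compactification T -> R^o) :
  (forall A : set T, open A) ->
  continuous f <->
  (forall e, 0 < e -> finite_set [set x : T | e < `|f (Some x) - f None|]).
Proof.
move=> oT; split=> [cf e e0|H].
  have /cvgrPdist_le/(_ e e0)[U [cU _] UP] := cf None.
  apply: sub_finite_set (discrete_compact_finite oT cU) => x /= ex.
  apply: contrapT => Ux; have /= := UP (Some x) (or_introl (ex_intro2 _ _ x Ux erefl)).
  by rewrite distrC leNgt ex.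
case=> [y|].
  move=> A /= fA; rewrite /nbhs /= /nbhs /=.
  have : nbhs y [set y] by apply: open_nbhs_nbhs; split.
  by apply: filterS => z ->; exact: nbhs_singleton fA.
have FN := nbhs_filter (None : one_point_compactification T).
apply/(@cvgrPdist_le _ _ _ _ FN) => e e0.
exists [set x : T | e < `|f (Some x) - f None|].
  split; first exact: finite_compact (H e e0).
  by rewrite -openC; exact: oT.
move=> _ [[x /= /negP xe <-]|->]; last by rewrite subrr normr0 ltW.
by rewrite distrC leNgt.
Qed.

Lemma finite_bound (T : choiceType) (h : T -> nat) (A : set T) : finite_set A ->
  exists N : nat, forall x, A x -> (h x < N)%N.
Proof.
move=> /finite_seqP[s ->]; exists (\max_(x <- s) h x).+1 => x /= xs.
by rewrite ltnS (leq_bigmax_seq (P := xpredT)).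
Qed.

Lemma nbar_continuousP (F : nbar -> R^o) :
  continuous F <-> (fun k => F (Some k)) @ \oo --> F None.
Proof.
have o (A : set nat) : open A by exact: discrete_open.
rewrite (opc_continuousP _ o) cvgn_epsP; split=> H e e0.
  have [N HN] := finite_bound id (H e e0); exists N => n Nn.
  by rewrite leNgt; apply/negP => /HN; rewrite ltnNge Nn.
have [N HN] := H e e0; apply: sub_finite_set (finite_II N) => k /= ke.
by rewrite ltnNge; apply/negP => /HN; rewrite leNgt ke.
Qed.

Lemma fspace_continuousP (f : fspace -> R) :
  continuous f <-> (fun k => f (Some (Some k))) @ \oo --> f None.
Proof.
have o (A : set ntrap) : open A by exact: discrete_open.
rewrite (@opc_continuousP ntrap f o) cvgn_epsP; split=> H e e0.
  have [N HN] := finite_bound (fun x : option nat => odflt 0%N x) (H e e0); exists N => n Nn.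
  by rewrite leNgt; apply/negP => ne; have := HN (Some n) ne; rewrite /= ltnNge Nn.
have [N HN] := H e e0.
apply: (@sub_finite_set _ _ (None |` [set Some x | x in `I_N])).
  case=> [k|] /= ke; [right|by left]; exists k => //=.
  by rewrite ltnNge; apply/negP => /HN; rewrite leNgt ke.
by rewrite finite_setU; split; [exact: finite_set1|exact: finite_image (finite_II N)].
Qed.

Lemma uniform_cvg0P (U : choiceType) (h : R -> U -> R^o) (G : U -> R^o) :
  {uniform, h t @[t --> 0^'+] --> G} <->
  forall e, 0 < e -> exists2 d, 0 < d & forall t, 0 < t -> t < d ->
    forall x, `|h t x - G x| <= e.
Proof.
split=> H.
  move=> e e0; have /H : nbhs (G : {uniform U -> R^o}) [set g | forall x, `|g x - G x| <= e].
    apply/uniform_nbhs; exists [set xy | ball xy.1 e xy.2]; split; first exact: (@entourage_ball _ R^o (PosNum e0)).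
    by move=> g /= gG x; have /= := gG x I; rewrite /ball /= distrC => /ltW.
  move=> [d /= d0 Hd]; exists d => // t t0 td.
  by apply: Hd => //=; rewrite distrC subr0 gtr0_norm.
move=> P /uniform_nbhs[E [+ EP]]; rewrite -entourage_ballE => -[e /= e0 eE].
have [d d0 Hd] := H (e / 2) ltac:(lra).
exists d => //= t /=; rewrite distrC subr0 => td t0.
apply: EP => y _ /=; apply: eE; rewrite /ball /= distrC.
rewrite (gtr0_norm t0) in td; have := Hd t t0 td y; lra.
Qed.

End compactification.

(** * The Ray resolvent and the Feller semigroup on sequences *)

Section Feller_process.
Context {R : realType} (a b : nat -> R) (p : R -> nat -> nat -> R).
Hypotheses (hab : rates a b) (hs : (sigma a b < +oo)%E) (hp : Q_process a b p).
Implicit Types (G : nat -> R) (al t : R).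

Local Notation restr F := (fun k => F (Some k)).
Local Notation frestr f := (fun k => f (Some (Some k))).
Let one (k : nat) : `|1 : R| <= 1. Proof. by rewrite normr1. Qed.

Lemma PP_one t i : PP p t (fun=> 1) i = rsum (p t i).
Proof. by congr rsum; apply/funext => j; rewrite mulr1. Qed.

Lemma ray_resolvent_state al f i : 0 < al -> cvgn (frestr f) ->
  ray_resolvent p al f (Some (Some i)) =
  RR p al (frestr f) i + (al^-1 - RR p al (fun=> 1) i) * f (Some None).
Proof.
move=> al0 cf; have [M _ fM] := cvgn_bounded cf.
rewrite /= /kernel_sum /= (RR_rsum hp i al0 fM); congr (_ + _ * _).
have b1 : bcont `|1| (fun _ : R => 1 : R) by exact: bcont_cst.
rewrite -[X in X - _]mul1r -laplace_cst // -(laplaceB al0 b1 (PP_bcont hp i one)).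
by congr laplace; apply/funext => t; rewrite PP_one.
Qed.

Lemma ray_resolvent_cvg al f : 0 < al -> cvgn (frestr f) ->
  (fun i => ray_resolvent p al f (Some (Some i))) @ \oo -->
  limn (RR p al (frestr f)) + (al^-1 - limn (RR p al (fun=> 1))) * f (Some None).
Proof.
move=> al0 cf; have [M _ fM] := cvgn_bounded cf.
rewrite (funext (fun i => ray_resolvent_state i al0 cf)).
apply: cvgD; first exact: (RR_cvgn hab hs hp al0 fM).
by apply: cvgMl; apply: cvgB; [exact: cvg_cst|exact: (RR_cvgn hab hs hp al0 one)].
Qed.

(** Continuity of the Ray resolvent follows from sigma < oo, as R_al G always converges. The value
    of f at the trap has the coefficient 1 / al - R_al 1, which the case G = 1 controls. *)
Lemma FellerP : Feller_Q_process a b p <->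
  (forall G, cvgn G -> al * limn (RR p al G) @[al --> +oo] --> limn G).
Proof.
split=> [[_ _ H] G cG|H].
  pose f : fspace -> R := zero_ext (cont_ext G).
  have cf : continuous f by apply/fspace_continuousP; exact: cG.
  have /cvg_pinfty_epsP Hf := H f cf; apply/cvg_pinfty_epsP => e /Hf[A HA].
  exists (Num.max A 0) => al; rewrite gt_max => /andP[Aal al0].
  have := HA al Aal; congr (`| _ * _ - _| <= _).
  by apply/cvg_lim => //; have := @ray_resolvent_cvg al f al0 cG; rewrite mulr0 addr0.
have cvR (f : fspace -> R) : continuous f -> cvgn (frestr f).
  by move/fspace_continuousP => c; apply/cvg_ex; eexists; exact: c.
split=> // [al f al0 /cvR cf|f cf].
  apply/fspace_continuousP; apply: cvgP; exact: ray_resolvent_cvg.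
have cr := cvR f cf; have L := (fspace_continuousP f).1 cf.
have /cvg_pinfty_epsP H1 := H _ cr; have /cvg_pinfty_epsP H2 := H _ (@cvgn_cst R 1).
have l1 : limn (fun _ : nat => 1 : R) = 1 by exact: lim_cst.
apply/cvg_pinfty_epsP => e e0.
have c0 : 0 < 2 * (1 + `|f (Some None)|) by rewrite mulr_gt0 // ltr_pwDl.
have [A HA] := H1 (e / 2) ltac:(lra).
have [B HB] := H2 (e / (2 * (1 + `|f (Some None)|))) ltac:(by rewrite divr_gt0).
exists (Num.max (Num.max A B) 0) => al; rewrite !gt_max => /andP[/andP[Aal Bal] al0].
have -> : ray_resolvent p al f None = limn (RR p al (frestr f)) +
    (al^-1 - limn (RR p al (fun=> 1))) * f (Some None).
  by apply/cvg_lim => //; exact: ray_resolvent_cvg.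
have -> : al * (limn (RR p al (frestr f)) + (al^-1 - limn (RR p al (fun=> 1))) * f (Some None)) - f None
  = (al * limn (RR p al (frestr f)) - limn (frestr f)) -
    (al * limn (RR p al (fun=> 1)) - limn (fun _ : nat => 1 : R)) * f (Some None).
  rewrite l1 (cvg_lim _ L) //.
  have alg (x y z v : R) : al * (x + (al^-1 - y) * z) - v = al * x - v - (al * y - 1) * z.
    by field; exact: lt0r_neq0.
  exact: alg.
apply: (le_trans (ler_normB _ _)); rewrite normrM.
have := HA al Aal; have := HB al Bal; rewrite ler_pdivlMr // => h1 h2.
have := normr_ge0 (f (Some None)).
set x := `|al * limn (RR p al (fun=> 1)) - _| in h1 *; set y := `|f (Some None)| in h1 *.
have : 0 <= x by exact: normr_ge0.
nra.
Qed.

Lemma Feller_semigroup_state t F i : Feller_semigroup p t F (Some i) = PP p t (restr F) i.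
Proof. by rewrite /Feller_semigroup /= /kernel_sum /= mulr0 addr0. Qed.

Hypothesis hF : forall G, cvgn G -> al * limn (RR p al G) @[al --> +oo] --> limn G.

(** A bound uniform over nat passes to infinity because P_t F converges and its limit is the value
    of the semigroup there. *)
Lemma generator_limP (F G : nbar -> R^o) : continuous F -> continuous G ->
  generator_lim p F G <-> gen p (restr F) (restr G).
Proof.
move=> /nbar_continuousP cF /nbar_continuousP cG.
have cF' : cvgn (restr F) by apply/cvg_ex; eexists; exact: cF.
rewrite /generator_lim uniform_cvg0P; split=> H e e0; have [d d0 Hd] := H e e0.
  exists d => // t t0 td i; have := Hd t t0 td (Some i).
  by rewrite -[(t^-1 *: _) _]/(t^-1 * (Feller_semigroup p t F (Some i) - F (Some i)))
    Feller_semigroup_state mulrC.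
exists d => // t t0 td x.
rewrite -[(t^-1 *: _) _]/(t^-1 * (Feller_semigroup p t F x - F x)) mulrC.
have Hk i : `|(PP p t (restr F) i - F (Some i)) / t - G (Some i)| <= e by exact: Hd.
case: x => [i|]; first by rewrite Feller_semigroup_state.
have cP := PP_cvgn hab hs hp hF (ltW t0) cF'.
have -> : Feller_semigroup p t F None = limn (PP p t (restr F)).
  by rewrite -(funext (Feller_semigroup_state t F)).
have L : (fun i => `|(PP p t (restr F) i - F (Some i)) / t - G (Some i)|) @ \oo -->
    `|(limn (PP p t (restr F)) - F None) / t - G None|.
  by apply: cvg_norm; apply: cvgB => //; apply: cvgMl; apply: cvgB.
apply: (cvgn_le_lim L (cvg_cst e)) => i; exact: Hk.
Qed.

End Feller_process.

(** * Admissible triples and the boundary condition *)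

Section nat_measures.
Context {R : realType}.
Local Notation positive_measure := {measure set nat -> \bar R}.

Lemma nat_measureE (nu : positive_measure) (A : set nat) :
  nu A = (\sum_(0 <= k <oo | k \in A) nu [set k])%E.
Proof.
have {1}-> : A = \bigcup_(i in A) [set i] by rewrite bigcup_imset1 image_id.
by rewrite measure_bigcup // => i j _ _ [x [-> ->]].
Qed.

Lemma nat_measure_scale (nu nu' : positive_measure) (r : R) : 0 <= r ->
  (forall k, nu' [set k] = r%:E * nu [set k])%E -> forall A, (nu' A = r%:E * nu A)%E.
Proof.
move=> r0 H A; rewrite !nat_measureE -nneseriesZl //.
by apply: eq_eseriesr => k _; rewrite H.
Qed.

Lemma measure_of_weights (n : nat -> R) : (forall k, 0 <= n k) ->
  exists nu : positive_measure, forall k, nu [set k] = (n k)%:E.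
Proof.
move=> n0; pose m (k : nat) : positive_measure := mscale (NngNum (n0 k)) \d_k.
exists (mseries m 0) => k; rewrite /= /mseries.
have [|c E] := @rsum_single _ (fun j => n j * (j == k)%:R) k.
  by move=> j /negbTE ->; rewrite mulr0.
rewrite eqxx mulr1 in E; rewrite -E -esum_asum => [|j|//]; last by rewrite mulr_ge0.
by apply: eq_eseriesr => j _; rewrite /m /= /mscale /= diracE in_set1.
Qed.

Lemma esum_asum_iff (h : nat -> R) : (forall k, 0 <= h k) ->
  (\sum_(0 <= k <oo) (h k)%:E = +oo)%E <-> ~ asum h.
Proof.
move=> h0; split=> [E c|nc]; first by rewrite esum_asum in E.
apply: contrapT => /eqP; rewrite -ltey => /(asum_esum h0); exact: nc.
Qed.

End nat_measures.

(** * Admissible triples in terms of sequences, and their uniqueness *)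

Section admissible_triples.
Context {R : realType} (a b : nat -> R).
Hypotheses (hab : rates a b) (hbd : regular_bd a b || exit_bd a b).
Local Notation mu := (mu a b).
Local Notation Qseq := (Qseq a b).
Local Notation positive_measure := {measure set nat -> \bar R}.
Implicit Types (nu : positive_measure) (F : nat -> R).

Lemma sigma_fin : (sigma a b < +oo)%E.
Proof. by case/orP: hbd => /andP[]. Qed.

Let hs := sigma_fin.

Lemma scale_ge0 k : 0 <= scale a b k.
Proof. by elim: k => // k IH; apply: le_trans IH (ltW (scale_lt hab k)). Qed.

Lemma scale_le k : scale a b k <= rsum (st a b).
Proof.
have st0 j := ltW (st_gt0 hab j).
apply: le_trans (rsum_part k (asum_st hab hs) st0).
elim: k => [|k IH]; first by rewrite big_geq.
have -> : \sum_(0 <= i < k.+1) st a b i = \sum_(0 <= i < k) st a b i + st a b k.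
  by rewrite big_nat_recr.
have := scaleS hab k; rewrite invfM => E.
have := bmu_st hab k; lra.
Qed.

(** The scale is bounded by the sum of [st], and from state 1 on it is at least its positive value
    at 1, so lambda is comparable to the total mass of mu. *)
Lemma lambda_mu : asum mu <-> (lambda a b < +oo)%E.
Proof.
have m0 k := ltW (mu_gt0 hab k).
have sm0 k : 0 <= scale a b k * mu k by rewrite mulr_ge0 ?scale_ge0.
split=> [c|/(asum_esum sm0) c].
  rewrite /lambda esum_asum ?ltry //.
  apply: asum_dom (asumZ (c := rsum (st a b)) c) _ => k.
  have r0 := le_trans (scale_ge0 0) (scale_le 0).
  by rewrite (ger0_norm (sm0 k)) (ger0_norm (mulr_ge0 r0 (m0 k))) ler_wpM2r ?scale_le.
have s1 : 0 < scale a b 1 by have := scale_lt hab 0.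
(* The scale vanishes at 0 and gives no control on mu_0 = 1, which this indicator of state 0
   accounts for. *)
have [c0 _] := @rsum_single _ (fun k => if k == 0%N then 1 else 0 : R) 0 (fun k k0 => ifN_eq _ _ k0).
apply: asum_dom (asumD (asumZ (c := (scale a b 1)^-1) c) c0) _ => k.
have s0 : 0 <= (scale a b 1)^-1 * (scale a b k * mu k) by rewrite mulr_ge0 ?invr_ge0 ?(ltW s1).
rewrite (ger0_norm (m0 k)) ger0_norm; last by rewrite addr_ge0 //; case: ifP.
case: k s0 => [|k] s0; first by rewrite eqxx [leLHS](mu0 a b) lerDr.
by rewrite /= addr0 ler_pdivlMl // ler_wpM2r //; exact: scale_ge1.
Qed.

Lemma exit_mu : exit_bd a b <-> ~ asum mu.
Proof.
rewrite /exit_bd hs /=; split=> [/eqP l /lambda_mu|nc]; first by rewrite l ltxx.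
by apply: contrapT => /negP; rewrite -ltey => /lambda_mu.
Qed.

Lemma esigma_tail k : (\sum_(k <= j <oo) sigma_term a b j = (tl a b k)%:E)%E.
Proof.
have st0 j : 0 <= st a b j by exact: ltW (st_gt0 hab j).
have E := @nneseries_split R (sigma_term a b) 0 k (fun j _ => ltac:(rewrite lee_fin; exact: st0)).
have := esum_asum st0 (asum_st hab hs); rewrite -[X in X = _]/(\sum_(0 <= j <oo) sigma_term a b j)%E.
rewrite E add0n sumEFin /tl; case: (\sum_(k <= j <oo) _)%E => [s| |] //= [<-].
by rewrite addrC addrK.
Qed.

Definition point_mass nu k : R := fine (nu [set k]).

Lemma point_mass_ge0 nu k : 0 <= point_mass nu k. Proof. exact: fine_ge0. Qed.

(** Every tail of sigma is positive, so an infinite point mass would make the sum in condition (a)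
    infinite. *)
Lemma admissible_fin nu g be : admissible a b nu g be -> forall k, nu [set k] = (point_mass nu k)%:E.
Proof.
move=> [_ H _ _ _] k; rewrite /point_mass fineK // ge0_fin_numE //.
rewrite ltey; apply/eqP => nuk; move: H; apply/negP; rewrite -leNgt.
apply: le_trans (nneseries_lim_ge k.+1 _) => [|j _]; last first.
  by rewrite esigma_tail mule_ge0 ?lee_fin ?tl_ge0.
rewrite big_nat_recr //= nuk esigma_tail gt0_mulye ?lte_fin ?tl_gt0 //.
by rewrite leeDr // sume_ge0 // => j _; rewrite esigma_tail mule_ge0 ?lee_fin ?tl_ge0.
Qed.

Lemma admissibleP nu g be :
  admissible a b nu g be <->
  (forall k, nu [set k] = (point_mass nu k)%:E) /\ adm a b (point_mass nu) g be.
Proof.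
have w0 := point_mass_ge0 nu; have t0 k := tl_ge0 hab hs k.
have wt0 k : 0 <= point_mass nu k * tl a b k by rewrite mulr_ge0.
have Et : (forall k, nu [set k] = (point_mass nu k)%:E) ->
    ((\sum_(0 <= k <oo) nu [set k] * \sum_(k <= j <oo) sigma_term a b j) =
     \sum_(0 <= k <oo) (point_mass nu k * tl a b k)%:E)%E.
  by move=> E; apply: eq_eseriesr => k _; rewrite E esigma_tail.
have Em : (forall k, nu [set k] = (point_mass nu k)%:E) ->
    (total_mass nu = \sum_(0 <= k <oo) (point_mass nu k)%:E)%E.
  by move=> E; apply: eq_eseriesr => k _; rewrite E.
split=> [h|[E [_ [g0 be0] ct cmu act]]].
  have E := admissible_fin h; case: h => -[g0 be0] H _ ex act; split=> //; split=> //.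
  - by apply: asum_esum => //; rewrite -Et.
  - by move=> be1; apply: contrapT => /exit_mu/ex be0'; rewrite be0' ltxx in be1.
  - by case: act => [tm|]; [left; apply/esum_asum_iff; rewrite -?Em|right].
split=> //.
- by rewrite Et // esum_asum // ltry.
- have t1 : (0 <= total_mass nu)%E by apply: nneseries_ge0.
  apply/eqP; case: act => [/(esum_asum_iff w0)|be1 /eqP]; first by rewrite -Em // => ->; rewrite addye.
  by rewrite padde_eq0 ?lee_fin // eqe (gt_eqF be1) andbF.
- move=> /exit_mu nc; apply: contrapT => b1; apply: nc; apply: cmu.
  by rewrite lt_neqAle be0 andbT eq_sym; apply/eqP.
- by case: act => [/(esum_asum_iff w0)|]; [rewrite -Em //; left|right].
Qed.

Section boundary_functional.
Variables (nu : positive_measure) (g be : R).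
Hypothesis hadm : admissible a b nu g be.
Variable F : nbar -> R^o.
Hypothesis hF : Qdomain a b F.
Let f k := F (Some k).

Lemma Qdomain_cvg : [/\ f @ \oo --> F None, cvgn f & cvgn (Qseq f)].
Proof.
case: hF => /nbar_continuousP cF /nbar_continuousP cQ; split=> //.
by apply/cvg_ex; eexists; exact: cF.
Qed.

Lemma right_derivE k : right_deriv a b F k = 2 * \sum_(0 <= i < k.+1) mu i * Qseq f i.
Proof.
have b0 := lt0r_neq0 (bmu_gt0 hab k).
by rewrite /right_deriv scaleS // invrK -(Qseq_sum_mu hab) mulrC -mulrA.
Qed.

(** The right derivative is twice a partial sum of mu QF, which matches beta / 2 with the
    coefficient be of [BC]. If infinity is not an exit, mu is summable and the limits exist; if it
    is, be = 0. *)
Lemma boundary_conditionP :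
  boundary_condition a b nu g be F <-> BC a b (point_mass nu) g be f = 0.
Proof.
have [L cf cQ] := Qdomain_cvg; have [_ A] := (admissibleP nu g be).1 hadm.
have [M M0 fM] := cvgn_bounded cf; have [N N0 QN] := cvgn_bounded cQ.
have GM k : `|1 * f k - Qseq f k| <= M + N.
  by rewrite mul1r (le_trans (ler_normB _ _)) // lerD.
have [cJ _] := BC_sum hab hs A ltr01 cf GM (fun=> erefl).
have JE : jump_term nu F = fun k => (limn f - f k) * point_mass nu k.
  by apply/funext => k; rewrite (cvg_lim _ L).
have RE : ~~ exit_bd a b -> right_deriv a b F @ \oo --> 2 * rsum (fun i => mu i * Qseq f i).
  move=> /negP ne; have cm : asum mu by apply: contrapT => /exit_mu.
  rewrite (funext right_derivE); apply: cvgZr.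
  have c := rsum_cvg (asum_mulr cm QN).
  apply/cvgn_epsP => e /((cvgn_epsP _ _).1 c)[m Hm]; exists m => k mk.
  by apply: Hm; rewrite leqW.
split.
  case=> _ _; rewrite JE /BC (cvg_lim _ L) //.
  case: ifPn => [/exit_mu ex|/RE c].
    by have -> : be = 0; [case: hadm => _ _ _ -> //; apply/exit_mu|rewrite mul0r].
  rewrite (cvg_lim _ c) // => H; by rewrite -[RHS]H; congr (_ + _ + _); field.
move=> H; split.
- by move=> /RE c; apply/cvg_ex; eexists; exact: c.
- by rewrite JE; exact: asum_cvg.
- rewrite -[RHS]H JE /BC (cvg_lim _ L) //; congr (_ + _ + _).
  case: ifPn => [/exit_mu ex|/RE c].
    by have -> : be = 0; [case: hadm => _ _ _ -> //; apply/exit_mu|rewrite mul0r].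
  by rewrite (cvg_lim _ c) //; field.
Qed.

End boundary_functional.

(** A functional vanishing on the kernel of another is a multiple of it. The ratio r is read on u,
    where [BC] takes the value [denom 1]; evaluating on [dlt k] and on 1 then compares the masses
    and the killing constants. *)
Lemma BC_proportional n g be n' g' be' :
  adm a b n g be -> adm a b n' g' be' -> (~ asum mu -> be = 0 /\ be' = 0) ->
  (forall F, cvgn F -> cvgn (Qseq F) -> BC a b n g be F = 0 -> BC a b n' g' be' F = 0) ->
  exists2 r : R, 0 < r & [/\ forall k, n' k = r * n k, g' = r * g & be' = r * be].
Proof.
move=> A A' hbe H.
have d0 := denom_gt0 hab hs A ltr01; have d0' := denom_gt0 hab hs A' ltr01.
pose r := denom a b n' g' be' 1 / denom a b n g be 1.
have r0 : 0 < r by rewrite divr_gt0.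
have u0 k := uu_gt0 hab hs (@ltr01 R) k; have u1 := uu_norm hab hs (@ltr01 R).
have cu : cvgn (uu a b 1) by apply/cvg_ex; exists 1; exact: uu_cvg.
have BCr F : cvgn F -> cvgn (Qseq F) -> BC a b n' g' be' F = r * BC a b n g be F.
  move=> cF cQ; pose c := BC a b n g be F / denom a b n g be 1.
  have := H (fun k => F k - c * uu a b 1 k).
  rewrite (BC_subuu hab hs A ltr01 c cF cQ) (BC_subuu hab hs A' ltr01 c cF cQ).
  have -> : Qseq (fun k => F k - c * uu a b 1 k) = fun k => Qseq F k - c * uu a b 1 k.
    by apply/funext => k; rewrite QseqB QseqZ uu_eq // mul1r.
  have cc : cvgn (fun k => c * uu a b 1 k) by exact: is_cvgZr.
  move=> /(_ (is_cvgB cF cc) (is_cvgB cQ cc)).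
  rewrite /c divfK ?subrr ?lt0r_neq0 // => /(_ erefl)/subr0_eq ->.
  by rewrite /r; ring.
have nE k : n' k = r * n k.
  have c := @cvgn_dlt R k; have cQ : cvgn (Qseq (dlt k)).
    apply/cvg_ex; exists 0; apply/cvgn_epsP => e e0; exists k.+2 => j kj; rewrite Qseq_dlt.
    have [-> -> ->] : [/\ (j == k.+1) = false, (j == k) = false & (j.+1 == k) = false].
      by split; lia.
    by rewrite !mulr0 subrr addr0 subrr normr0 ltW.
  have := BCr _ c cQ; rewrite !BC_dlt //; lra.
have gE : g' = r * g.
  have c := @cvgn_cst R 1; have cQ : cvgn (Qseq (fun=> 1)).
    by rewrite (funext (fun k => Qseq_cst hab 1 k)); exact: cvgn_cst.
  by have := BCr _ c cQ; rewrite !BC_cst.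
exists r => //; split=> //.
(* What remains of the values at u, once the masses and killing constants are matched, is beta times
   a positive sum. *)
have [cm|/hbe[-> ->]] := pselect (asum mu); last by rewrite mulr0.
have cmu : asum (fun k => mu k * uu a b 1 k) by exact: asum_mulr u1.
have S0 : 0 < rsum (fun k => mu k * uu a b 1 k).
  apply: lt_le_trans (rsum_term 0 cmu _) => [|k].
    by rewrite mulr_gt0 ?mu_gt0.
  by rewrite mulr_ge0 // ltW ?mu_gt0.
have : denom a b n' g' be' 1 = r * denom a b n g be 1.
  by rewrite /r divfK // lt0r_neq0.
rewrite /denom gE (rsumZ be cmu) (rsumZ be' cmu).
have -> : rsum (fun k => n' k * (1 - uu a b 1 k)) = r * rsum (fun k => n k * (1 - uu a b 1 k)).
  rewrite -rsumZ; last exact: (asum_nu hab hs A ltr01).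
  by congr rsum; apply/funext => k; rewrite nE mulrA.
rewrite !mul1r => E; apply: (mulIf (lt0r_neq0 S0)); lra.
Qed.

End admissible_triples.

(** * The generator and its resolvent formula *)

Section resolvent_formula.
Context {R : realType} (a b : nat -> R).
Hypotheses (hab : rates a b) (hbd : regular_bd a b || exit_bd a b).
Let hs : (sigma a b < +oo)%E := sigma_fin hbd.
Variables (nu : {measure set nat -> \bar R}) (g be : R) (pm : R -> nat -> nat -> R).
Hypotheses (hadm : admissible a b nu g be) (hm : minimal_Q_process a b pm).
Local Notation n := (point_mass nu).
Let A : adm a b n g be := ((admissibleP hab hbd nu g be).1 hadm).2.

Lemma adm_killing c : 0 <= c -> adm a b n (g + c) be.
Proof.
by case: A => n0 [g0 be0] ct cm act c0; split=> //; split=> //; rewrite addr_ge0.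
Qed.

Lemma transition_bcont p i j : Q_process a b p -> bcont 1 (fun t => p t i j).
Proof.
move=> hp; have := PP_bcont hp i (@dlt_norm R j); congr bcont.
by apply/funext => t; rewrite PP_dlt.
Qed.

(* The processes with killing rate at infinity increased by c dominate pm, and
   their resolvents decrease to Phi as c grows. *)
Lemma minimal_resolvent al i j : 0 < al -> resolvent pm al i j = Phi a b al i j.
Proof.
move=> al0; case: hm => hpm hmin; apply/eqP; rewrite eq_le Phi_le_resolvent // andbT.
apply: le_eps => e e0.
have d0 := denom_gt0 hab hs A al0; have u0 := uu_gt0 hab hs al0 i.
pose C := uu a b al i * numer a b n be al j.
have C0 : 0 <= C by rewrite mulr_ge0 ?(ltW u0) ?(numer_ge0 hab hs A al0).
(* The added killing c = C / e makes the boundary part C / (denom + c) of the dominating resolvent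
   at most e. *)
have A' := adm_killing (divr_ge0 C0 (ltW e0)).
have hT := pT_process hab hs A'.
have := le_laplace al0 (transition_bcont i j hpm) (transition_bcont i j hT) (fun t => hmin _ hT t i j).
move=> /le_trans; apply.
rewrite -[laplace _ _]/(resolvent _ al i j) (pT_resolvent hab hs A' i j al0) RT_dlt //.
have -> : denom a b n (g + C / e) be al = denom a b n g be al + C / e.
  by rewrite /denom; ring.
rewrite lerD2l mulrA -/C ler_pdivrMr; last by rewrite ltr_wpDr // divr_ge0 // ltW.
by rewrite mulrDr mulrCA mulfV ?mulr1 ?lerDr ?mulr_ge0 ?(ltW e0) ?(ltW d0) // lt0r_neq0.
Qed.

Lemma minimal_u al i : 0 < al -> u_fun pm al i = uu a b al i.
Proof.
move=> al0; rewrite /u_fun (funext (fun j => minimal_resolvent i j al0)).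
by rewrite (Phi_rsum hab hs al0); ring.
Qed.

Lemma resolvent_formulaE al i j : 0 < al ->
  resolvent_formula a b pm nu g be al i j = (RT a b n g be al (dlt j) i)%:E.
Proof.
move=> al0; have nuE := ((admissibleP hab hbd nu g be).1 hadm).1.
have d0 := denom_gt0 hab hs A al0; have n0 := point_mass_ge0 nu.
rewrite /resolvent_formula RT_dlt // minimal_resolvent // !minimal_u //.
have -> : (\sum_(0 <= k <oo) nu [set k] * (resolvent pm al k j)%:E)%E =
    (rsum (fun k => n k * Phi a b al k j))%:E.
  rewrite -(esum_asum _ (@asum_nPhi _ _ _ hab hs _ _ _ A _ al0 j)) => [|k]; last by rewrite mulr_ge0 ?Phi_ge0.
  by apply: eq_eseriesr => k _; rewrite nuE minimal_resolvent.
have -> : (\sum_(0 <= k <oo) nu [set k] * (1 - u_fun pm al k)%:E)%E =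
    (rsum (fun k => n k * (1 - uu a b al k)))%:E.
  rewrite -(esum_asum _ (asum_nu hab hs A al0)) => [|k]; last by rewrite mulr_ge0 ?(u1_ge0 hab hs al0).
  by apply: eq_eseriesr => k _; rewrite nuE minimal_u.
have -> : ((be * al)%:E * \sum_(0 <= k <oo) (mu a b k * u_fun pm al k)%:E)%E =
    (al * rsum (fun k => be * (mu a b k * uu a b al k)))%:E.
  have uE k : u_fun pm al k = uu a b al k by exact: minimal_u.
  under eq_eseriesr do rewrite uE.
  (* When infinity is an exit the series is infinite and be = 0: the product is 0 by the convention
     on extended reals. *)
  have [cm|nc] := pselect (asum (mu a b)); last first.
    have -> : be = 0 by case: hadm => _ _ _ -> //; exact/(exit_mu hab hbd).
    have [|_ ->] := @rsum_fin _ (fun k => 0 * (mu a b k * uu a b al k)) 0; first by move=> k _; rewrite mul0r.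
    by rewrite big_geq // mul0r mulr0 mul0e.
  have cmu : asum (fun k => mu a b k * uu a b al k) by exact: (asum_mulr cm (uu_norm hab hs al0)).
  rewrite esum_asum // => [|k]; last by rewrite mulr_ge0 // ltW ?mu_gt0 ?uu_gt0.
  by rewrite rsumZ // -EFinM; congr EFin; ring.
by rewrite -!EFinD inver gt_eqF // -!EFinM -EFinD -mulrA.
Qed.

End resolvent_formula.

(** * Generators described by triples *)

Section generator_triple.
Context {R : realType} (a b : nat -> R).
Hypotheses (hab : rates a b) (hbd : regular_bd a b || exit_bd a b).
Let hs : (sigma a b < +oo)%E := sigma_fin hbd.
Local Notation positive_measure := {measure set nat -> \bar R}.

Section one_process.
Variables (p : R -> nat -> nat -> R) (nu : positive_measure) (g be : R).
Hypotheses (hp : Feller_Q_process a b p) (hadm : admissible a b nu g be).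
Let hQ : Q_process a b p. Proof. by case: hp. Qed.
Let hF := (FellerP hab hs hQ).1 hp.

Lemma generator_lim_boundary (F G : nbar -> R^o) :
  (forall F G : nat -> R, cvgn F -> cvgn G ->
    (gen p F G <-> (forall i, G i = Qseq a b F i) /\ BC a b (point_mass nu) g be F = 0)) ->
  continuous F -> continuous G ->
  generator_lim p F G <-> [/\ G = Qop a b F, Qdomain a b F & boundary_condition a b nu g be F].
Proof.
move=> H cF cG; rewrite (generator_limP hab hs hQ hF cF cG).
have /nbar_continuousP lF := cF; have /nbar_continuousP lG := cG.
rewrite H; [|by apply/cvg_ex; eexists; exact: lF|by apply/cvg_ex; eexists; exact: lG].
have QE : (forall i, G (Some i) = Qseq a b (fun k => F (Some k)) i) -> G = Qop a b F.
  move=> GQ; apply/funext => -[i|]; first exact: GQ.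
  by rewrite /= -(cvg_lim _ lG) //; congr (limn _); apply/funext => i; exact: GQ.
split=> [[GQ B]|[GQ dF bF]].
  have GE := QE GQ; have dF : Qdomain a b F by split; rewrite -?GE.
  by split=> //; apply/(boundary_conditionP hab hbd hadm dF).
by split; [rewrite GQ|apply/(boundary_conditionP hab hbd hadm dF)].
Qed.

(** The assumed description of [gen] turns the two definitions of the domain into each other. It
    comes from [gen_boundary] for a given process, and from [gen_BC] with [pT_rr] for the
    constructed one. *)
Lemma generator_triple D L : linear_operator D L ->
  (forall F G : nat -> R, cvgn F -> cvgn G ->
    (gen p F G <-> (forall i, G i = Qseq a b F i) /\ BC a b (point_mass nu) g be F = 0)) ->
  is_generator p D L <-> boundary_triple a b D L nu g be.
Proof.
move=> [cL _ _] H.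
have E : [set F : nbar -> R^o | continuous F /\ exists2 G, continuous G & generator_lim p F G] =
  [set F | Qdomain a b F /\ boundary_condition a b nu g be F].
  apply/seteqP; split=> F /=.
    by move=> [cF [G cG /(generator_lim_boundary H cF cG)[]]].
  move=> [dF bF]; have [cF cQ] := dF; split=> //; exists (Qop a b F) => //.
  by apply/(generator_lim_boundary H cF cQ).
split=> [[DE LE]|[_ DE LE]].
  split=> //; first by rewrite DE.
  by move=> F DF; have [cF cLF] := cL F DF; have /(generator_lim_boundary H cF cLF)[] := LE F DF.
split=> [|F DF]; first by rewrite E.
have [cF cLF] := cL F DF; apply/(generator_lim_boundary H cF cLF).
by rewrite LE //; move: DF; rewrite DE => -[].
Qed.

(** This holds for any triple describing D, not only for the one extracted from p: equality of the
    two descriptions of D is all that [gen_resolvent] needs. *)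
Lemma generator_resolvent D L al i j : is_generator p D L ->
  boundary_triple a b D L nu g be -> 0 < al ->
  resolvent p al i j = RT a b (point_mass nu) g be al (dlt j) i.
Proof.
move=> [DE _] [_ DE' _] al0; have [_ A] := (admissibleP hab hbd nu g be).1 hadm.
apply: (gen_resolvent hab hs hQ hF i j A al0) => F cF cQ gF.
have cF' : continuous (cont_ext F) by apply/nbar_continuousP.
have cG' : continuous (Qop a b (cont_ext F)) by apply/nbar_continuousP.
have : D (cont_ext F).
  by rewrite DE; split=> //; exists (Qop a b (cont_ext F)) => //; apply/(generator_limP hab hs hQ hF cF' cG').
by rewrite DE' => -[dF bF]; exact/(boundary_conditionP hab hbd hadm dF).
Qed.

End one_process.

Lemma boundary_triple_unique D L (nu nu' : positive_measure) g be g' be' :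
  boundary_triple a b D L nu g be -> boundary_triple a b D L nu' g' be' ->
  proportional nu g be nu' g' be'.
Proof.
move=> [h DE _] [h' DE' _].
have [nuE A] := (admissibleP hab hbd nu g be).1 h.
have [nuE' A'] := (admissibleP hab hbd nu' g' be').1 h'.
have [||r r0 [nr gr br]] := BC_proportional hab hbd A A'.
- by move=> /(exit_mu hab hbd) ex; split; [case: h|case: h'] => _ _ _ ->.
- move=> F cF cQ B.
  have dF : Qdomain a b (cont_ext F) by split; apply/nbar_continuousP.
  have : D (cont_ext F) by rewrite DE; split=> //; exact/(boundary_conditionP hab hbd h dF).
  by rewrite DE' => -[_]; exact: (boundary_conditionP hab hbd h' dF).1.
exists r => //; split=> //; apply: nat_measure_scale (ltW r0) _ => k.
by rewrite nuE nuE' nr EFinM.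
Qed.

End generator_triple.

Theorem theorem6p3 (R : realType) (a b : nat -> R) (hab : rates a b)
    (hbd : regular_bd a b || exit_bd a b)
    (D : set (nbar -> R^o)) (L : (nbar -> R^o) -> nbar -> R^o)
    (hL : linear_operator D L) :
  ((exists2 p, Feller_Q_process a b p & is_generator p D L) <->
   (exists (nu : {measure set nat -> \bar R}) (gamma beta : R),
      boundary_triple a b D L nu gamma beta /\
      forall (nu' : {measure set nat -> \bar R}) (gamma' beta' : R),
        boundary_triple a b D L nu' gamma' beta' ->
        proportional nu gamma beta nu' gamma' beta')) /\
  (forall p, Feller_Q_process a b p -> is_generator p D L ->
   forall (nu : {measure set nat -> \bar R}) (gamma beta : R),
     boundary_triple a b D L nu gamma beta ->
   forall pm, minimal_Q_process a b pm ->
   forall (alpha : R) (i j : nat), 0 < alpha ->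
     (resolvent p alpha i j)%:E =
     resolvent_formula a b pm nu gamma beta alpha i j).
Proof.
have hs := sigma_fin hbd; split; [split|].
- move=> [p hp hg]; have [hQ _ _] := hp; have hF := (FellerP hab hs hQ).1 hp.
  have [n [g [be [A H]]]] := gen_boundary hab hs hQ hF.
  have [nu nuE] := measure_of_weights (let: And5 n0 _ _ _ _ := A in n0).
  have wE : point_mass nu = n by apply/funext => k; rewrite /point_mass nuE.
  rewrite -wE in A H.
  have hadm : admissible a b nu g be.
    by apply/(admissibleP hab hbd); split=> // k; rewrite wE nuE.
  have T := (generator_triple hab hbd hp hadm hL H).1 hg.
  by exists nu, g, be; split=> // nu' g' be'; exact: (boundary_triple_unique hab hbd T).
- move=> [nu [g [be [T _]]]]; have [hadm _ _] := T.
  have [_ A] := (admissibleP hab hbd nu g be).1 hadm.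
  have hQ := pT_process hab hs A.
  have hF := pT_nonbranching hab hs A.
  have hp := (FellerP hab hs hQ).2 hF.
  exists (pT a b (point_mass nu) g be) => //.
  apply/(generator_triple hab hbd hp hadm hL) => // F G cF cG.
  apply: (gen_BC hab hs hQ hF A (@ltr01 R) _ cF cG) => j.
  exact: (pT_rr hab hs A j ltr01).
move=> p hp hg nu g be T pm hm al i j al0; have [hadm _ _] := T.
by rewrite (resolvent_formulaE hab hbd hadm hm) // (generator_resolvent hab hbd hp hadm i j hg T al0).
Qed.
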